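(* Let $N\ge3$. An $N$-dimensional Finsler space $(M,F)$ is an $\mathcal F^N$-space if and only if the indicatrix $\mathcal I_x$ of the Finsler space is a space of constant curvature (for each $x\in M$). Moreover, in an $\mathcal F^N$-space the dependence of the conformal multiplier $f$ on the variable $y$ is given by a power of the Finsler metric function: $$g_{\{x\}}(y)=p^2\,u_{\{x\}}(y),\qquad p=c_1(x)\left(F(x,y)\right)^{a(x)},\qquad c_1(x)>0,$$ and the curvature value $\mathcal C_{\rm Ind.}(x)$ of the indicatrix $\mathcal I_x$ satisfies $\mathcal C_{\rm Ind.}=H^2$ with $H=1-a$. (The assertion is local both in the base manifold and in the tangent space.)
   Context: $F(x,y)$ is a Finsler metric function on $TM$ (positive and positively homogeneous of degree 1 on the tangent spaces with the origin removed), $g_{\{x\}}(y)$ the Finsler metric tensor $g_{ij}=\frac12\partial^2F^2/\partial y^i\partial y^j$ at fixed $x$, regarded as a Riemannian metric on $T_xM$ with variable $y$ (this gives the tangent Riemannian space $\mathcal R_{\{x\}}=\{T_xM,g_{\{x\}}(y)\}$). The indicatrix $\mathcal I_x=\{y\in T_xM:F(x,y)=1\}$ carries the Riemannian metric induced from $\mathcal R_{\{x\}}$. $(M,F)$ is called an $\mathcal F^N$-space if it is a deformed Riemannian space: there are a Riemannian metric $S=\sqrt{a_{mn}(x)y^my^n}$ on $M$ and, in each tangent space $T_xM$ (not moving the point $x$), a sufficiently smooth invertible, in general non-linear, transformation $y\leftrightarrow\bar y$, $\bar y=\bar y(x,y)$, positively homogeneous in $y$ of a degree $H=H(x)$, taking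 unit vectors of $F$ to unit vectors of $S$ and conversely, such that the metric tensor $g_{\{x\}}(y)$ is conformal to the pull-back of the Euclidean metric tensor $a_{mn}(x)$ of $T_xM$ under this transformation. Thus $g_{\{x\}}(y)=f(x,y)\,u_{\{x\}}(y)$, where the tensor $u_{\{x\}}(y)$ has identically vanishing Riemannian curvature tensor (in the variable $y$), and the positive smooth conformal multiplier $f$ is homogeneous in $y$, its degree of homogeneity being denoted $2a(x)$; then $H=1-a$, and $a\ne1$.
   Formalization: In the form local in the tangent space the indicatrix is required to have constant positive curvature, since flat indicatrices on a cone give counterexamples; when F is regular on all tangent spaces with the origin removed, no sign condition is imposed. *)

(* Defs.v *)
From mathcomp Require Import all_boot all_order all_algebra.
From mathcomp Require Import all_classical all_reals all_analysis.

Set Implicit Arguments.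
Unset Strict Implicit.
Unset Printing Implicit Defensive.

Import Order.TTheory GRing.Theory Num.Theory.
Import numFieldNormedType.Exports.

Local Open Scope classical_set_scope.
Local Open Scope ring_scope.

(* In finite dimension, asking for the iterated derivatives along all fixed
   vectors is the same as asking for the iterated partial derivatives. *)
Fixpoint Ck (R : realType) (V W : normedModType R) (k : nat)
    (U : set V) (f : V -> W) : Prop :=
  match k with
  | 0%N => forall z, U z -> {for z, continuous f}
  | k'.+1 => (forall z, U z -> differentiable f z) /\
             (forall v : V, Ck k' U (fun z => 'D_v f z))
  end.

Definition smooth_on (R : realType) (V W : normedModType R)
    (U : set V) (f : V -> W) : Prop :=
  forall k, Ck k U f.

Definition partial_der (R : realType) (n : nat) (W : normedModType R)
    (i : 'I_n) (f : 'rV[R]_n -> W) (x : 'rV[R]_n) : W :=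
  'D_(delta_mx 0 i : 'rV[R]_n) f x.

Definition bilin (R : realType) (n : nat) (B : 'M[R]_n) (v w : 'rV[R]_n) : R :=
  (v *m B *m w^T) 0 0.

Definition posdef (R : realType) (n : nat) (B : 'M[R]_n) : Prop :=
  B^T = B /\ forall v : 'rV[R]_n, v != 0 -> 0 < bilin B v v.

(* christoffel G k i j = Gamma^k_{ij} *)
Definition christoffel (R : realType) (n : nat) (G : 'rV[R]_n -> 'M[R]_n)
    (k i j : 'I_n) (x : 'rV[R]_n) : R :=
  2^-1 * \sum_l invmx (G x) k l *
    (partial_der i (fun z => G z j l) x + partial_der j (fun z => G z i l) x
     - partial_der l (fun z => G z i j) x).

(* riemann G l k i j = R^l_{kij}, the d_l-component of
   R(d_i, d_j) d_k, with R(X, Y) = [nabla_X, nabla_Y] - nabla_[X, Y] *)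
Definition riemann (R : realType) (n : nat) (G : 'rV[R]_n -> 'M[R]_n)
    (l k i j : 'I_n) (x : 'rV[R]_n) : R :=
  partial_der i (christoffel G l j k) x - partial_der j (christoffel G l i k) x
  + \sum_p (christoffel G l i p x * christoffel G p j k x
            - christoffel G l j p x * christoffel G p i k x).

(* On V the metric G has constant sectional curvature C:
   R_{lkij} = C (G_{li} G_{kj} - G_{lj} G_{ki}). *)
Definition const_curvature (R : realType) (n : nat) (V : set 'rV[R]_n)
    (G : 'rV[R]_n -> 'M[R]_n) (C : R) : Prop :=
  forall w, V w -> forall l k i j : 'I_n,
    \sum_m G w l m * riemann G m k i j w
    = C * (G w l i * G w k j - G w l j * G w k i).

(* The base manifold is represented by a coordinate domain M in R^N, so that
   points of TM are pairs (x, y) of a base point and a tangent vector. *)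

Definition conic (R : realType) (N : nat)
    (D : set ('rV[R]_N * 'rV[R]_N)) : Prop :=
  forall x y (l : R), 0 < l -> D (x, y) -> D (x, l *: y).

Definition slit_tangent (R : realType) (N : nat) (M : set 'rV[R]_N) :
    set ('rV[R]_N * 'rV[R]_N) :=
  [set z | M z.1 /\ z.2 != 0].

(* g_{ij}(x, y) = 1/2 d^2 F^2 / dy^i dy^j *)
Definition fundamental_tensor (R : realType) (N : nat)
    (F : 'rV[R]_N * 'rV[R]_N -> R) (x y : 'rV[R]_N) : 'M[R]_N :=
  \matrix_(i, j)
    (2^-1 * partial_der i (partial_der j (fun y' => F (x, y') ^+ 2)) y).

(* D is the set of tangent vectors where F is regular: the whole slit tangent
   bundle, or, for assertions local in the tangent spaces, an open conic
   subset of it. *)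
Record finsler_space (R : realType) (N : nat) (M : set 'rV[R]_N)
    (D : set ('rV[R]_N * 'rV[R]_N)) (F : 'rV[R]_N * 'rV[R]_N -> R) : Prop :=
  FinslerSpace {
    finsler_base_open : open M;
    finsler_domain_open : open D;
    finsler_domain_sub : D `<=` slit_tangent M;
    finsler_domain_conic : conic D;
    finsler_domain_fiber : forall x, M x -> exists y, D (x, y);
    finsler_smooth : smooth_on D F;
    finsler_pos : forall x y, D (x, y) -> 0 < F (x, y);
    finsler_hom : forall x y (l : R), 0 < l -> D (x, y) ->
      F (x, l *: y) = l * F (x, y);
    finsler_posdef : forall x y, D (x, y) -> posdef (fundamental_tensor F x y)
  }.

Definition indicatrix (R : realType) (N : nat)
    (D : set ('rV[R]_N * 'rV[R]_N)) (F : 'rV[R]_N * 'rV[R]_N -> R)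
    (x : 'rV[R]_N) : set 'rV[R]_N :=
  [set y | D (x, y) /\ F (x, y) = 1].

(* phi is an immersion of the same dimension as the indicatrix, hence its
   local inverses are charts; conversely every chart gives such a phi. *)
Definition indicatrix_param (R : realType) (N : nat)
    (D : set ('rV[R]_N * 'rV[R]_N)) (F : 'rV[R]_N * 'rV[R]_N -> R)
    (x : 'rV[R]_N) (V : set 'rV[R]_N.-1)
    (phi : 'rV[R]_N.-1 -> 'rV[R]_N) : Prop :=
  [/\ open V, smooth_on V phi,
      (forall w, V w -> indicatrix D F x (phi w)) &
      (forall w, V w -> forall v : 'rV[R]_N.-1, 'D_v phi w = 0 -> v = 0)].

(* The metric induced on the indicatrix by g_{x}(y), in the coordinates phi. *)
Definition induced_metric (R : realType) (N : nat)
    (F : 'rV[R]_N * 'rV[R]_N -> R) (x : 'rV[R]_N)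
    (phi : 'rV[R]_N.-1 -> 'rV[R]_N) (w : 'rV[R]_N.-1) : 'M[R]_N.-1 :=
  \matrix_(i, j) bilin (fundamental_tensor F x (phi w))
                       (partial_der i phi w) (partial_der j phi w).

Definition indicatrix_const_curvature (R : realType) (N : nat)
    (D : set ('rV[R]_N * 'rV[R]_N)) (F : 'rV[R]_N * 'rV[R]_N -> R)
    (x : 'rV[R]_N) (C : R) : Prop :=
  forall V phi, indicatrix_param D F x V phi ->
    const_curvature V (induced_metric F x phi) C.

Definition riemannian_metric (R : realType) (N : nat) (M : set 'rV[R]_N)
    (A : 'rV[R]_N -> 'M[R]_N) : Prop :=
  (forall i j : 'I_N, smooth_on M (fun x => A x i j)) /\
  (forall x, M x -> posdef (A x)).

(* S(x, v) = sqrt (a_mn(x) v^m v^n) *)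
Definition riemannian_norm (R : realType) (N : nat)
    (A : 'rV[R]_N -> 'M[R]_N) (x v : 'rV[R]_N) : R :=
  Num.sqrt (bilin (A x) v v).

(* The pull-back u_{x}(y) of the Euclidean metric A x of the tangent space at x
   under y |-> ybar (x, y). *)
Definition pullback_metric (R : realType) (N : nat)
    (A : 'rV[R]_N -> 'M[R]_N) (ybar : 'rV[R]_N * 'rV[R]_N -> 'rV[R]_N)
    (x y : 'rV[R]_N) : 'M[R]_N :=
  \matrix_(i, j) bilin (A x)
    (partial_der i (fun y' => ybar (x, y')) y)
    (partial_der j (fun y' => ybar (x, y')) y).

(* On the open conic set W of tangent vectors, ybar deforms the Riemannian
   metric A into F, with degree of homogeneity H x, and the conformal
   multiplier f has degree of homogeneity 2 a(x). *)
Record deformation (R : realType) (N : nat) (F : 'rV[R]_N * 'rV[R]_N -> R)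
    (A : 'rV[R]_N -> 'M[R]_N) (H a : 'rV[R]_N -> R)
    (W : set ('rV[R]_N * 'rV[R]_N))
    (ybar : 'rV[R]_N * 'rV[R]_N -> 'rV[R]_N)
    (f : 'rV[R]_N * 'rV[R]_N -> R) : Prop :=
  Deformation {
    deform_open : open W;
    deform_conic : conic W;
    deform_smooth : smooth_on W ybar;
    deform_inj : forall x y y', W (x, y) -> W (x, y') ->
      ybar (x, y) = ybar (x, y') -> y = y';
    deform_regular : forall x y, W (x, y) -> forall v : 'rV[R]_N,
      'D_v (fun y' => ybar (x, y')) y = 0 -> v = 0;
    deform_hom : forall x y (l : R), 0 < l -> W (x, y) ->
      ybar (x, l *: y) = (l `^ H x) *: ybar (x, y);
    deform_unit : forall x y, W (x, y) ->
      (F (x, y) = 1 <-> riemannian_norm A x (ybar (x, y)) = 1);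
    deform_mult_smooth : smooth_on W f;
    deform_mult_pos : forall x y, W (x, y) -> 0 < f (x, y);
    deform_mult_hom : forall x y (l : R), 0 < l -> W (x, y) ->
      f (x, l *: y) = l `^ (2 * a x) * f (x, y);
    deform_conformal : forall x y, W (x, y) ->
      fundamental_tensor F x y = f (x, y) *: pullback_metric A ybar x y
  }.

(* The deformation is local in TM; the metric A and the degrees H and a are
   common to all the local deformations. *)
Definition FN_structure (R : realType) (N : nat) (M : set 'rV[R]_N)
    (D : set ('rV[R]_N * 'rV[R]_N)) (F : 'rV[R]_N * 'rV[R]_N -> R)
    (A : 'rV[R]_N -> 'M[R]_N) (H a : 'rV[R]_N -> R) : Prop :=
  riemannian_metric M A /\
  forall z, D z -> exists W ybar f,
    [/\ W z, W `<=` D & deformation F A H a W ybar f].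

Definition FN_space (R : realType) (N : nat) (M : set 'rV[R]_N)
    (D : set ('rV[R]_N * 'rV[R]_N)) (F : 'rV[R]_N * 'rV[R]_N -> R) : Prop :=
  exists A H a, FN_structure M D F A H a.

(* Main.v *)
Require Import Defs.
From mathcomp Require Import all_boot all_order all_algebra.
From mathcomp Require Import all_classical all_reals all_analysis.
From HB Require Import structures.
From mathcomp Require Import ring lra perm.

Import Order.TTheory GRing.Theory Num.Theory.
Import numFieldNormedType.Exports.

Local Open Scope classical_set_scope.
Local Open Scope ring_scope.

Set Implicit Arguments.
Unset Strict Implicit.
Unset Printing Implicit Defensive.

(** Fix a point [x] of the base.  In an F^N-space, Euler's identity applied to
    the deformation [ybar] of degree [H] and to [F^2 = g(y, y)] gives
    [S(ybar) = F^H] and [f = H^-2 F^(2 - 2H)]; comparing degrees, [H = 1 - a],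
    and [H] cannot vanish ([deform_norm], [deform_energy], [deform_multiplier]).
    So [f] is the constant [H^-2] on the indicatrix, which [ybar] maps into the
    unit sphere of a Euclidean space: its metric is [H^-2] times a metric of
    curvature 1 ([round_sphere_curvature], [FN_curvature]).

    Conversely, in polar coordinates [y = F phi] the fundamental tensor is the
    cone metric [dF^2 + F^2 G], where [G] is the metric of the indicatrix
    ([fundamental_tensor_polar]).  If [psi] maps the indicatrix into the unit
    sphere and multiplies [G] by [H^2], then [F^H psi] multiplies the cone
    metric by [H^2 F^(2H - 2)] ([developed_conformal]).  Such a [psi] exists
    when [G] has constant curvature [C = H^2]: a linear coordinate [u] of the
    Euclidean space, restricted to the sphere, satisfies [Hess u = - C u G];
    with [u] and its first derivatives as unknowns this is a total differential
    system, integrable exactly because the curvature is [C]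
    ([sphere_system_flat]).  The solutions whose initial values form an
    orthonormal frame for [C G] keep the Gram matrix of such a frame, and they
    separate the points near the centre ([parametric_development]).

    The deformation has to depend smoothly on [x], so the system is solved with
    parameters ([total_system_solution]).  Along the rays it becomes a linear
    integral equation, solved by iteration.  The solution is smooth because
    its difference quotients solve an equation of the same form on the doubled
    space, so that each step gains one derivative ([radial_smooth]).  The
    integrability condition then propagates the equations from the radial
    direction to all directions.

    If [F] is regular on the whole slit tangent space, then a constant
    curvature is automatically positive.  The indicatrix together with its
    Legendre transform is a centroaffine hypersurface, whose Gauss equation
    compares its curvature with that of the unit sphere through a cubic form,
    the Cartan tensor ([dual_curvature], [sphere_cubic]).  The determinant of
    [g] is homogeneous of degree zero, hence attains its maximum; there the
    cubic form is traceless, and contracting Gauss' equation gives that the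
    curvature is at least 1 ([stationary_apolar], [apolar_curvature],
    [slit_curvature_ge1]). *)

(** * Functions of class C^k *)

Section Differentiability.
Context {R : realType}.

(** A continuous linear map that approximates the increments of [f] to first
    order is the differential of [f]. *)
Lemma differentiable_eps (V W : normedModType R) (f : V -> W) (x : V)
    (L : V -> W) : linear L -> continuous L ->
  (forall e, 0 < e -> \forall h \near (0 : V),
     `|f (h + x) - f x - L h| <= e * `|h|) ->
  differentiable f x /\ forall v, 'D_v f x = L v.
Proof.
move=> Llin Lc H.
pose LM := GRing.isLinear.Build _ _ _ _ _ Llin.
pose LL : {linear V -> W} := HB.pack L LM.
have Lc' : continuous LL by exact: Lc.
have E : f \o shift x = cst (f x) + LL +o_ 0 id.
  apply/eqaddoP => e e0; near=> h => /=.
  have -> : (f \o shift x - (cst (f x) + LL)) h = f (h + x) - f x - L h.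
    by rewrite /= opprD addrA.
  near: h; exact: H.
have dE := diff_unique Lc' E.
have df : differentiable f x.
  by apply/diff_locallyP; rewrite dE; split => //.
by split => // v; rewrite deriveE// dE.
Unshelve. all: by end_near. Qed.

Lemma differentiable_near (V W : normedModType R) (f : V -> W) (x : V) :
  differentiable f x -> forall e, 0 < e -> \forall h \near (0 : V),
     `|f (h + x) - f x - 'd f x h| <= e * `|h|.
Proof.
move=> /diff_locally /eqaddoP H e e0; near=> h.
have -> : f (h + x) - f x - 'd f x h = (f \o shift x - (cst (f x) + 'd f x)) h.
  by rewrite /= opprD addrA.
near: h; exact: H.
Unshelve. all: by end_near. Qed.

Lemma near_eq_differentiable (V W : normedModType R) (f g : V -> W) (x : V) :
  (\near x, f x = g x) -> differentiable f x -> differentiable g x.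
Proof.
move=> fg df.
suff [] : differentiable g x /\ forall v, 'D_v g x = 'd f x v by [].
apply: differentiable_eps; first exact: linearP.
  exact: diff_continuous.
move=> e e0; have fgx := nbhs_singleton fg.
have fgs : \forall h \near (0 : V), f (h + x) = g (h + x).
  by move: fg; rewrite (near_shift 0) subr0.
near=> h; rewrite -fgx -(near fgs h)//; near: h.
exact: differentiable_near.
Unshelve. all: by end_near. Qed.

Lemma derive_pair_snd (U V W : normedModType R) (f : U * V -> W) (x : U) (y v : V) :
  'D_v (fun y' => f (x, y')) y = 'D_((0, v) : U * V) f (x, y).
Proof.
rewrite /derive; apply: (f_equal (fun u : R -> W => lim (u @ 0^'))).
apply/funext => h /=; suff -> : h *: ((0, v) : U * V) + (x, y) = (x, h *: v + y) by [].
by apply: injective_projections => //=; rewrite scaler0 add0r.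
Qed.

End Differentiability.

Section Smooth.
Context {R : realType}.
Implicit Types (V W : normedModType R).

Lemma CkW V W k (U : set V) (f : V -> W) : Ck k.+1 U f -> Ck k U f.
Proof.
elim: k f => [|k IH] f [df Df].
  by move=> z Uz; apply: differentiable_continuous; exact: df.
by split=> // v; apply: IH.
Qed.

Lemma Ck_le V W k m (U : set V) (f : V -> W) : (k <= m)%N -> Ck m U f -> Ck k U f.
Proof.
move=> /subnK <-; elim: (m - k)%N => // n IH H; apply: IH; exact: CkW.
Qed.

Lemma Ck_subset V W k (U U' : set V) (f : V -> W) :
  U' `<=` U -> Ck k U f -> Ck k U' f.
Proof.
move=> s; elim: k f => [|k IH] f; first by move=> H z /s /H.
by move=> [df Df]; split => [z /s /df//|v]; apply: IH; exact: Df.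
Qed.

Lemma eq_Ck V W k (U : set V) (f g : V -> W) : open U ->
  (forall z, U z -> f z = g z) -> Ck k U f -> Ck k U g.
Proof.
move=> oU; elim: k f g => [|k IH] f g fg.
  move=> cf z Uz; have nz : \near z, f z = g z.
    by near=> y; apply: fg; near: y; exact: open_nbhs_nbhs.
  suff : g @ z --> g z by []; rewrite -(fg _ Uz); apply: cvg_trans (cf z Uz).
  exact: near_eq_cvg.
move=> [df Df].
have nz z : U z -> \near z, f z = g z.
  by move=> Uz; near=> y; apply: fg; near: y; exact: open_nbhs_nbhs.
split => [z Uz|v].
  exact: near_eq_differentiable (nz z Uz) (df z Uz).
apply: IH (Df v) => z Uz; exact/near_eq_derive/nz.
Unshelve. all: by end_near. Qed.

Lemma Ck_cst V W k (U : set V) (a : W) : Ck k U (cst a : V -> W).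
Proof.
elim: k a => [|k IH] a; first by move=> z _; apply: cst_continuous.
split => [z _|v]; first exact: differentiable_cst.
have -> : (fun z => 'D_v (cst a) z) = (cst 0 : V -> W).
  by apply/funext => z; rewrite derive_cst.
exact: IH.
Qed.

Lemma CkD V W k (U : set V) (f g : V -> W) : open U ->
  Ck k U f -> Ck k U g -> Ck k U (fun z => f z + g z).
Proof.
move=> oU; elim: k f g => [|k IH] f g.
  by move=> cf cg z Uz; apply: continuousD; [apply: cf|apply: cg].
move=> [df Df] [dg Dg]; split => [z Uz|v].
  by apply: differentiableD; [apply: df|apply: dg].
apply: eq_Ck (IH _ _ (Df v) (Dg v)) => // z Uz.
by rewrite (@deriveD _ _ _ f g)//; apply: diff_derivable; [apply: df|apply: dg].
Qed.

Lemma CkM V k (U : set V) (f g : V -> R) : open U ->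
  Ck k U f -> Ck k U g -> Ck k U (fun z => f z * g z).
Proof.
move=> oU; elim: k f g => [|k IH] f g.
  by move=> cf cg z Uz; apply: continuousM; [apply: cf|apply: cg].
move=> cf cg; have [df Df] := cf; have [dg Dg] := cg; split => [z Uz|v].
  by apply: differentiableM; [apply: df|apply: dg].
have H : Ck k U (fun z => f z * 'D_v g z + g z * 'D_v f z).
  by apply: CkD => //; apply: IH; do ?exact: CkW; [exact: Dg|exact: Df].
apply: eq_Ck H => // z Uz.
by rewrite (@deriveM _ _ f g)//; apply: diff_derivable; [apply: df|apply: dg].
Qed.

Lemma CkZl V W k (U : set V) (f : V -> R) (a : W) : open U ->
  Ck k U f -> Ck k U (fun z => f z *: a).
Proof.
move=> oU; elim: k f => [|k IH] f.
  by move=> cf z Uz; apply: continuousZr_tmp; exact: cf.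
move=> [df Df]; split => [z Uz|v]; first by apply: differentiableZl; exact: df.
apply: eq_Ck (IH _ (Df v)) => // z Uz.
have dz : differentiable (fun z => f z *: a) z by apply: differentiableZl; exact: df.
by rewrite [RHS]deriveE// diffZl ?deriveE//; exact: df.
Qed.

Lemma CkZ V W k (U : set V) (f : V -> W) (c : R) : open U ->
  Ck k U f -> Ck k U (fun z => c *: f z).
Proof.
move=> oU; elim: k f => [|k IH] f.
  by move=> cf z Uz; apply: continuousZl_tmp; exact: cf.
move=> [df Df]; split => [z Uz|v]; first by apply: differentiableZ; exact: df.
apply: eq_Ck (IH _ (Df v)) => // z Uz.
by rewrite (@deriveZ _ _ _ f)//; apply: diff_derivable; apply: df.
Qed.

Lemma CkN V W k (U : set V) (f : V -> W) : open U ->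
  Ck k U f -> Ck k U (fun z => - f z).
Proof.
move=> oU /(CkZ (-1) oU); apply: eq_Ck => // z _; by rewrite scaleN1r.
Qed.

Lemma CkB V W k (U : set V) (f g : V -> W) : open U ->
  Ck k U f -> Ck k U g -> Ck k U (fun z => f z - g z).
Proof. by move=> oU cf cg; apply: CkD => //; exact: CkN. Qed.

Lemma Ck_sum V W k (U : set V) (I : Type) (r : seq I) (P : pred I)
    (f : I -> V -> W) : open U ->
  (forall i, P i -> Ck k U (f i)) -> Ck k U (fun z => \sum_(i <- r | P i) f i z).
Proof.
move=> oU H; elim: r => [|i r IH].
  by apply: eq_Ck (@Ck_cst V W k U 0) => // z _; rewrite big_nil.
have [Pi|Pi] := boolP (P i).
  apply: eq_Ck (CkD oU (H i Pi) IH) => // z _; by rewrite big_cons Pi.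
by apply: eq_Ck IH => // z _; rewrite big_cons (negbTE Pi).
Qed.

Lemma Ck_prod V k (U : set V) (I : Type) (r : seq I) (P : pred I)
    (f : I -> V -> R) : open U ->
  (forall i, P i -> Ck k U (f i)) -> Ck k U (fun z => \prod_(i <- r | P i) f i z).
Proof.
move=> oU H; elim: r => [|i r IH].
  by apply: eq_Ck (@Ck_cst V R k U 1) => // z _; rewrite big_nil.
have [Pi|Pi] := boolP (P i).
  apply: eq_Ck (CkM oU (H i Pi) IH) => // z _; by rewrite big_cons Pi.
by apply: eq_Ck IH => // z _; rewrite big_cons (negbTE Pi).
Qed.

Lemma CkV V k (U : set V) (f : V -> R) : open U ->
  (forall z, U z -> f z != 0) -> Ck k U f -> Ck k U (fun z => (f z)^-1).
Proof.
move=> oU f0; elim: k => [|k IH].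
  by move=> cf z Uz; apply: (@continuousV _ _ f) => //; [exact: f0|exact: cf].
move=> cf; have [df Df] := cf; split => [z Uz|v].
  by apply: differentiableV; [exact: df|exact: f0].
have H : Ck k U (fun z => - ((f z)^-1 * (f z)^-1 * 'D_v f z)).
  have cV : Ck k U (fun z => (f z)^-1) by apply: IH; exact: CkW.
  by apply: CkN => //; apply: CkM => //; [exact: CkM|exact: Df].
apply: eq_Ck H => // z Uz.
rewrite (@deriveV _ _ f)//; [|exact: f0|by apply: diff_derivable; apply: df].
by rewrite /GRing.scale/= mulNr expr2 invfM.
Qed.

Lemma diff_scalar_comp V (f : V -> R) (g : R -> R) (z : V) (d : R) :
  differentiable f z -> is_derive (f z) 1 g d ->
  differentiable (g \o f) z /\ forall v, 'D_v (g \o f) z = 'D_v f z * d.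
Proof.
move=> df dg; have Dg : differentiable g (f z) by apply/derivable1_diffP; exact: ex_derive.
have Dgf : differentiable (g \o f) z by apply: differentiable_comp.
split => // v; rewrite deriveE// diff_comp//= deriveE//.
rewrite -[X in 'd g _ X]mulr1 [LHS]linearZ; congr (_ * _).
by rewrite -deriveE//; exact: derive_val.
Qed.

Lemma Ck_expR V k (U : set V) (f : V -> R) : open U ->
  Ck k U f -> Ck k U (fun z => expR (f z)).
Proof.
move=> oU; elim: k => [|k IH].
  move=> cf z Uz; apply: (continuous_comp (cf z Uz)); exact: continuous_expR.
move=> cf; have [df Df] := cf.
have D z (Uz : U z) := diff_scalar_comp (df z Uz) (is_derive_expR (f z)).
split => [z /D[]//|v].
have H : Ck k U (fun z => 'D_v f z * expR (f z)).
  by apply: CkM => //; [exact: Df|apply: IH; exact: CkW].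
by apply: eq_Ck H => // z /D[_ ->].
Qed.

Lemma Ck_ln V k (U : set V) (f : V -> R) : open U ->
  (forall z, U z -> 0 < f z) -> Ck k U f -> Ck k U (fun z => ln (f z)).
Proof.
move=> oU f0; case: k => [|k].
  move=> cf z Uz; apply: (continuous_comp (cf z Uz)); apply: continuous_ln; exact: f0.
move=> cf; have [df Df] := cf.
have D z (Uz : U z) := diff_scalar_comp (df z Uz) (is_derive1_ln (f0 z Uz)).
split => [z /D[]//|v].
have H : Ck k U (fun z => 'D_v f z * (f z)^-1).
  apply: CkM => //; first exact: Df.
  by apply: CkV => //; [move=> z /f0 /lt0r_neq0|exact: CkW].
by apply: eq_Ck H => // z /D[_ ->].
Qed.

(** [f `^ p] is the exponential of [p * ln f]. *)
Lemma Ck_powR V k (U : set V) (f p : V -> R) : open U ->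
  (forall z, U z -> 0 < f z) -> Ck k U f -> Ck k U p ->
  Ck k U (fun z => f z `^ p z).
Proof.
move=> oU f0 cf cp.
apply: eq_Ck (Ck_expR oU (CkM oU cp (Ck_ln oU f0 cf))) => // z Uz.
by rewrite /powR gt_eqF ?f0.
Qed.

Lemma Ck_linear V W k (U : set V) (L : V -> W) : linear L -> continuous L ->
  Ck k U L.
Proof.
move=> Ll Lc.
have D z : differentiable L z /\ forall v, 'D_v L z = L v.
  apply: differentiable_eps => // e e0; near=> h.
  have -> : L (h + z) - L z - L h = 0.
    have := Ll 1 h z; rewrite !scale1r => ->; by rewrite addrK subrr.
  by rewrite normr0 mulr_ge0// ltW.
case: k => [|k]; first by move=> z _; exact: Lc.
split => [z _|v]; first by have [] := D z.
suff -> : (fun z => 'D_v L z) = cst (L v) by exact: Ck_cst.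
by apply/funext => z; have [_ ->] := D z.
Unshelve. all: by end_near. Qed.

End Smooth.

(** * Coordinates and the chain rule *)

Section LinearDerivative.
Context {R : realType}.
Implicit Types (U V W : normedModType R).

Lemma differentiable_linear_comp V W U (f : U -> V) (L : V -> W) (z : U) :
  linear L -> continuous L -> differentiable f z ->
  differentiable (L \o f) z /\ forall v, 'D_v (L \o f) z = L ('D_v f z).
Proof.
move=> Llin Lc df.
pose LM := GRing.isLinear.Build _ _ _ _ _ Llin.
pose LL : {linear V -> W} := HB.pack L LM.
have dL : differentiable L (f z) by exact: (@linear_differentiable _ _ _ LL).
have dLf : differentiable (L \o f) z by exact: differentiable_comp.
split => // v; rewrite deriveE// diff_comp//= deriveE//.
by rewrite (@diff_lin _ _ _ LL).
Qed.

Lemma derive_comp U V W (f : V -> W) (g : U -> V) (z v : U) :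
  differentiable g z -> differentiable f (g z) ->
  'D_v (f \o g) z = 'D_('D_v g z) f (g z).
Proof.
move=> dg df; have dfg : differentiable (f \o g) z by exact: differentiable_comp.
by rewrite deriveE// diff_comp//= -!deriveE.
Qed.

Lemma Ck_pair U V W k (O : set U) (f : U -> V) (g : U -> W) : open O ->
  Ck k O f -> Ck k O g -> Ck k O (fun z => (f z, g z)).
Proof.
move=> oO; elim: k f g => [|k IH] f g.
  by move=> cf cg z Oz; apply: cvg_pair; [exact: cf|exact: cg].
move=> [df Df] [dg Dg]; have dfg z : O z -> differentiable (fun z => (f z, g z)) z.
  by move=> Oz; apply: differentiable_pair; [exact: df|exact: dg].
split => // v; apply: eq_Ck (IH _ _ (Df v) (Dg v)) => // z Oz.
rewrite [RHS]deriveE//; last exact: dfg.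
by rewrite (diff_pair (df _ Oz) (dg _ Oz))/= !deriveE//; [exact: dg|exact: df].
Qed.

End LinearDerivative.

(** A finite system of coordinates on a normed space; it makes finite
    dimensional normed spaces, and products of them, uniformly accessible
    to arguments by partial derivatives. *)
Record frame (R : realType) (V : normedModType R) := Frame {
  fidx : finType;
  fvec : fidx -> V;
  fcoord : fidx -> V -> R;
  fcoord_linear : forall i, linear (fcoord i);
  fcoord_continuous : forall i, continuous (fcoord i);
  frameE : forall v, v = \sum_i fcoord i v *: fvec i }.

Arguments fvec {R V} f i.
Arguments fcoord {R V} f i v.
Arguments fcoord_linear {R V} f i.
Arguments fcoord_continuous {R V} f i.
Arguments frameE {R V} f v.

Section Frames.
Context {R : realType}.
Implicit Types (U V W : normedModType R).

Definition row_frame (n : nat) : frame 'rV[R]_n.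
Proof.
exists 'I_n (fun i => delta_mx 0 i : 'rV[R]_n) (fun i (v : 'rV[R]_n) => v 0 i).
- by move=> i a u v; rewrite !mxE.
- by move=> i; exact: coord_continuous.
- by move=> v; exact: row_sum_delta.
Defined.

Definition real_frame : frame R.
Proof.
exists unit (fun=> 1) (fun=> id).
- by [].
- by move=> i x.
- by move=> v; rewrite (bigD1 tt)//= big1 ?addr0 => [|[]//]; rewrite /GRing.scale/= mulr1.
Defined.

Definition prod_frame V W (fV : frame V) (fW : frame W) : frame (V * W)%type.
Proof.
exists (fidx fV + fidx fW)%type
  (fun i => match i with inl i => (fvec fV i, 0) | inr i => (0, fvec fW i) end)
  (fun i v => match i with inl i => fcoord fV i v.1 | inr i => fcoord fW i v.2 end).
- by move=> [i|i] a u v /=; rewrite fcoord_linear.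
- move=> [i|i] v; apply: (@continuous_comp _ _ _ _ (fcoord _ i)).
  + exact: cvg_fst.
  + exact: fcoord_continuous.
  + exact: cvg_snd.
  + exact: fcoord_continuous.
- move=> v; rewrite big_sumType/=.
  have E1 : \sum_i fcoord fV i v.1 *: ((fvec fV i, 0) : V * W) = (v.1, 0).
    rewrite [in RHS](frameE fV v.1); elim/big_ind2: _ => //.
      by move=> x1 x2 y1 y2 -> ->; apply: injective_projections => //=; rewrite addr0.
    by move=> i _; apply: injective_projections => //=; rewrite scaler0.
  have E2 : \sum_i fcoord fW i v.2 *: ((0, fvec fW i) : V * W) = (0, v.2).
    rewrite [in RHS](frameE fW v.2); elim/big_ind2: _ => //.
      by move=> x1 x2 y1 y2 -> ->; apply: injective_projections => //=; rewrite addr0.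
    by move=> i _; apply: injective_projections => //=; rewrite scaler0.
  by rewrite E1 E2; apply: injective_projections => //=; rewrite ?addr0 ?add0r.
Defined.

Lemma derive_frame V W (fV : frame V) (f : V -> W) (z v : V) :
  differentiable f z -> 'D_v f z = \sum_i fcoord fV i v *: 'D_(fvec fV i) f z.
Proof.
move=> df; rewrite deriveE// {1}(frameE fV v) linear_sum.
by apply: eq_bigr => i _; rewrite linearZ/= deriveE.
Qed.

Lemma Ck_linear_comp V W U k (O : set U) (f : U -> V) (L : V -> W) : open O ->
  linear L -> continuous L -> Ck k O f -> Ck k O (fun z => L (f z)).
Proof.
move=> oO Ll Lc; elim: k f => [|k IH] f.
  by move=> cf z Oz; apply: continuous_comp; [exact: cf|exact: Lc].
move=> [df Df]; split => [z Oz|v].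
  by have [] := differentiable_linear_comp Ll Lc (df z Oz).
apply: eq_Ck (IH _ (Df v)) => // z Oz.
by have [_ /(_ v)] := differentiable_linear_comp Ll Lc (df z Oz).
Qed.

Lemma Ck_coord U V k (O : set U) (fV : frame V) (f : U -> V) i : open O ->
  Ck k O f -> Ck k O (fun z => fcoord fV i (f z)).
Proof.
move=> oO; apply: Ck_linear_comp => //.
  exact: fcoord_linear.
exact: fcoord_continuous.
Qed.

Lemma Ck_of_coords U V k (O : set U) (fV : frame V) (f : U -> V) : open O ->
  (forall i, Ck k O (fun z => fcoord fV i (f z))) -> Ck k O f.
Proof.
move=> oO H.
have {}H : Ck k O (fun z => \sum_i fcoord fV i (f z) *: fvec fV i).
  by apply: Ck_sum => // i _; exact: CkZl.
by apply: eq_Ck H => // z _; rewrite -frameE.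
Qed.

(** By induction on the order: the derivative of the composite along a fixed
    vector is a sum of products of coordinates of the derivative of [g] and of
    composites of partial derivatives of [f] with [g]. *)
Lemma Ck_comp U V k (O : set U) (O' : set V) (fV : frame V) (f : V -> R)
    (g : U -> V) : open O -> Ck k O g -> Ck k O' f ->
  (forall z, O z -> O' (g z)) -> Ck k O (fun z => f (g z)).
Proof.
move=> oO; elim: k f g => [|k IH] f g.
  by move=> cg cf gO z Oz; apply: continuous_comp; [exact: cg|exact/cf/gO].
move=> cg cf gO; have [df Df] := cf; have [dg Dg] := cg; split => [z Oz|v].
  by apply: differentiable_comp; [exact: dg|exact/df/gO].
have H : Ck k O (fun z => \sum_i fcoord fV i ('D_v g z) * 'D_(fvec fV i) f (g z)).
  apply: Ck_sum => // i _; apply: CkM => //.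
    by apply: Ck_coord => //; exact: Dg.
  by apply: (IH ('D_(fvec fV i) f) g) => //; [exact: CkW|exact: Df].
apply: eq_Ck H => // z Oz; rewrite (@derive_comp _ _ _ _ f g)//; last 2 first.
- exact: dg.
- exact/df/gO.
by rewrite (derive_frame fV)//; exact/df/gO.
Qed.

Lemma smooth_row U n (O : set U) k (f : U -> 'rV[R]_n) : open O ->
  (forall i, Ck k O (fun z => f z 0 i)) -> Ck k O f.
Proof. by move=> oO H; apply: (Ck_of_coords (fV := row_frame n)) => // i; exact: H. Qed.

Lemma Ck_fst_comp U V W k (O : set U) (f : U -> V * W) : open O ->
  Ck k O f -> Ck k O (fun z => (f z).1).
Proof.
move=> oO; apply: (@Ck_linear_comp _ _ _ _ _ _ (fun p : V * W => p.1)) => //.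
by move=> z; exact: cvg_fst.
Qed.

Lemma Ck_snd_comp U V W k (O : set U) (f : U -> V * W) : open O ->
  Ck k O f -> Ck k O (fun z => (f z).2).
Proof.
move=> oO; apply: (@Ck_linear_comp _ _ _ _ _ _ (fun p : V * W => p.2)) => //.
by move=> z; exact: cvg_snd.
Qed.

Lemma Ck_id U k (O : set U) : Ck k O (fun z : U => z).
Proof. by apply: Ck_linear => // z. Qed.

Lemma Ck_der U W k (O : set U) (f : U -> W) v : Ck k.+1 O f -> Ck k O ('D_v f).
Proof. by move=> [_]; apply. Qed.

Lemma Ck_continuous U W k (O : set U) (f : U -> W) z :
  Ck k O f -> O z -> {for z, continuous f}.
Proof. by move=> /(Ck_le (leq0n _)) H Oz; exact: H. Qed.

End Frames.

(** * Second derivatives and linear differential equations *)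

Section Segments.
Context {R : realType}.
Implicit Types (U V W : normedModType R).

Lemma is_derive_line V (f : V -> R) (z v : V) (t : R) :
  differentiable f (z + t *: v) ->
  is_derive t 1 (fun t => f (z + t *: v)) ('D_v f (z + t *: v)).
Proof.
move=> df; pose g := fun t : R => z + t *: v.
have dg : is_derive t (1 : R) g v.
  have -> : v = 0 + 1 *: v by rewrite add0r scale1r.
  have d1 : is_derive t (1 : R) (cst z) 0 by exact: is_derive_cst.
  suff d2 : is_derive t (1 : R) (fun t : R => t *: v) (1 *: v) by exact: (is_deriveD d1 d2).
  have ds : differentiable (fun t : R => t *: v) t.
    by apply: (differentiableZl v); exact: ex_diff.
  apply: DeriveDef; first exact: diff_derivable.
  by rewrite deriveE// diff_val.
have dgt : differentiable g t by apply/derivable1_diffP; exact: ex_derive.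
have dfg : differentiable (f \o g) t by exact: differentiable_comp.
apply: DeriveDef; first exact: (@diff_derivable _ _ _ (f \o g)).
by rewrite (@derive_comp _ _ _ _ f g)// derive_val.
Qed.

Lemma mvt_line V (f : V -> R) (z v : V) :
  (forall t : R, 0 <= t <= 1 -> differentiable f (z + t *: v)) ->
  exists2 t : R, 0 < t < 1 & f (z + v) - f z = 'D_v f (z + t *: v).
Proof.
move=> df.
have [t] : exists2 t, t \in `]0, 1[%R &
    f (z + 1 *: v) - f (z + 0 *: v) = 'D_v f (z + t *: v) * (1 - 0).
  apply: (@MVT R (fun t => f (z + t *: v)) (fun t => 'D_v f (z + t *: v))).
  - exact: ltr01.
  - by move=> t; rewrite in_itv/= => /andP[t0 t1]; apply: is_derive_line; apply: df; rewrite !ltW.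
  - apply: derivable_within_continuous => t; rewrite in_itv/= => t01.
    by have [] := is_derive_line (df t t01).
rewrite in_itv/= => t01; rewrite scale1r scale0r addr0 subr0 mulr1 => E.
by exists t.
Qed.

Lemma ballD V (z v : V) (r : R) : `|v| < r -> ball z r (z + v).
Proof. by move=> vr; rewrite -ball_normE/= opprD addNKr normrN. Qed.

(** The second difference is expanded along [v] first; the same difference
    expanded along [u] first gives the symmetry of second derivatives. *)
Lemma second_difference V (f : V -> R) (z u v : V) :
  (forall s t : R, 0 <= s <= 1 -> 0 <= t <= 1 ->
     differentiable f (z + s *: u + t *: v) /\
     differentiable ('D_v f) (z + s *: u + t *: v)) ->
  exists s t : R, [/\ 0 <= s <= 1, 0 <= t <= 1 &
    f (z + u + v) - f (z + u) - f (z + v) + f z =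
    'D_u ('D_v f) (z + s *: u + t *: v)].
Proof.
move=> H.
have one01 : (0 : R) <= (1 : R) <= 1 by apply/andP; split; lra.
have zero01 : (0 : R) <= (0 : R) <= 1 by apply/andP; split; lra.
pose g w := f (w + u) - f w.
have dg (t : R) : 0 <= t <= 1 -> differentiable g (z + t *: v) /\
    'D_v g (z + t *: v) = 'D_v f (z + t *: v + u) - 'D_v f (z + t *: v).
  move=> t01; have d1 : differentiable f (z + t *: v + u).
    by have := (H 1 t one01 t01).1; rewrite scale1r addrAC.
  have d2 : differentiable f (z + t *: v).
    by have := (H 0 t zero01 t01).1; rewrite scale0r addr0.
  have dsh : is_diff (z + t *: v) (fun w : V => w + u) (id + cst 0) by exact: is_diffD.
  have d3 : differentiable (fun w => f (w + u)) (z + t *: v).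
    exact: (differentiable_comp (g := f)).
  have d4 : 'D_v (fun w => f (w + u)) (z + t *: v) = 'D_v f (z + t *: v + u).
    rewrite (@derive_comp _ _ _ _ f (fun w : V => w + u))//.
    by rewrite [X in 'D_X f _]deriveE// diff_val/= addr0.
  split; first exact: differentiableB.
  by rewrite (@deriveB _ _ _ (fun w => f (w + u)) f) ?d4//; exact: diff_derivable.
have [t t01 E] := mvt_line (fun t t01 => (dg t t01).1).
have t01' : 0 <= t <= 1 by case/andP: t01 => *; rewrite !ltW.
have [s s01 E'] : exists2 s : R, 0 < s < 1 &
    'D_v f (z + t *: v + u) - 'D_v f (z + t *: v) = 'D_u ('D_v f) (z + t *: v + s *: u).
  by apply: mvt_line => s s01; rewrite addrAC; exact: (H s t s01 t01').2.
exists s, t; split; [by case/andP: s01 => *; rewrite !ltW|exact: t01'|].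
rewrite (addrAC z (s *: u)) -E' -(dg t t01').2 -E /g (addrAC z u v).
ring.
Qed.

(** Schwarz's theorem: the second difference of [f] over a small parallelogram
    is symmetric, and by [second_difference] it equals each of the two mixed
    derivatives at some nearby point, up to the scale of the parallelogram. *)
Lemma derive_sym V (U : set V) (f : V -> R) (z u v : V) : open U ->
  Ck 2 U f -> U z -> 'D_u ('D_v f) z = 'D_v ('D_u f) z.
Proof.
move=> oU [df Df] Uz.
apply/eqP; rewrite -subr_eq0 -normr_le0; apply/ler_addgt0Pr => e e0; rewrite add0r.
have cuv a b : {for z, continuous ('D_a ('D_b f))} by have [_ /(_ a)] := Df b; apply.
have nP : nbhs z [set w | [/\ U w, `|'D_u ('D_v f) z - 'D_u ('D_v f) w| < e / 2 &
    `|'D_v ('D_u f) z - 'D_v ('D_u f) w| < e / 2]].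
  have n1 := open_nbhs_nbhs (conj oU Uz).
  have e2 : 0 < e / 2 by rewrite divr_gt0.
  have /cvgrPdist_lt/(_ _ e2) n2 := cuv u v.
  have /cvgrPdist_lt/(_ _ e2) n3 := cuv v u.
  by apply: filterS3 n1 n2 n3 => w w1 w2 w3; exact: And3 w1 w2 w3.
have /nbhs_ballP[r /= r0 rP] := nP.
have d1 : 0 < `|u| + `|v| + 1 by rewrite ltr_wpDl// addr_ge0.
have d0 : 0 < 2 * (`|u| + `|v| + 1) by rewrite mulr_gt0.
have [h h0 hlt] : exists2 h, 0 < h & h * (`|u| + `|v| + 1) < r.
  exists (r / (2 * (`|u| + `|v| + 1))); first by rewrite divr_gt0.
  have -> : r / (2 * (`|u| + `|v| + 1)) * (`|u| + `|v| + 1) = r / 2.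
    by field; rewrite gt_eqF.
  by rewrite ltr_pdivrMr// ltr_pMr// ltr1n.
have B (s t : R) : 0 <= s <= 1 -> 0 <= t <= 1 ->
    ball z r (z + s *: (h *: u) + t *: (h *: v)).
  move=> /andP[s0 s1] /andP[t0 t1]; rewrite -addrA; apply: ballD.
  apply: le_lt_trans hlt; apply: le_trans (ler_normD _ _) _.
  rewrite !normrZ !ger0_norm//; do ?exact: ltW.
  have := normr_ge0 u; have := normr_ge0 v; have := ltW h0.
  move=> a1 a2 a3; have b1 := mulr_ge0 a1 a2; have b2 := mulr_ge0 a1 a3.
  have := ler_wpM2r b1 t1; have := ler_wpM2r b2 s1; rewrite !mul1r; lra.
have hn0 : h != 0 by rewrite gt_eqF.
have Dh a b w : ball z r w -> 'D_(h *: a) ('D_(h *: b) f) w = h * (h * 'D_a ('D_b f) w).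
  have E w' : ball z r w' -> 'D_(h *: b) f w' = h * 'D_b f w'.
    move=> /rP[Uw _ _]; have := df _ Uw => dw; by rewrite deriveE// linearZ/= -deriveE.
  move=> Bw; have [Uw _ _] := rP _ Bw.
  have [Db _] := Df b.
  have -> : 'D_(h *: a) ('D_(h *: b) f) w = 'D_(h *: a) (h *: 'D_b f) w.
    apply: near_eq_derive; near=> w'; apply: E; near: w'.
    by apply: open_nbhs_nbhs; split => //; exact: ball_open.
  rewrite deriveZ; last by apply: diff_derivable; exact: Db.
  by congr (h * _); rewrite deriveE ?linearZ/= -?deriveE//; exact: Db.
have DD a w : ball z r w -> differentiable f w /\ differentiable ('D_(h *: a) f) w.
  move=> Bw; have [Uw _ _] := rP _ Bw; split; first exact: df.
  by have [D _] := Df (h *: a); exact: D.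
have [s1 [t1 [s1P t1P E1]]] := second_difference (fun s t s01 t01 => DD v _ (B s t s01 t01)).
have B' (s t : R) : 0 <= s <= 1 -> 0 <= t <= 1 ->
    ball z r (z + s *: (h *: v) + t *: (h *: u)).
  by move=> s01 t01; rewrite addrAC; exact: B.
have [s2 [t2 [s2P t2P E2]]] := second_difference (fun s t s01 t01 => DD u _ (B' s t s01 t01)).
have [_ e1 _] := rP _ (B _ _ s1P t1P); have [_ _ e2] := rP _ (B' _ _ s2P t2P).
rewrite (Dh u v _ (B _ _ s1P t1P)) in E1; rewrite (Dh v u _ (B' _ _ s2P t2P)) in E2.
move: E1 E2 e1 e2; set w1 := z + s1 *: _ + _; set w2 := z + s2 *: _ + _.
move: ('D_u ('D_v f) w1) ('D_v ('D_u f) w2) ('D_u ('D_v f) z) ('D_v ('D_u f) z).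
move=> x1 x2 x3 x4 E1 E2 e1 e2.
have E3 : x1 = x2.
  by apply: (mulfI hn0); apply: (mulfI hn0); rewrite -E1 -E2 (addrAC z (h *: v)); ring.
have -> : x3 - x4 = (x3 - x1) - (x4 - x2) by rewrite E3; ring.
apply: le_trans (ler_normB _ _) _; apply: ltW.
by rewrite [ltRHS]splitr; exact: ltrD.
Unshelve. all: by end_near. Qed.

(** Uniqueness for homogeneous linear systems of ordinary differential
    equations, by Gronwall's estimate for the sum of the squares. *)
Lemma linear_ode_zero (J : finType) (q : J -> R -> R) (M : J -> J -> R -> R) (K : R) :
  (forall j (t : R), 0 <= t <= 1 -> {for t, continuous (q j)}) ->
  (forall j (t : R), 0 < t < 1 -> is_derive t (1 : R) (q j) (\sum_k M j k t * q k t)) ->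
  (forall j k (t : R), 0 < t < 1 -> `|M j k t| <= K) ->
  (forall j, q j 0 = 0) ->
  forall j (t : R), 0 <= t <= 1 -> q j t = 0.
Proof.
move=> cq dq MK q0.
pose n : R := #|J|%:R.
pose e t := \sum_j q j t ^+ 2.
pose de t := \sum_j 2 * (q j t * \sum_k M j k t * q k t).
(* [2 n K] bounds the logarithmic derivative of the sum of the squares *)
pose c := - (2 * n * K).
have He (t : R) : 0 < t < 1 -> is_derive t (1 : R) e (de t).
  move=> t01.
  have -> : e = \sum_j (q j ^+ 2) by apply/funext => s; rewrite /e fct_sumE.
  rewrite /de; elim/big_ind2: _ => [|f1 f1' f2 f2' ? ?|j _].
  - exact: is_derive_cst.
  - exact: is_deriveD.
  - have := @is_deriveX _ _ (q j) 2 t 1 _ (dq j t t01).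
    move/is_derive_eq; apply; rewrite /GRing.scale/= expr1; ring.
have K0 (t : R) : 0 < t < 1 -> de t <= 2 * n * K * e t.
  move=> t01.
  have -> : 2 * n * K * e t = \sum_j \sum_k K * (q j t ^+ 2 + q k t ^+ 2).
    transitivity (\sum_j (n * (K * q j t ^+ 2) + K * e t)).
      rewrite big_split/= -mulr_sumr sumr_const -mulr_natl -/n -mulr_sumr -/(e t); ring.
    apply: eq_bigr => j _; rewrite /e mulr_sumr.
    under [RHS]eq_bigr do rewrite mulrDr.
    by rewrite big_split/= sumr_const -mulr_natl.
  apply: ler_sum => j _; rewrite mulr_sumr mulr_sumr; apply: ler_sum => k _.
  have := MK j k t t01; rewrite ler_norml => /andP[m1 m2].
  set a := q j t; set b := q k t; set m := M j k t in m1 m2 *.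
  have : 0 <= (K - m) * (a - b) ^+ 2 + (K + m) * (a - b) ^+ 2.
    by apply: addr_ge0; apply: mulr_ge0; rewrite ?sqr_ge0// ?subr_ge0//; lra.
  have : 0 <= (K - m) * (a + b) ^+ 2 by rewrite mulr_ge0 ?sqr_ge0// subr_ge0.
  have : 0 <= (K + m) * (a - b) ^+ 2 by rewrite mulr_ge0 ?sqr_ge0//; lra.
  by rewrite !expr2; lra.
pose F t := e t * expR (c * t).
have dF (t : R) : 0 < t < 1 -> is_derive t (1 : R) F (e t * (expR (c * t) * c) + expR (c * t) * de t).
  move=> t01; have dE := He t t01.
  have d2 : is_derive t 1 (fun t => expR (c * t)) (expR (c * t) * c).
    apply: is_derive1_comp.
    by apply: is_derive_eq; rewrite /GRing.scale/= mulr1.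
  exact: (is_deriveM dE d2).
have cF : {within `[0, 1], continuous F}.
  apply: continuous_in_subspaceT => t; rewrite inE/= in_itv/= => t01.
  apply: continuousM.
    have -> : e = \sum_j (q j ^+ 2) by apply/funext => s; rewrite /e fct_sumE.
    elim/big_ind: _ => [|f1 f2 ? ?|j _].
    + exact: cst_continuous.
    + exact: continuousD.
    + by rewrite expr2; apply: continuousM; exact: cq.
  apply: continuous_comp; last exact: continuous_expR.
  exact: mulrl_continuous.
have e0 : e 0 = 0 by rewrite /e big1// => j _; rewrite q0 expr0n.
move=> j t t01.
have : F t <= F 0.
  apply: (@ler0_derive1_le_cc _ F 0 1) => //; rewrite ?in_itv/= ?lexx ?ler01//;
    last by case/andP: t01.
    by move=> s; rewrite in_itv/= => s01; have [] := dF s s01.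
  move=> s; rewrite in_itv/= => s01; have d := dF s s01.
  rewrite derive1E derive_val.
  have := K0 s s01; have := expR_gt0 (c * s); rewrite /c; nra.
rewrite /F e0 mul0r pmulr_lle0 ?expR_gt0// => et.
have : q j t ^+ 2 <= 0.
  apply: le_trans et; rewrite /e (bigD1 j)//= lerDl.
  by apply: sumr_ge0 => k _; exact: sqr_ge0.
by move=> q2; apply/eqP; rewrite -sqrf_eq0 eq_le q2 sqr_ge0.
Qed.

End Segments.

(** * Integrals depending on parameters *)

Section UnitIntegral.
Context {R : realType}.
Implicit Types (V W : normedModType R).
Notation mu := (@lebesgue_measure R).

Definition int01 (h : R -> R) : R := \int[mu]_(s in `[0, 1]) h s.

Definition cont01 (h : R -> R) := forall s : R, 0 <= s <= 1 -> {for s, continuous h}.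

Lemma cont01_within h (t : R) : 0 <= t <= 1 -> cont01 h ->
  {within `[0, t], continuous h}.
Proof.
move=> /andP[t0 t1] ch; apply: continuous_in_subspaceT => s.
rewrite inE/= in_itv/= => /andP[s0 st]; apply: ch; apply/andP; split => //.
exact: le_trans t1.
Qed.

Lemma zero_in01 : (0 : R) <= (0 : R) <= 1.
Proof. by apply/andP; split; lra. Qed.

Lemma one_in01 : (0 : R) <= (1 : R) <= 1.
Proof. by apply/andP; split; lra. Qed.

Lemma cont01_integrable h : cont01 h -> mu.-integrable `[0, 1] (EFin \o h).
Proof.
move=> ch; apply: continuous_compact_integrable; first exact: segment_compact.
exact: (cont01_within one_in01).
Qed.

Lemma eq_int01 g h : (forall s : R, 0 <= s <= 1 -> g s = h s) -> int01 g = int01 h.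
Proof.
move=> gh; apply: eq_Rintegral => s; rewrite inE/= in_itv/= => s01; exact: gh.
Qed.

Lemma int01D g h : cont01 g -> cont01 h ->
  int01 (fun s => g s + h s) = int01 g + int01 h.
Proof. by move=> cg ch; apply: RintegralD => //; exact: cont01_integrable. Qed.

Lemma int01Z c h : cont01 h -> int01 (fun s => c * h s) = c * int01 h.
Proof. by move=> ch; apply: RintegralZl => //; exact: cont01_integrable. Qed.

Lemma cont01_cst c : cont01 (fun=> c).
Proof. by move=> s _; exact: cst_continuous. Qed.

Lemma cont01D g h : cont01 g -> cont01 h -> cont01 (fun s => g s + h s).
Proof. by move=> cg ch s s01; apply: continuousD; [exact: cg|exact: ch]. Qed.

Lemma cont01M g h : cont01 g -> cont01 h -> cont01 (fun s => g s * h s).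
Proof. by move=> cg ch s s01; apply: continuousM; [exact: cg|exact: ch]. Qed.

Lemma int01_cst c : int01 (fun=> c) = c.
Proof.
rewrite /int01 Rintegral_cst//= lebesgue_measure_itv/= lte_fin ltr01.
by rewrite oppr0 adde0 mulr1.
Qed.

Lemma cont01_sum (J : Type) (r : seq J) (P : pred J) (h : J -> R -> R) :
  (forall j, P j -> cont01 (h j)) -> cont01 (fun s => \sum_(j <- r | P j) h j s).
Proof.
move=> ch; elim: r => [|j r IH].
  have -> : (fun s => \sum_(j <- [::] | P j) h j s) = (fun=> 0).
    by apply/funext => s; rewrite big_nil.
  exact: cont01_cst.
have [Pj|Pj] := boolP (P j); last first.
  suff -> : (fun s => \sum_(k <- j :: r | P k) h k s) =
    (fun s => \sum_(k <- r | P k) h k s) by [].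
  by apply/funext => s; rewrite big_cons (negbTE Pj).
have -> : (fun s => \sum_(k <- j :: r | P k) h k s) =
    (fun s => h j s + \sum_(k <- r | P k) h k s).
  by apply/funext => s; rewrite big_cons Pj.
by apply: cont01D => //; exact: ch.
Qed.

Lemma int01_sum (J : Type) (r : seq J) (P : pred J) (h : J -> R -> R) :
  (forall j, P j -> cont01 (h j)) ->
  int01 (fun s => \sum_(j <- r | P j) h j s) = \sum_(j <- r | P j) int01 (h j).
Proof.
move=> ch; elim: r => [|j r IH].
  rewrite big_nil -[RHS](int01_cst 0); apply: eq_int01 => s _; by rewrite big_nil.
rewrite big_cons; have [Pj|Pj] := boolP (P j); last first.
  by rewrite -IH; apply: eq_int01 => s _; rewrite big_cons (negbTE Pj).
rewrite -IH -int01D; [|exact: ch|exact: cont01_sum].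
by apply: eq_int01 => s _; rewrite big_cons Pj.
Qed.

Lemma int01N h : cont01 h -> int01 (fun s => - h s) = - int01 h.
Proof.
move=> ch; rewrite -mulN1r -int01Z//.
by apply: eq_int01 => s _; rewrite mulN1r.
Qed.

Lemma cont01N h : cont01 h -> cont01 (fun s => - h s).
Proof. by move=> ch s s01; apply: continuousN; exact: ch. Qed.

Lemma int01B g h : cont01 g -> cont01 h ->
  int01 (fun s => g s - h s) = int01 g - int01 h.
Proof.
by move=> cg ch; rewrite int01D ?int01N//; exact: cont01N.
Qed.

Lemma int01_norm_le h M : cont01 h ->
  (forall s : R, 0 <= s <= 1 -> `|h s| <= M) -> `|int01 h| <= M.
Proof.
move=> ch hM.
have i1 : mu.-integrable `[0, 1] (EFin \o (fun s => `|h s|)).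
  apply: cont01_integrable => s s01; apply: continuous_comp; first exact: ch.
  exact: norm_continuous.
apply: le_trans.
  by apply: (@le_normr_Rintegral _ _ _ mu) => //; exact: cont01_integrable.
rewrite -[leRHS]int01_cst; apply: le_Rintegral => //.
  by apply: cont01_integrable; exact: cont01_cst.
Qed.

Lemma int01_FTC (F h : R -> R) : cont01 h ->
  (forall s : R, 0 < s < 1 -> is_derive s (1 : R) F (h s)) ->
  F x @[x --> (0 : R)^'+] --> F 0 -> F x @[x --> (1 : R)^'-] --> F 1 ->
  int01 h = F 1 - F 0.
Proof.
move=> ch dF c0 c1.
rewrite /int01 /Rintegral (@continuous_FTC2 _ h F 0 1)//.
- exact: (cont01_within one_in01).
- split => // s; rewrite in_itv/= => s01; by have [] := dF s s01.
- move=> s; rewrite in_itv/= => s01; have d := dF s s01.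
  by rewrite derive1E derive_val.
Qed.

(** The integral is the primitive of [b] that vanishes at 0. *)
Lemma is_derive_int01_scaled (b : R -> R) (t : R) : cont01 b -> 0 < t < 1 ->
  is_derive t (1 : R) (fun t => int01 (fun s => t * b (s * t))) (b t).
Proof.
move=> cb t01.
pose B (x : R) := \int[mu]_(s in `[0, x]) b s.
have ib := cont01_integrable cb.
have dB (x : R) : 0 < x < 1 -> is_derive x (1 : R) B (b x).
  move=> /andP[x0 x1].
  have cx : {for x, continuous b} by apply: cb; rewrite !ltW.
  have [D E] := @continuous_FTC1_closed _ b 0 x 1 x1 ib x0 cx.
  by apply: DeriveDef; [exact: D|exact: (etrans (esym (derive1E _ _)) E)].
have B0 : B x @[x --> (0 : R)] --> (0 : R).
  exact: (@parameterized_integral_cvg_left _ 0 1 b ltr01 ib).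
have B00 : B 0 = 0 by rewrite /B set_itv1 Rintegral_set1.
suff E x : 0 < x < 1 -> int01 (fun s => x * b (s * x)) = B x.
  apply: (near_eq_is_derive (f := B)); last exact: dB.
  have : \forall x \near t, x \in `]0, 1[%R by apply: near_in_itvoo; rewrite in_itv.
  by apply: filterS => x; rewrite in_itv/= => x01; rewrite E.
move=> x01; have /andP[x0 x1] := x01.
have xs01 (s : R) : 0 <= s <= 1 -> 0 <= s * x <= 1.
  by move=> /andP[s0 s1]; apply/andP; split; nra.
transitivity (B (1 * x) - B (0 * x)); last by rewrite mul1r mul0r B00 subr0.
apply: (@int01_FTC (fun s => B (s * x))).
- move=> s s01; apply: continuousM; first exact: cst_continuous.
  apply: continuous_comp; first exact: mulrr_continuous.
  by apply: cb; exact: xs01.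
- move=> s /andP[s0 s1]; rewrite mulrC.
  have sx01 : 0 < s * x < 1.
    rewrite mulr_gt0//=; apply: lt_le_trans (_ : 1 * x <= _); last by rewrite mul1r ltW.
    by rewrite ltr_pM2r.
  have d1 := dB _ sx01.
  have d2 : is_derive s (1 : R) (fun s : R => s * x) x.
    have h1 : is_derive s (1 : R) (id : R -> R) 1 by exact: is_derive_id.
    have h2 : is_derive s (1 : R) (cst x : R -> R) 0 by exact: is_derive_cst.
    have := is_deriveM h1 h2.
    by move=> /is_derive_eq; apply; rewrite /GRing.scale/= mulr1 mulr0 add0r.
  exact: is_derive1_comp.
- rewrite mul0r B00.
  apply: (@cvg_comp _ _ _ (fun s : R => s * x) B _ (nbhs (0 : R))) => //.
  apply: cvg_at_right_filter; rewrite -[X in _ --> X](mul0r x).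
  exact: mulrr_continuous.
- rewrite mul1r; apply: cvg_at_left_filter.
  have cBx : {for x, continuous B}.
    apply: differentiable_continuous; apply/derivable1_diffP.
    by have [] := dB x x01.
  rewrite -[X in _ --> B X](mul1r x).
  apply: (@continuous_comp _ _ _ (fun s : R => s * x) B); first exact: mulrr_continuous.
  by rewrite mul1r.
Qed.

(** Compactness of the unit interval. *)
Lemma tube_near V (P : R -> V -> Prop) (z0 : V) :
  (forall s : R, 0 <= s <= 1 -> \forall p \near (s, z0), P p.1 p.2) ->
  \forall z \near z0, forall s : R, 0 <= s <= 1 -> P s z.
Proof.
move=> H.
have /compact_near_coveringP/(_ V (nbhs z0) (fun z s => P s z)) := @segment_compact R 0 1.
have H' (x : R) : [set` `[0, 1]] x -> \forall x' \near x & i \near nbhs z0, P x' i.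
  by rewrite /= in_itv/= => x01; exact: H.
move=> /(_ _ H'); apply: filterS => z zP s s01; apply: zP.
by rewrite /= in_itv.
Qed.

Lemma tube_continuous V (h : R * V -> R) (z0 : V) :
  (forall s : R, 0 <= s <= 1 -> {for (s, z0), continuous h}) ->
  forall e, 0 < e -> \forall z \near z0, forall s : R, 0 <= s <= 1 ->
    `|h (s, z) - h (s, z0)| < e.
Proof.
move=> ch e e0; apply: tube_near => s s01.
have e2 : 0 < e / 2 by rewrite divr_gt0.
have /cvgrPdist_lt/(_ _ e2) [[A B]/= [nA nB] AB] := ch s s01.
exists (A, B) => // -[s' z]/= [As' Bz].
have := AB (s', z) (conj As' Bz); have := AB (s', z0) (conj As' (nbhs_singleton nB)).
move=> /= a b; rewrite -(subrKA (h (s, z0))).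
apply: le_lt_trans (ler_normD _ _) _; rewrite [ltRHS]splitr ltrD//.
by rewrite distrC.
Qed.

Lemma section_continuous V (h : R * V -> R) (s : R) (z : V) :
  {for (s, z), continuous h} -> {for s, continuous (fun s => h (s, z))}.
Proof.
move=> ch; apply: (@continuous_comp _ _ _ (fun s => (s, z)) h) => //.
exact: (@Ck_pair R R R V 0 setT id (cst z) openT (Ck_id _ _) (Ck_cst _ _ _) s I).
Qed.

Lemma fcoord_bound V (fV : frame V) (i : fidx fV) :
  exists2 K : R, 0 < K & forall v, `|fcoord fV i v| <= K * `|v|.
Proof.
pose LM := GRing.isLinear.Build _ _ _ _ _ (fcoord_linear fV i).
pose LL : {linear V -> R} := HB.pack (fcoord fV i) LM.
exact: (@linear_lipschitz _ _ _ LL (fcoord_continuous fV i)).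
Qed.


Lemma derive_snd_frame V (fV : frame V) (h : R * V -> R) (p : R * V) (v : V) :
  differentiable h p ->
  'D_((0, v) : R * V) h p = \sum_i fcoord fV i v * 'D_((0, fvec fV i) : R * V) h p.
Proof.
move=> dh; rewrite (derive_frame (prod_frame real_frame fV))// big_sumType/=.
by rewrite big1 ?add0r// => i _; rewrite scale0r.
Qed.

Section ParametricIntegral.
Variables (V : normedModType R) (fV : frame V) (U : set V) (O : set (R * V)).
Hypotheses (oU : open U) (oO : open O).
Hypothesis UO : forall (s : R) z, 0 <= s <= 1 -> U z -> O (s, z).

Lemma section_cont01 k h z : Ck k O h -> U z -> cont01 (fun s => h (s, z)).
Proof.
move=> ch Uz s s01; apply: section_continuous.
by apply: (Ck_continuous ch); exact: UO.
Qed.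

Lemma continuous_int01 h : Ck 0 O h ->
  Ck 0 U (fun z => int01 (fun s => h (s, z))).
Proof.
move=> ch z Uz; apply/cvgrPdist_lt => e e0.
have e2 : 0 < e / 2 by rewrite divr_gt0.
have ct (s : R) : 0 <= s <= 1 -> {for (s, z), continuous h}.
  by move=> s01; apply: ch; exact: UO.
have := tube_continuous ct e2; apply: filterS2 (open_nbhs_nbhs (conj oU Uz)).
move=> z' Uz' H; rewrite -int01B; [|exact: section_cont01 ch _|exact: section_cont01 ch _].
apply: (@le_lt_trans _ _ (e / 2)); last by rewrite ltr_pdivrMr// ltr_pMr// ltr1n.
apply: int01_norm_le; last by move=> s s01; rewrite distrC ltW// H.
by apply: cont01D; [|apply: cont01N]; exact: section_cont01 ch _.
Qed.

(** The mean value theorem bounds the increment of [h (s, -)] by a partial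
    derivative at an intermediate point; by [tube_continuous] that derivative
    is close to the one at [z] uniformly in [s]. *)
Lemma derive_int01 h z : Ck 1 O h -> U z ->
  differentiable (fun z => int01 (fun s => h (s, z))) z /\
  forall v, 'D_v (fun z => int01 (fun s => h (s, z))) z =
            int01 (fun s => 'D_((0, v) : R * V) h (s, z)).
Proof.
move=> ch Uz; have [dh Dh] := ch.
pose D i p := 'D_((0, fvec fV i) : R * V) h p.
have cD i : Ck 0 O (D i) by exact: Dh.
have cDz i : cont01 (fun s => D i (s, z)) by exact: section_cont01 (cD i) Uz.
pose L v := int01 (fun s => 'D_((0, v) : R * V) h (s, z)).
have dE v p : O p -> 'D_((0, v) : R * V) h p = \sum_i fcoord fV i v * D i p.
  by move=> Op; apply: derive_snd_frame; exact: dh.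
have LE v : L v = \sum_i fcoord fV i v * int01 (fun s => D i (s, z)).
  rewrite /L (@eq_int01 _ (fun s => \sum_i fcoord fV i v * D i (s, z))); last first.
    by move=> s s01; rewrite dE//; exact: UO.
  rewrite int01_sum; first by apply: eq_bigr => i _; rewrite int01Z.
  by move=> i _; apply: cont01M => //; exact: cont01_cst.
apply: differentiable_eps.
- move=> a u v; rewrite -/(L _) -/(L u) -/(L v) !LE.
  rewrite /GRing.scale/= mulr_sumr -big_split/=; apply: eq_bigr => i _.
  by rewrite fcoord_linear /GRing.scale/= mulrDl mulrA.
- suff : Ck 0 setT L by move=> cL v; exact: cL.
  apply: (@eq_Ck _ _ _ _ _ (fun v => \sum_i fcoord fV i v * int01 (fun s => D i (s, z)))).
  + exact: openT.
  + by move=> v _; rewrite LE.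
  apply: Ck_sum; first exact: openT.
  move=> i _; apply: CkM; first exact: openT.
    by move=> v _; exact: fcoord_continuous.
  exact: Ck_cst.
move=> e e0.
have /choice[K KP] : forall i, exists K : R, 0 < K /\
    forall v, `|fcoord fV i v| <= K * `|v|.
  by move=> i; have [K' K0 K'P] := @fcoord_bound V fV i; exists K'; split.
pose S := \sum_i K i + 1.
have S0 : 0 < S by rewrite ltr_wpDl// sumr_ge0// => i _; rewrite ltW//; have [] := KP i.
pose d := e / S.
have d0 : 0 < d by rewrite divr_gt0.
have nD : \forall z' \near z, U z' /\ forall i (s : R), 0 <= s <= 1 ->
    `|D i (s, z') - D i (s, z)| < d.
  have n2 : \forall z' \near z, forall i, (forall s : R, 0 <= s <= 1 ->
      `|D i (s, z') - D i (s, z)| < d).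
    apply: filter_forall => i; apply: tube_continuous => // s s01.
    by apply: cD; exact: UO.
  by apply: filterS2 (open_nbhs_nbhs (conj oU Uz)) n2 => z' Uz' H; split.
have /nbhs_ballP[r /= r0 rP] := nD.
near=> v.
have vr : `|v| < r by near: v; exact: nbhs0_lt.
have vt (t : R) : 0 <= t <= 1 -> ball z r (z + t *: v).
  move=> /andP[t0 t1]; apply: ballD; rewrite normrZ ger0_norm//.
  by apply: le_lt_trans vr; rewrite ler_piMl.
have Uvz : U (v + z).
  by have := (rP _ (vt _ one_in01)).1; rewrite scale1r addrC.
have c1 := section_cont01 ch Uvz.
have c2 := section_cont01 ch Uz.
have c3 : cont01 (fun s => 'D_((0, v) : R * V) h (s, z)).
  exact: (@section_cont01 0 ('D_((0, v) : R * V) h) z (Dh _) Uz).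
rewrite -/(L v) /L -int01B// -int01B//; last by apply: cont01D => //; exact: cont01N.
apply: int01_norm_le.
  by apply: cont01D; [apply: cont01D => //|]; exact: cont01N.
move=> s s01.
have lin t : (s, z) + t *: ((0, v) : R * V) = (s, z + t *: v).
  by apply: injective_projections => //=; rewrite scaler0 addr0.
have [t t01 E] : exists2 t : R, 0 < t < 1 &
    h ((s, z) + (0, v)) - h (s, z) = 'D_((0, v) : R * V) h ((s, z) + t *: (0, v)).
  apply: mvt_line => t t01; rewrite lin; apply: dh; apply: UO => //.
  by have [] := rP _ (vt _ t01).
have t01' : 0 <= t <= 1 by case/andP: t01 => *; rewrite !ltW.
have [Uzt Dzt] := rP _ (vt _ t01').
have -> : (s, v + z) = (s, z) + ((0, v) : R * V).
  by apply: injective_projections => //=; rewrite ?addr0// addrC.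
rewrite E lin !dE; [|exact: UO|exact: UO].
rewrite -sumrB; under eq_bigr do rewrite -mulrBr.
apply: le_trans (ler_norm_sum _ _ _) _.
apply: (@le_trans _ _ (\sum_i K i * `|v| * d)).
  apply: ler_sum => i _; rewrite normrM; apply: ler_pM => //.
    by have [_] := KP i; apply.
  by apply: ltW; exact: Dzt.
rewrite -!mulr_suml /d mulrAC ler_wpM2r//.
rewrite mulrC -mulrA ler_piMr ?(ltW e0)// mulrC ler_pdivrMr// mul1r /S lerDl//.
Unshelve. all: by end_near. Qed.

(** Differentiation under the integral sign, at every order. *)
Lemma Ck_int01 k h : Ck k O h -> Ck k U (fun z => int01 (fun s => h (s, z))).
Proof.
elim: k h => [|k IH] h; first exact: continuous_int01.
move=> ch; have ch1 : Ck 1 O h by apply: Ck_le ch.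
split => [z Uz|v]; first by have [] := derive_int01 ch1 Uz.
have H := IH _ (Ck_der ((0, v) : R * V) ch).
by apply: eq_Ck H => // z Uz; have [_ ->] := derive_int01 ch1 Uz.
Qed.

End ParametricIntegral.

End UnitIntegral.

(** * Hadamard's lemma *)

Section Hadamard.
Context {R : realType} (P V : normedModType R) (fP : frame P) (fV : frame V).
Variables (O : set (P * V)).
Hypothesis oO : open O.
Hypothesis convO : forall p z z' (t : R), O (p, z) -> O (p, z') -> 0 <= t <= 1 ->
  O (p, z + t *: (z' - z)).

Definition hadamard_coef (f : P * V -> R) (i : fidx fV) (q : P * (V * V)) : R :=
  int01 (fun t => 'D_((0, fvec fV i) : P * V) f (q.1, q.2.1 + t *: (q.2.2 - q.2.1))).

Definition hadamard_dom : set (P * (V * V)) :=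
  [set q | O (q.1, q.2.1) /\ O (q.1, q.2.2)].

Let seg (r : R * (P * (V * V))) : P * V :=
  (r.2.1, r.2.2.1 + r.1 *: (r.2.2.2 - r.2.2.1)).

Let seg_smooth k (U : set (R * (P * (V * V)))) : open U -> Ck k U seg.
Proof.
move=> oU.
have c0 : Ck k U (fun r : R * (P * (V * V)) => r) by exact: Ck_id.
have c1 : Ck k U (fun r : R * (P * (V * V)) => r.1) by exact: Ck_fst_comp.
have c2 : Ck k U (fun r : R * (P * (V * V)) => r.2) by exact: Ck_snd_comp.
have c3 : Ck k U (fun r : R * (P * (V * V)) => r.2.1) by exact: (Ck_fst_comp oU c2).
have c4 : Ck k U (fun r : R * (P * (V * V)) => r.2.2) by exact: (Ck_snd_comp oU c2).
have c5 : Ck k U (fun r : R * (P * (V * V)) => r.2.2.1) by exact: (Ck_fst_comp oU c4).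
have c6 : Ck k U (fun r : R * (P * (V * V)) => r.2.2.2) by exact: (Ck_snd_comp oU c4).
apply: Ck_pair => //; apply: CkD => //.
have H : Ck k U (fun r : R * (P * (V * V)) =>
    \sum_i (r.1 * fcoord fV i (r.2.2.2 - r.2.2.1)) *: fvec fV i).
  apply: Ck_sum => // i _; apply: CkZl => //; apply: CkM => //.
  by apply: Ck_coord => //; exact: CkB.
apply: eq_Ck H => // r _; rewrite [in RHS](frameE fV (_ - _)) scaler_sumr.
by apply: eq_bigr => i _; rewrite scalerA.
Qed.

Let open_segpre : open (seg @^-1` O).
Proof.
apply: open_comp => // r _; exact: (Ck_continuous (@seg_smooth 0 setT openT) I).
Qed.

Lemma open_hadamard_dom : open hadamard_dom.
Proof.
have c0 : Ck 0 setT (fun r : P * (V * V) => r) by exact: Ck_id.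
have c1 := Ck_fst_comp openT c0.
have c2 := Ck_snd_comp openT c0.
have c3 := Ck_pair openT c1 (Ck_fst_comp openT c2).
have c4 := Ck_pair openT c1 (Ck_snd_comp openT c2).
apply: openI; apply: open_comp => // r _.
  exact: (Ck_continuous c3 I).
exact: (Ck_continuous c4 I).
Qed.

Let segO (t : R) q : 0 <= t <= 1 -> hadamard_dom q -> (seg @^-1` O) (t, q).
Proof. by move=> t01 [h1 h2]; exact: convO. Qed.

Let seg_der k (f : P * V -> R) i : Ck k.+1 O f ->
  Ck k (seg @^-1` O) (fun r => 'D_((0, fvec fV i) : P * V) f (seg r)).
Proof.
move=> cf; exact: (Ck_comp (prod_frame fP fV) open_segpre
  (seg_smooth k open_segpre) (Ck_der _ cf) (fun z Oz => Oz)).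
Qed.

(** The segments that join two points of a fibre of [O] stay in [O], so that
    the coefficient is an integral with parameters of a function of class C^k. *)
Lemma Ck_hadamard k (f : P * V -> R) i : Ck k.+1 O f -> Ck k hadamard_dom (hadamard_coef f i).
Proof.
move=> cf.
exact: (Ck_int01 (prod_frame fP (prod_frame fV fV)) open_hadamard_dom segO
   (seg_der i cf)).
Qed.

(** Hadamard's lemma: the increment of a smooth function is a combination of
    the increments of the coordinates, with smooth coefficients. *)
Lemma hadamardE (f : P * V -> R) p z z' : Ck 1 O f -> O (p, z) -> O (p, z') ->
  f (p, z') - f (p, z) =
  \sum_i fcoord fV i (z' - z) * hadamard_coef f i (p, (z, z')).
Proof.
move=> cf Oz Oz'; have hq : hadamard_dom (p, (z, z')) by [].
have cs i : cont01 (fun t => 'D_((0, fvec fV i) : P * V) f (p, z + t *: (z' - z))).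
  exact: (section_cont01 segO (seg_der i cf) hq).
rewrite /hadamard_coef/=.
under eq_bigr do rewrite -int01Z//.
rewrite -int01_sum; last by move=> i _; apply: cont01M => //; exact: cont01_cst.
have lin (t : R) : (p, z) + t *: ((0, z' - z) : P * V) = (p, z + t *: (z' - z)).
  by apply: injective_projections => //=; rewrite scaler0 addr0.
have df (t : R) : 0 <= t <= 1 -> differentiable f ((p, z) + t *: ((0, z' - z) : P * V)).
  by move=> t01; rewrite lin; have [D _] := cf; apply: D; exact: convO.
pose F (t : R) := f ((p, z) + t *: ((0, z' - z) : P * V)).
have dF (t : R) : 0 <= t <= 1 -> is_derive t (1 : R) F
    (\sum_i fcoord fV i (z' - z) * 'D_((0, fvec fV i) : P * V) f (p, z + t *: (z' - z))).
  move=> t01; have := is_derive_line (df t t01).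
  move=> /is_derive_eq; apply; rewrite (derive_frame (prod_frame fP fV)); last exact: df.
  rewrite big_sumType/= big1 ?add0r => [|i _].
    by rewrite lin.
  have := fcoord_linear fP i (-1) 0 0; rewrite scaler0 addr0 => ->.
  by rewrite scaleN1r addNr scale0r.
have cF (t : R) : 0 <= t <= 1 -> {for t, continuous F}.
  move=> t01; have [d _] := dF t t01.
  by apply: differentiable_continuous; apply/derivable1_diffP.
transitivity (F 1 - F 0).
  rewrite /F scale1r scale0r addr0; congr (f _ - _).
  by apply: injective_projections => //=; rewrite ?addr0// addrC subrK.
apply: esym; apply: int01_FTC.
- apply: cont01_sum => i _; apply: cont01M => //; exact: cont01_cst.
- by move=> s /andP[s0 s1]; apply: dF; rewrite !ltW.
- by apply: cvg_at_right_filter; apply: cF; exact: zero_in01.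
- by apply: cvg_at_left_filter; apply: cF; exact: one_in01.
Qed.

Lemma hadamard_diag (f : P * V -> R) p z i :
  hadamard_coef f i (p, (z, z)) = 'D_((0, fvec fV i) : P * V) f (p, z).
Proof.
rewrite /hadamard_coef/= -[RHS]int01_cst; apply: eq_int01 => t _.
by rewrite subrr scaler0 addr0.
Qed.

End Hadamard.

(** * Linear integral equations along rays *)

Section Caratheodory.
Context {R : realType} (V : normedModType R) (fV : frame V).

(** The derivative is read off the coefficients on the diagonal, where they are
    continuous. *)
Lemma caratheodory_derive (U : set V) (f : V -> R)
    (phi : fidx fV -> V * V -> R) z : open U ->
  (forall i, Ck 0 [set q | U q.1 /\ U q.2] (phi i)) ->
  (forall z z', U z -> U z' ->
     f z' - f z = \sum_i fcoord fV i (z' - z) * phi i (z, z')) ->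
  U z -> differentiable f z /\
    forall v, 'D_v f z = \sum_i fcoord fV i v * phi i (z, z).
Proof.
move=> oU cphi fE Uz; apply: differentiable_eps.
- move=> a u v; rewrite /GRing.scale/= mulr_sumr -big_split/=; apply: eq_bigr => i _.
  by rewrite fcoord_linear /GRing.scale/= mulrDl mulrA.
- suff : Ck 0 setT (fun v => \sum_i fcoord fV i v * phi i (z, z)) by move=> cL v; exact: cL.
  apply: Ck_sum; first exact: openT.
  move=> i _; apply: CkM; first exact: openT.
    by move=> v _; exact: fcoord_continuous.
  exact: Ck_cst.
move=> e e0.
have /choice[K KP] : forall i, exists K : R, 0 < K /\
    forall v, `|fcoord fV i v| <= K * `|v|.
  by move=> i; have [K' K0 K'P] := @fcoord_bound _ V fV i; exists K'; split.
pose S := \sum_i K i + 1.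
have S0 : 0 < S by rewrite ltr_wpDl// sumr_ge0// => i _; rewrite ltW//; have [] := KP i.
have d0 : 0 < e / S by rewrite divr_gt0.
have nphi : \forall h \near (0 : V), forall i, `|phi i (z, z) - phi i (z, h + z)| < e / S.
  apply: filter_forall => i.
  have c1 : {for (0 : V), continuous (fun h : V => phi i (z, h + z))}.
    apply: (@continuous_comp _ _ _ (fun h : V => (z, h + z)) (phi i)); last first.
      by apply: cphi; rewrite /= add0r.
    have ci := Ck_id (R := R) 0 (setT : set V).
    exact: (Ck_continuous (Ck_pair openT (Ck_cst _ _ z) (CkD openT ci (Ck_cst _ _ z))) I).
  have /cvgrPdist_lt/(_ _ d0) := c1; by rewrite add0r.
have nU : \forall h \near (0 : V), U (h + z).
  have : \forall h \near z, U h by apply: open_nbhs_nbhs.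
  by rewrite (near_shift 0) subr0.
apply: filterS2 nU nphi => h Uhz H.
rewrite (fE z (h + z) Uz Uhz) addrK -sumrB.
under eq_bigr do rewrite -mulrBr.
apply: le_trans (ler_norm_sum _ _ _) _.
apply: (@le_trans _ _ (\sum_i K i * `|h| * (e / S))).
  apply: ler_sum => i _; rewrite normrM; apply: ler_pM => //.
    by have [_] := KP i; apply.
  by rewrite distrC; apply: ltW; exact: H.
rewrite -!mulr_suml mulrAC ler_wpM2r//.
by rewrite mulrC -mulrA ler_piMr ?(ltW e0)// mulrC ler_pdivrMr// mul1r /S lerDl.
Qed.

(** Converse of Hadamard's lemma. *)
Lemma caratheodory_Ck (U : set V) (f : V -> R) (phi : fidx fV -> V * V -> R) k : open U ->
  (forall i, Ck k [set q | U q.1 /\ U q.2] (phi i)) ->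
  (forall z z', U z -> U z' ->
     f z' - f z = \sum_i fcoord fV i (z' - z) * phi i (z, z')) ->
  Ck k.+1 U f.
Proof.
move=> oU cphi fE.
have c0 i : Ck 0 [set q | U q.1 /\ U q.2] (phi i) by exact: Ck_le (cphi i).
split => [z Uz|v]; first by have [] := caratheodory_derive oU c0 fE Uz.
have H : Ck k U (fun z => \sum_i fcoord fV i v * phi i (z, z)).
  apply: Ck_sum => // i _; apply: CkM => //; first exact: Ck_cst.
  apply: (Ck_comp (prod_frame fV fV) oU _ (cphi i)) => //.
  by apply: Ck_pair => //; exact: Ck_id.
by apply: eq_Ck H => // z Uz; have [_ ->] := caratheodory_derive oU c0 fE Uz.
Qed.

End Caratheodory.

Section GeometricSeries.
Context {R : realType}.

Lemma geometric_tail (u : nat -> R) (M : R) :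
  (forall n, `|u n| <= M / 2 ^+ n) ->
  forall n, `|limn (series u) - series u n| <= 2 * M / 2 ^+ n.
Proof.
move=> uM n.
have M0 : 0 <= M by have := uM 0%N; rewrite expr0 divr1; apply: le_trans.
have Mn k : 0 <= 2 * M / 2 ^+ k by rewrite divr_ge0// ?exprn_ge0// mulr_ge0.
have bnd k : `|series u (n + k)%N - series u n| <= 2 * M / 2 ^+ n - 2 * M / 2 ^+ (n + k).
  elim: k => [|k IH]; first by rewrite addn0 !subrr normr0.
  rewrite addnS seriesSr addrAC.
  apply: le_trans (ler_normD _ _) _; apply: le_trans (lerD IH (uM (n + k)%N)) _.
  rewrite exprS; set p := 2 ^+ (n + k); set q := 2 * M / 2 ^+ n.
  have p0 : p != 0 by rewrite expf_neq0.
  have -> : 2 * M / (2 * p) = M / p by field.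
  have -> : 2 * M / p = M / p + M / p by rewrite -mulrDl; congr (_ / _); ring.
  lra.
have cu : cvgn (series u).
  apply: normed_cvg; apply: (@series_le_cvg _ _ (geometric M 2^-1)) => //.
  - by move=> k; exact: normr_ge0.
  - by move=> k; rewrite /= mulr_ge0// exprn_ge0// invr_ge0.
  - by move=> k; rewrite /= exprVn.
  - by apply: is_cvg_geometric_series; rewrite ger0_norm ?invr_ge0// invf_lt1// ltr1n.
have cn : (fun m => `|series u m - series u n|) @ \oo --> `|limn (series u) - series u n|.
  by apply: cvg_norm; apply: cvgB => //; exact: cvg_cst.
rewrite -(cvg_lim _ cn)//; apply: limr_le; first by apply/cvg_ex; eexists; exact: cn.
near=> m; have nm : (n <= m)%N by near: m; exact: nbhs_infty_ge.
rewrite -(subnKC nm); apply: le_trans (bnd _) _.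
by rewrite lerBlDr lerDl.
Unshelve. all: by end_near. Qed.

Lemma geometric_zero (x M : R) : (forall n, `|x| <= M / 2 ^+ n) -> x = 0.
Proof.
move=> H; apply/eqP; rewrite -normr_le0.
have c : (fun n => M / 2 ^+ n) @ \oo --> M * 0.
  apply: cvgM; first exact: cvg_cst.
  have := @cvg_expr R 2^-1; rewrite ger0_norm ?invr_ge0// invf_lt1// ltr1n => /(_ isT).
  by under eq_cvg do rewrite exprVn.
rewrite -(mulr0 M) -(cvg_lim _ c)//; apply: limr_ge; first by apply/cvg_ex; eexists; exact: c.
by near=> n; exact: H.
Unshelve. all: by end_near. Qed.

End GeometricSeries.

(** The maps [sc s] multiply some of the coordinates by [s] and leave the
    others unchanged: the former are the variables of a differential system,
    the latter its parameters. *)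
Record scaling (R : realType) (V : normedModType R) (fV : frame V) := Scaling {
  sc :> R -> V -> V;
  scflag : fidx fV -> bool;
  scE : forall s v i, fcoord fV i (sc s v) = (if scflag i then s else 1) * fcoord fV i v
}.

Arguments scflag {R V fV} _ _.

Section Scaling.
Context {R : realType} (V : normedModType R) (fV : frame V) (S : scaling fV).

Lemma scM s t v : S s (S t v) = S (s * t) v.
Proof.
rewrite (frameE fV (S s _)) (frameE fV (S (s * t) v)); apply: eq_bigr => i _.
by rewrite !(scE S); case: ifP => _; rewrite ?mul1r// mulrA.
Qed.

Lemma sc1 v : S 1 v = v.
Proof.
rewrite (frameE fV (S 1 v)) [RHS](frameE fV v); apply: eq_bigr => i _.
by rewrite (scE S) if_same mul1r.
Qed.

Lemma fcoordB i (u v : V) : fcoord fV i (u - v) = fcoord fV i u - fcoord fV i v.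
Proof.
by rewrite addrC -scaleN1r fcoord_linear /GRing.scale/= mulN1r addrC.
Qed.

Lemma scB s u v : S s (u - v) = S s u - S s v.
Proof.
rewrite (frameE fV (S s (u - v))) (frameE fV (S s u - S s v)); apply: eq_bigr => i _.
by rewrite fcoordB !(scE S) fcoordB mulrBr.
Qed.

Lemma sc_smooth k (O : set (R * V)) : open O -> Ck k O (fun p => S p.1 p.2).
Proof.
move=> oO; apply: (Ck_of_coords (fV := fV)) => // i.
have c : Ck k O (fun p : R * V => fcoord fV i p.2).
  by apply: Ck_coord => //; apply: Ck_snd_comp => //; exact: Ck_id.
case fl : (scflag S i).
  have H := CkM oO (Ck_fst_comp oO (Ck_id k O)) c.
  by apply: eq_Ck H => // p _; rewrite (scE S) fl.
by apply: eq_Ck c => // p _; rewrite (scE S) fl mul1r.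
Qed.

Definition prod_sc (s : R) (q : V * V) : V * V := (S s q.1, S s q.2).

Definition prod_scaling : scaling (prod_frame fV fV).
Proof.
exists prod_sc (fun i => match i with inl i => scflag S i | inr i => scflag S i end).
by move=> s v [i|i] /=; rewrite scE.
Defined.

End Scaling.

Section RadialOperator.
Context {R : realType} (V : normedModType R) (fV : frame V) (S : scaling fV).
Variables (U : set V) (B : set R) (A : finType).
Hypotheses (oU : open U) (oB : open B).
Hypothesis B01 : forall s : R, 0 <= s <= 1 -> B s.
Hypothesis stableU : forall (s : R) z, 0 <= s <= 1 -> U z -> U (S s z).
Implicit Types (b : A -> A -> R * V -> R) (X Y c : A -> V -> R).

Let BU : set (R * V) := [set p | B p.1 /\ U p.2].

Let dom : set (R * V) := [set p | BU p /\ U (S p.1 p.2)].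

Lemma open_BU : open BU.
Proof.
apply: openI; apply: open_comp => // p _.
  exact: cvg_fst.
exact: cvg_snd.
Qed.

Let odom : open dom.
Proof.
apply: openI; first exact: open_BU.
apply: open_comp => // p _; exact: (Ck_continuous (sc_smooth S 0 openT) I).
Qed.

Let dom01 (s : R) z : 0 <= s <= 1 -> U z -> dom (s, z).
Proof. by move=> s01 Uz; split; [split; [exact: B01|]|exact: stableU]. Qed.

(** With [b a d (s, z)] the matrix of a linear differential equation along the
    ray [s |-> S s z], the equation [X = c + radial b X] is its integral form. *)
Definition radial b X (a : A) (z : V) : R :=
  int01 (fun s => \sum_d b a d (s, z) * X d (S s z)).

Let integrand_smooth k b X a : (forall a d, Ck k BU (b a d)) ->
  (forall d, Ck k U (X d)) ->
  Ck k dom (fun p => \sum_d b a d p * X d (S p.1 p.2)).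
Proof.
move=> cb cX; apply: Ck_sum => // d _; apply: CkM => //.
  by apply: Ck_subset (cb a d) => p [].
by apply: (Ck_comp fV odom (sc_smooth S k odom) (cX d)) => p [].
Qed.

Lemma Ck_radial k b X a : (forall a d, Ck k BU (b a d)) ->
  (forall d, Ck k U (X d)) -> Ck k U (radial b X a).
Proof.
move=> cb cX; exact: (Ck_int01 fV oU dom01 (integrand_smooth a cb cX)).
Qed.

Lemma radial_cont01 b X a z : (forall a d, Ck 0 BU (b a d)) ->
  (forall d, Ck 0 U (X d)) -> U z ->
  cont01 (fun s => \sum_d b a d (s, z) * X d (S s z)).
Proof.
move=> cb cX Uz; exact: (section_cont01 dom01 (integrand_smooth a cb cX)).
Qed.

Lemma radialB b X Y a z : (forall a d, Ck 0 BU (b a d)) ->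
  (forall d, Ck 0 U (X d)) -> (forall d, Ck 0 U (Y d)) -> U z ->
  radial b (fun d z => X d z - Y d z) a z = radial b X a z - radial b Y a z.
Proof.
move=> cb cX cY Uz; rewrite -int01B; try exact: radial_cont01.
apply: eq_int01 => s _; rewrite -sumrB; apply: eq_bigr => d _; ring.
Qed.

Lemma radialD b X Y a z : (forall a d, Ck 0 BU (b a d)) ->
  (forall d, Ck 0 U (X d)) -> (forall d, Ck 0 U (Y d)) -> U z ->
  radial b (fun d z => X d z + Y d z) a z = radial b X a z + radial b Y a z.
Proof.
move=> cb cX cY Uz; rewrite -int01D; try exact: radial_cont01.
apply: eq_int01 => s _; rewrite -big_split; apply: eq_bigr => d _ /=; ring.
Qed.

Definition small b := forall a (s : R) z, 0 <= s <= 1 -> U z ->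
  \sum_d `|b a d (s, z)| <= 2^-1.

(** The bound is required along the whole orbit of [z], so that it can be
    iterated. *)
Definition orbit_le X (M : R) z := forall a (s : R), 0 <= s <= 1 -> `|X a (S s z)| <= M.

(** The operator halves bounds along orbits: at [S t z] its integrand only
    involves the points [S (s t) z]. *)
Lemma orbit_radial b X M z : (forall a d, Ck 0 BU (b a d)) -> small b ->
  (forall d, Ck 0 U (X d)) -> U z -> orbit_le X M z -> orbit_le (radial b X) (M / 2) z.
Proof.
move=> cb sb cX Uz XM a t t01; have Uz' := stableU t01 Uz.
apply: int01_norm_le; first exact: radial_cont01.
move=> s s01; apply: le_trans (ler_norm_sum _ _ _) _.
apply: (@le_trans _ _ (\sum_d `|b a d (s, S t z)| * M)).
  apply: ler_sum => d _; rewrite normrM ler_wpM2l// scM; apply: XM.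
  case/andP: s01 => s0 s1; case/andP: t01 => t0 t1.
  by apply/andP; split; [exact: mulr_ge0|exact: mulr_ile1].
rewrite -mulr_suml mulrC ler_wpM2l//; last exact: sb.
exact: le_trans (XM a 0 (zero_in01)).
Qed.

(** Orbit bounds are locally uniform, again by compactness of the unit interval. *)
Lemma orbit_bounded X z : (forall d, Ck 0 U (X d)) -> U z ->
  exists M : R, \forall z' \near z, orbit_le X M z'.
Proof.
move=> cX Uz.
have /choice[M MP] : forall a, exists M : R, \forall z' \near z, forall s : R,
    0 <= s <= 1 -> `|X a (S s z')| <= M.
  move=> a; have cXa : Ck 0 dom (fun p => X a (S p.1 p.2)).
    by apply: (Ck_comp fV odom (sc_smooth S 0 odom) (cX a)) => p [].
  have c1 : cont01 (fun s => X a (S s z)) := section_cont01 dom01 cXa Uz.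
  have c2 : {within `[0, 1], continuous (fun s => `|X a (S s z)|)}.
    apply: (cont01_within (one_in01 (R := R))) => s s01.
    by apply: continuous_comp; [exact: c1|exact: norm_continuous].
  have [s0 _ s0P] := EVT_max ler01 c2.
  exists (`|X a (S s0 z)| + 1).
  have c3 (s : R) : 0 <= s <= 1 -> {for (s, z), continuous (fun p => X a (S p.1 p.2))}.
    by move=> s01; apply: cXa; exact: dom01.
  apply: filterS (tube_continuous c3 ltr01) => z' z'P s s01.
  have := s0P s; rewrite in_itv/= => /(_ s01) h1; have /ltW h2 := z'P s s01.
  rewrite -(subrK (X a (S s z)) (X a (S s z'))); apply: le_trans (ler_normD _ _) _.
  by rewrite addrC; exact: lerD.
have {}MP : \forall z' \near z, forall a, forall s : R, 0 <= s <= 1 -> `|X a (S s z')| <= M a.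
  exact: filter_forall.
exists (\sum_a `|M a|); apply: filterS MP => z' H a s s01.
apply: le_trans (H a s s01) _; rewrite (bigD1 a)//=.
apply: le_trans (ler_norm _) _; rewrite lerDl; exact: sumr_ge0.
Qed.

Lemma radial_unique b X : (forall a d, Ck 0 BU (b a d)) -> small b ->
  (forall d, Ck 0 U (X d)) -> (forall a z, U z -> X a z = radial b X a z) ->
  forall a z, U z -> X a z = 0.
Proof.
move=> cb sb cX XE a z Uz.
have [M /nbhs_singleton HM] := orbit_bounded cX Uz.
have Hn n : orbit_le X (M / 2 ^+ n) z.
  elim: n => [|n IH]; first by rewrite expr0 divr1.
  have := orbit_radial cb sb cX Uz IH; rewrite exprSr invfM mulrA => H a' s s01.
  by rewrite XE; [exact: H|exact: stableU].
apply: (@geometric_zero _ _ M) => n.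
by have := Hn n a 1 one_in01; rewrite sc1.
Qed.

(** The sum of the iterates of [c] converges geometrically, locally uniformly,
    and its sum is a continuous solution. *)
Lemma radial_exists b c : (forall a d, Ck 0 BU (b a d)) -> small b ->
  (forall d, Ck 0 U (c d)) ->
  exists X, (forall d, Ck 0 U (X d)) /\
    forall a z, U z -> X a z = c a z + radial b X a z.
Proof.
move=> cb sb cc.
pose Y n := iter n (radial b) c.
have cY n d : Ck 0 U (Y n d).
  by elim: n d => [|n IH] d; [exact: cc|exact: Ck_radial].
have Yorb M z : U z -> orbit_le c M z -> forall n, orbit_le (Y n) (M / 2 ^+ n) z.
  move=> Uz H; elim => [|n IH]; first by rewrite expr0 divr1.
  by have := orbit_radial cb sb (cY n) Uz IH; rewrite exprSr invfM mulrA.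
pose T n a z := series (fun n => Y n a z) n.
pose X a z : R := limn (fun n => T n a z).
have cT n a : Ck 0 U (T n a).
  have H : Ck 0 U (fun z => \sum_(0 <= k < n) Y k a z).
    by apply: Ck_sum => // k _; exact: cY.
  exact: H.
have tail M z : U z -> orbit_le c M z -> forall n a (s : R), 0 <= s <= 1 ->
    `|X a (S s z) - T n a (S s z)| <= 2 * M / 2 ^+ n.
  move=> Uz H n a s s01; apply: geometric_tail => k; exact: Yorb.
have cX a : Ck 0 U (X a).
  move=> z Uz; have [M HM] := orbit_bounded cc Uz.
  have M0 : 0 <= M by have := nbhs_singleton HM a 0 zero_in01; apply: le_trans.
  apply/cvgrPdist_lt => e e0.
  have [n Hn] : exists n, 2 * M / 2 ^+ n < e / 3.
    have cn : (fun n => 2 * M / 2 ^+ n) @ \oo --> (2 * M) * 0.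
      apply: cvgM; first exact: cvg_cst.
      have := @cvg_expr R 2^-1; rewrite ger0_norm ?invr_ge0// invf_lt1// ltr1n => /(_ isT).
      by under eq_cvg do rewrite exprVn.
    have e3 : 0 < e / 3 by rewrite divr_gt0.
    move: cn; rewrite mulr0 => /cvgrPdist_lt/(_ _ e3)[n _ /(_ n (leqnn n))].
    by rewrite sub0r normrN => h; exists n; apply: le_lt_trans h; exact: ler_norm.
  have e3 : 0 < e / 3 by rewrite divr_gt0.
  have /cvgrPdist_lt/(_ _ e3) nT := cT n a z Uz.
  have nU := open_nbhs_nbhs (conj oU Uz).
  have HM0 := nbhs_singleton HM.
  apply: filterS3 nU HM nT => z' Uz' HM' hT.
  have h1 := tail M z Uz HM0 n a 1 one_in01.
  have h2 := tail M z' Uz' HM' n a 1 one_in01.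
  rewrite !sc1 in h1 h2.
  have -> : X a z - X a z' = (X a z - T n a z) + (T n a z - T n a z') - (X a z' - T n a z').
    by move: (X a z) (X a z') (T n a z) (T n a z') => x1 x2 x3 x4; ring.
  have -> : e = e / 3 + e / 3 + e / 3 by field.
  apply: le_lt_trans (ler_normB _ _) _; apply: ltrD; last exact: le_lt_trans h2 Hn.
  apply: le_lt_trans (ler_normD _ _) _; apply: ltrD => //.
  exact: le_lt_trans h1 Hn.
exists X; split => // a z Uz.
have [M /nbhs_singleton HM] := orbit_bounded cc Uz.
have T_S n : T n.+1 a z = c a z + radial b (T n) a z.
  elim: n => [|n IH].
    rewrite /T seriesSr /series/= big_nil add0r.
    rewrite -[LHS]addr0; congr (_ + _); rewrite /radial -[LHS](int01_cst 0).
    apply: eq_int01 => s _; rewrite big1// => d _; by rewrite big_nil mulr0.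
  rewrite /T seriesSr -/(T n.+1 a z) IH -addrA; congr (_ + _).
  rewrite -[Y n.+1 a z]/(radial b (Y n) a z) -radialD//.
  by apply: eq_int01 => s _; apply: eq_bigr => d _; rewrite /T seriesSr.
apply/eqP; rewrite -subr_eq0; apply/eqP; apply: (@geometric_zero _ _ (2 * M)) => n.
have h1 := tail M z Uz HM n.+1 a 1 one_in01; rewrite sc1 in h1.
have h2 : orbit_le (fun d z => X d z - T n d z) (2 * M / 2 ^+ n) z.
  by move=> d s s01; exact: tail.
have cXT d : Ck 0 U (fun z => X d z - T n d z) by apply: CkB.
have h3 := orbit_radial cb sb cXT Uz h2 a one_in01; rewrite sc1 radialB// in h3.
have -> : X a z - (c a z + radial b X a z) =
    (X a z - T n.+1 a z) - (radial b X a z - radial b (T n) a z).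
  by rewrite T_S; ring.
apply: le_trans (ler_normB _ _) _; apply: le_trans (lerD h1 h3) _.
rewrite exprS; set p := 2 ^+ n; have p0 : p != 0 by rewrite expf_neq0.
have -> : 2 * M / (2 * p) = M / p by field.
have -> : 2 * M / p / 2 = M / p by field.
by rewrite -mulrDl -mulr2n mulr_natl.
Qed.

End RadialOperator.

(** Solutions of the radial system inherit the smoothness of its coefficients:
    the difference quotients of a solution solve a radial system on the
    doubled space, and one order of differentiability is gained at each step. *)
Lemma radial_smooth (R : realType) k : forall (V : normedModType R) (fV : frame V)
    (S : scaling fV) (U : set V) (B : set R) (A : finType)
    (b : A -> A -> R * V -> R) (c X : A -> V -> R),
  open U -> open B -> (forall s : R, 0 <= s <= 1 -> B s) ->
  (forall (s : R) z, 0 <= s <= 1 -> U z -> U (S s z)) ->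
  (forall z z' (t : R), U z -> U z' -> 0 <= t <= 1 -> U (z + t *: (z' - z))) ->
  small U b -> (forall a d, Ck k [set p | B p.1 /\ U p.2] (b a d)) ->
  (forall a, Ck k U (c a)) -> (forall a, Ck 0 U (X a)) ->
  (forall a z, U z -> X a z = c a z + radial S b X a z) ->
  forall a, Ck k U (X a).
Proof.
elim: k => [//|k IH] V fV S U B A b c X oU oB B01 stU cvU sb cb cc cX XE a0.
have cb0 a d : Ck 0 [set p | B p.1 /\ U p.2] (b a d) by exact: Ck_le (cb a d).
have cXk a : Ck k U (X a).
  apply: (IH V fV S U B A b c X) => //.
    by move=> a' d; exact: CkW.
  by move=> a'; exact: CkW.
pose UU : set (V * V) := [set q | U q.1 /\ U q.2].
have oUU : open UU.
  apply: openI; apply: open_comp => // p _; first exact: cvg_fst.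
  exact: cvg_snd.
pose J := fidx fV.
pose wt (i : J) (s : R) : R := if scflag S i then s else 1.
have oBU := open_BU oU oB.
have oTU : open [set p : R * V | setT p.1 /\ U p.2] := open_BU oU openT.
have cvBU (p : R) z z' (t : R) : B p /\ U z -> B p /\ U z' -> 0 <= t <= 1 ->
    B p /\ U (z + t *: (z' - z)).
  by move=> [Bp Uz] [_ Uz'] t01; split => //; exact: cvU.
have cvTU (p : R) z z' (t : R) : setT p /\ U z -> setT p /\ U z' -> 0 <= t <= 1 ->
    setT p /\ U (z + t *: (z' - z)).
  by move=> [Bp Uz] [_ Uz'] t01; split => //; exact: cvU.
pose hb a d (i : J) := hadamard_coef (fV := fV) (b a d) i.
have chb a d i : Ck k [set p : R * (V * V) | B p.1 /\ UU p.2] (hb a d i).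
  have := Ck_hadamard (@real_frame R) oBU cvBU i (cb a d).
  by apply: Ck_subset => -[s [z z']] [/= Bs [Uz Uz']].
have cc2 a : Ck k.+1 [set p : R * V | setT p.1 /\ U p.2] (fun p => c a p.2).
  apply: (Ck_comp fV oTU _ (cc a)) => [|p []//].
  by apply: Ck_snd_comp => //; exact: Ck_id.
pose hc a (i : J) (q : V * V) := hadamard_coef (fV := fV) (fun p : R * V => c a p.2) i (0, q).
have chc a i : Ck k UU (hc a i).
  have := Ck_hadamard (@real_frame R) oTU cvTU i (cc2 a) => H.
  apply: (Ck_comp (prod_frame (@real_frame R) (prod_frame fV fV)) oUU _ H).
    by apply: Ck_pair => //; [exact: Ck_cst|exact: Ck_id].
  by move=> [z z'] [].
have cSgen m (O : set (R * (V * V))) : open O -> Ck m O (fun p => S p.1 p.2.1).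
  move=> oO; apply: (Ck_of_coords (fV := fV)) => // i.
  have H := Ck_coord i openT (sc_smooth S m openT).
  have c1 : Ck m O (fun p : R * (V * V) => (p.1, p.2.1)).
    apply: Ck_pair => //; first by apply: Ck_fst_comp => //; exact: Ck_id.
    by apply: Ck_fst_comp => //; apply: Ck_snd_comp => //; exact: Ck_id.
  exact: (Ck_comp (prod_frame (@real_frame R) fV) oO c1 H).
pose dom2 : set (R * (V * V)) := [set p | (B p.1 /\ UU p.2) /\ U (S p.1 p.2.1)].
have odom2 : open dom2.
  apply: openI; first exact: (open_BU oUU oB).
  apply: open_comp => // p _.
  exact: (Ck_continuous (cSgen 0 setT openT) I).
have dom2_01 (s : R) q : 0 <= s <= 1 -> UU q -> dom2 (s, q).
  by move=> s01 [Uz Uz']; split; [split => //; exact: B01|exact: stU].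
have cXS d : Ck k dom2 (fun p : R * (V * V) => X d (S p.1 p.2.1)).
  have cS := cSgen k dom2 odom2.
  by apply: (Ck_comp fV odom2 cS (cXk d)) => p [].
have cint a i : Ck k dom2 (fun p => \sum_d hb a d i p * X d (S p.1 p.2.1)).
  apply: Ck_sum => // d _; apply: CkM => //.
  by apply: Ck_subset (chb a d i) => p [].
(* the difference quotients of the inhomogeneous term and of the coefficients *)
pose C (ai : A * J) (q : V * V) := hc ai.1 ai.2 q +
  int01 (fun s => \sum_d hb ai.1 d ai.2 (s, q) * X d (S s q.1)).
have cC ai : Ck k UU (C ai).
  apply: CkD => //.
  exact: (Ck_int01 (prod_frame fV fV) oUU dom2_01 (cint ai.1 ai.2)).
pose b2 (ai dj : A * J) (p : R * (V * V)) :=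
  if ai.2 == dj.2 then b ai.1 dj.1 (p.1, p.2.2) * wt ai.2 p.1 else 0.
have oBUU : open [set p : R * (V * V) | B p.1 /\ UU p.2] := open_BU oUU oB.
have cb3 m a d : Ck m [set p | B p.1 /\ U p.2] (b a d) ->
    Ck m [set p : R * (V * V) | B p.1 /\ UU p.2] (fun p => b a d (p.1, p.2.2)).
  move=> cbm; apply: (Ck_comp (prod_frame (@real_frame R) fV) oBUU _ cbm).
    apply: Ck_pair => //; first by apply: Ck_fst_comp => //; exact: Ck_id.
    by apply: Ck_snd_comp => //; apply: Ck_snd_comp => //; exact: Ck_id.
  by move=> [s [z z']] /= [Bs [Uz Uz']].
have cwt m i : Ck m [set p : R * (V * V) | B p.1 /\ UU p.2] (fun p => wt i p.1).
  rewrite /wt; case: (scflag S i); last exact: Ck_cst.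
  by apply: Ck_fst_comp => //; exact: Ck_id.
have cb2 ai dj : Ck k [set p : R * (V * V) | B p.1 /\ UU p.2] (b2 ai dj).
  rewrite /b2; case: (ai.2 == dj.2); last exact: Ck_cst.
  by apply: CkM => //; apply: cb3; exact: CkW.
have wt1 i (s : R) : 0 <= s <= 1 -> `|wt i s| <= 1.
  by rewrite /wt; case: ifP => _ /andP[s0 s1]; rewrite ?normr1// ger0_norm.
have sb2 : small UU b2.
  move=> [a i] s [z z'] s01 [Uz Uz'].
  rewrite -(pair_bigA _ (fun d j => `|b2 (a, i) (d, j) (s, (z, z'))|))/=.
  apply: le_trans (sb a s z' s01 Uz'); apply: ler_sum => d _.
  rewrite (bigD1 i)//= big1 ?addr0 => [|j ji].
    by rewrite /b2/= eqxx normrM ler_piMr// wt1.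
  by rewrite /b2/= eq_sym (negbTE ji) normr0.
have stUU (s : R) q : 0 <= s <= 1 -> UU q -> UU (prod_scaling S s q).
  by move=> s01 [Uz Uz']; split; exact: stU.
have cvUU q q' (t : R) : UU q -> UU q' -> 0 <= t <= 1 -> UU (q + t *: (q' - q)).
  by move=> [u1 u2] [v1 v2] t01; split; exact: cvU.
have cb20 ai dj : Ck 0 [set p : R * (V * V) | B p.1 /\ UU p.2] (b2 ai dj).
  exact: Ck_le (cb2 ai dj).
have cC0 ai : Ck 0 UU (C ai) by exact: Ck_le (cC ai).
have [Phi [cPhi PhiE]] := radial_exists (S := prod_scaling S) oUU oB B01 stUU cb20 sb2 cC0.
have cPhik ai : Ck k UU (Phi ai).
  exact: (IH _ _ (prod_scaling S) UU B _ b2 C Phi).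
pose Delta a (q : V * V) := X a q.2 - X a q.1 - \sum_i fcoord fV i (q.2 - q.1) * Phi (a, i) q.
pose b3 a d (p : R * (V * V)) := b a d (p.1, p.2.2).
have cX1 a : Ck 0 UU (fun q => X a q.1).
  apply: (Ck_comp fV oUU _ (cX a)) => [|q []//].
  by apply: Ck_fst_comp => //; exact: Ck_id.
have cX2 a : Ck 0 UU (fun q => X a q.2).
  apply: (Ck_comp fV oUU _ (cX a)) => [|q []//].
  by apply: Ck_snd_comp => //; exact: Ck_id.
have cDelta a : Ck 0 UU (Delta a).
  apply: CkB => //; first exact: CkB.
  apply: Ck_sum => // i _; apply: CkM => //; apply: Ck_coord => //.
  by apply: CkB => //; [apply: Ck_snd_comp|apply: Ck_fst_comp] => //; exact: Ck_id.
have cb30 a d : Ck 0 [set p : R * (V * V) | B p.1 /\ UU p.2] (b3 a d) by exact: cb3.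
have sb3 : small UU b3 by move=> a s [z z'] s01 [_ Uz']; exact: sb.
have DeltaE a q : UU q -> Delta a q = radial (prod_scaling S) b3 Delta a q.
  move: q => [z z'] [/= Uz Uz']; have Uq : UU (z, z') by [].
  pose I1 s := \sum_d b a d (s, z') * X d (S s z').
  pose I2 s := \sum_d b a d (s, z) * X d (S s z).
  pose I3 s := \sum_i fcoord fV i (z' - z) * \sum_d hb a d i (s, (z, z')) * X d (S s z).
  pose I4 s := \sum_i fcoord fV i (z' - z) *
    \sum_dj b2 (a, i) dj (s, (z, z')) * Phi dj (prod_scaling S s (z, z')).
  have c1 : cont01 I1 by exact: (radial_cont01 oU oB B01 stU cb0 cX Uz').
  have c2 : cont01 I2 by exact: (radial_cont01 oU oB B01 stU cb0 cX Uz).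
  have c3 i : cont01 (fun s => \sum_d hb a d i (s, (z, z')) * X d (S s z)).
    exact: (section_cont01 dom2_01 (cint a i) Uq).
  have c4 i : cont01 (fun s => \sum_dj b2 (a, i) dj (s, (z, z')) *
      Phi dj (prod_scaling S s (z, z'))).
    exact: (radial_cont01 oUU oB B01 stUU cb20 cPhi Uq).
  have c3' : cont01 I3.
    by apply: cont01_sum => i _; apply: cont01M => //; exact: cont01_cst.
  have c4' : cont01 I4.
    by apply: cont01_sum => i _; apply: cont01M => //; exact: cont01_cst.
  have E1 : X a z' = c a z' + int01 I1 by exact: XE.
  have E2 : X a z = c a z + int01 I2 by exact: XE.
  have E3 : c a z' - c a z = \sum_i fcoord fV i (z' - z) * hc a i (z, z').
    exact: (hadamardE (f := fun p : R * V => c a p.2) (p := (0 : R)) (z := z) (z' := z')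
      (@real_frame R) fV oTU cvTU (Ck_le (ltn0Sn k) (cc2 a)) (conj I Uz) (conj I Uz')).
  have E4 : \sum_i fcoord fV i (z' - z) * Phi (a, i) (z, z') =
      (c a z' - c a z) + int01 I3 + int01 I4.
    rewrite E3 /I3 /I4 !int01_sum; last 2 first.
    - by move=> i _; apply: cont01M => //; exact: cont01_cst.
    - by move=> i _; apply: cont01M => //; exact: cont01_cst.
    rewrite -!big_split/=; apply: eq_bigr => i _.
    by rewrite !int01Z// PhiE// /C/= !mulrDr.
  have -> : Delta a (z, z') = int01 I1 - int01 I2 - int01 I3 - int01 I4.
    by rewrite /Delta/= E4 E1 E2; ring.
  rewrite -!int01B//; try by do ?[apply: cont01D|apply: cont01N].
  apply: eq_int01 => s s01 /=.
  have Sz := stU s z s01 Uz; have Sz' := stU s z' s01 Uz'.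
  rewrite /I1 /I2 -sumrB.
  have -> : I3 s = \sum_d (b a d (s, z') - b a d (s, z)) * X d (S s z).
    rewrite /I3; under eq_bigr do rewrite mulr_sumr.
    rewrite exchange_big/=; apply: eq_bigr => d _.
    have := hadamardE (f := b a d) (p := s) (z := z) (z' := z') (@real_frame R) fV oBU cvBU
      (Ck_le (ltn0Sn k) (cb a d)) (conj (B01 _ s01) Uz) (conj (B01 _ s01) Uz').
    by move=> ->; rewrite mulr_suml; apply: eq_bigr => i _; rewrite mulrA.
  have -> : I4 s = \sum_d b a d (s, z') *
      \sum_i fcoord fV i (S s z' - S s z) * Phi (d, i) (prod_scaling S s (z, z')).
    rewrite /I4; under [RHS]eq_bigr do rewrite mulr_sumr.
    rewrite [RHS]exchange_big/=; apply: eq_bigr => i _.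
    transitivity (fcoord fV i (z' - z) * \sum_d \sum_j b2 (a, i) (d, j) (s, (z, z')) *
        Phi (d, j) (prod_scaling S s (z, z'))).
      by congr (_ * _); rewrite pair_bigA/=; apply: eq_bigr => -[].
    rewrite mulr_sumr; apply: eq_bigr => d _.
    rewrite (bigD1 i)//= big1 ?addr0 => [|j ji]; last first.
      by rewrite /b2/= eq_sym (negbTE ji) mul0r.
    by rewrite /b2/= eqxx -scB scE -/(wt i s); ring.
  rewrite -!sumrB; apply: eq_bigr => d _; rewrite /b3 /Delta/=; ring.
have Delta0 := radial_unique (S := prod_scaling S) oUU oB B01 stUU cb30 sb3 cDelta DeltaE.
apply: (caratheodory_Ck (phi := fun i => Phi (a0, i)) oU) => // z z' Uz Uz'.
have := Delta0 a0 (z, z') (conj Uz Uz'); rewrite /Delta/= => /eqP.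
by rewrite subr_eq0 => /eqP.
Qed.

(** * Total differential systems with parameters *)

Section DeriveCalculus.
Context {R : realType} (V : normedModType R).
Implicit Types (f g : V -> R) (z v : V).

Lemma deriveD_fun f g z v : differentiable f z -> differentiable g z ->
  'D_v (fun z => f z + g z) z = 'D_v f z + 'D_v g z.
Proof. by move=> df dg; apply: (@deriveD _ _ _ f g); exact: diff_derivable. Qed.

Lemma deriveB_fun f g z v : differentiable f z -> differentiable g z ->
  'D_v (fun z => f z - g z) z = 'D_v f z - 'D_v g z.
Proof. by move=> df dg; apply: (@deriveB _ _ _ f g); exact: diff_derivable. Qed.

Lemma deriveM_fun f g z v : differentiable f z -> differentiable g z ->
  'D_v (fun z => f z * g z) z = 'D_v f z * g z + f z * 'D_v g z.
Proof.
move=> df dg; rewrite (@deriveM _ _ f g z v); do ?exact: diff_derivable.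
by rewrite addrC /GRing.scale/= [g z * _]mulrC.
Qed.

Lemma deriveZ_fun (c : R) f z v : differentiable f z ->
  'D_v (fun z => c * f z) z = c * 'D_v f z.
Proof. by move=> df; apply: (@deriveZ _ _ _ f); exact: diff_derivable. Qed.

Lemma derive_sum_fun (J : finType) (f : J -> V -> R) z v :
  (forall j, differentiable (f j) z) ->
  'D_v (fun z => \sum_j f j z) z = \sum_j 'D_v (f j) z.
Proof.
move=> df.
suff [] : differentiable (fun z => \sum_j f j z) z /\
    'D_v (fun z => \sum_j f j z) z = \sum_j 'D_v (f j) z by [].
elim: (index_enum J) => [|j r [IH1 IH2]].
  have -> : (fun z => \sum_(j <- [::]) f j z) = cst 0.
    by apply/funext => y; rewrite big_nil.
  by rewrite big_nil derive_cst; split => //; exact: differentiable_cst.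
have -> : (fun z => \sum_(j <- j :: r) f j z) = (fun z => f j z + \sum_(j <- r) f j z).
  by apply/funext => y; rewrite big_cons.
split; first exact: differentiableD.
by rewrite deriveD_fun// big_cons IH2.
Qed.

Lemma differentiable_sum_fun (J : finType) (f : J -> V -> R) z :
  (forall j, differentiable (f j) z) -> differentiable (fun z => \sum_j f j z) z.
Proof.
move=> df; elim: (index_enum J) => [|j r IH].
  have -> : (fun z => \sum_(j <- [::]) f j z) = cst 0.
    by apply/funext => y; rewrite big_nil.
  exact: differentiable_cst.
have -> : (fun z => \sum_(j <- j :: r) f j z) = (fun z => f j z + \sum_(j <- r) f j z).
  by apply/funext => y; rewrite big_cons.
exact: differentiableD.
Qed.

Lemma differentiable_linear (W : normedModType R) (L : V -> W) z :
  linear L -> continuous L -> differentiable L z.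
Proof. by move=> Ll Lc; have [d _] := Ck_linear 1 setT Ll Lc; exact: d. Qed.

Lemma derive_linear (W : normedModType R) (L : V -> W) z v :
  linear L -> continuous L -> 'D_v L z = L v.
Proof.
move=> Ll Lc; have di : differentiable (@id V) z by exact: ex_diff.
by have [_ ->] := differentiable_linear_comp Ll Lc di; rewrite derive_id.
Qed.

Lemma smooth_differentiable (W : normedModType R) (O : set V) (f : V -> W) z :
  smooth_on O f -> O z -> differentiable f z.
Proof. by move=> /(_ 1%N)[df _] Oz; exact: df. Qed.

Lemma smooth_der (W : normedModType R) (O : set V) (f : V -> W) v :
  smooth_on O f -> smooth_on O ('D_v f).
Proof. by move=> sf k; have [_] := sf k.+1; apply. Qed.

End DeriveCalculus.

Section TotalSystem.
Context {R : realType} (P : normedModType R) (fP : frame P) (n : nat).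
Local Notation W := 'rV[R]_n.
Local Notation Z := (P * W)%type.
Let fZ := prod_frame fP (row_frame (R := R) n).

Definition dw (j : 'I_n) (f : Z -> R) (z : Z) : R :=
  'D_((0, delta_mx 0 j) : Z) f z.

Lemma derive_dw (f : Z -> R) z (w : W) : differentiable f z ->
  'D_((0, w) : Z) f z = \sum_j w 0 j * dw j f z.
Proof.
move=> df; rewrite (derive_frame fZ)// big_sumType/= big1 ?add0r// => i _.
have := fcoord_linear fP i (-1) 0 0; rewrite scaler0 addr0 => ->.
by rewrite scaleN1r addNr scale0r.
Qed.

(** The second component is the variable, the first one the parameter. *)
Definition leaf_sc (s : R) (z : Z) : Z := (z.1, s *: z.2).

Definition leaf_scaling : scaling fZ.
Proof.
exists leaf_sc (fun i => match i with inl _ => false | inr _ => true end).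
by move=> s v [i|i] /=; rewrite ?mul1r// mxE.
Defined.

Variables (A : finType) (Om : 'I_n -> A -> A -> Z -> R) (O : set Z) (p0 : P).
Hypotheses (oO : open O) (O0 : O (p0, 0)).
Hypothesis sOm : forall j a d, smooth_on O (Om j a d).
Hypothesis flat : forall i j a e z, O z ->
  dw i (Om j a e) z - dw j (Om i a e) z
  + \sum_d (Om j a d z * Om i d e z - Om i a d z * Om j d e z) = 0.

Definition cyl (r : R) : set Z := [set z | ball p0 r z.1 /\ ball (0 : W) r z.2].

Lemma open_cyl r : open (cyl r).
Proof.
apply: openI; apply: open_comp (ball_open _ _) => // z _.
  exact: cvg_fst.
exact: cvg_snd.
Qed.

Let ball0 (r : R) (w : W) : ball (0 : W) r w = (`|w| < r) :> Prop.
Proof. by rewrite -ball_normE/= sub0r normrN. Qed.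

Lemma cyl_scale r (s : R) z : `|s| <= 1 -> cyl r z -> cyl r (leaf_sc s z).
Proof.
move=> s1 [z1 z2]; split => //; move: z2; rewrite !ball0 /leaf_sc/= => z2.
rewrite normrZ; apply: le_lt_trans z2; by rewrite ler_piMl.
Qed.

Lemma cyl_convex r z z' (t : R) : cyl r z -> cyl r z' -> 0 <= t <= 1 ->
  cyl r (z + t *: (z' - z)).
Proof.
have conv (V : normedModType R) (c x y : V) : ball c r x -> ball c r y -> 0 <= t <= 1 ->
    ball c r (x + t *: (y - x)).
  rewrite -!ball_normE/= => h1 h2 /andP[t0 t1].
  have -> : c - (x + t *: (y - x)) = (1 - t) *: (c - x) + t *: (c - y).
    rewrite scalerBl scale1r -addrA [- _ + _]addrC -scalerBr.
    have -> : (c - y) - (c - x) = x - y by rewrite opprB addrC addrA subrK.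
    by rewrite opprD addrA -scalerN opprB.
  apply: le_lt_trans (ler_normD _ _) _; rewrite !normrZ (ger0_norm t0).
  rewrite ger0_norm ?subr_ge0//.
  have [->|tn0] := eqVneq t 0; first by rewrite subr0 mul1r mul0r addr0.
  have t0' : 0 < t by rewrite lt_def tn0.
  have e1 : (1 - t) * `|c - x| <= (1 - t) * r by rewrite ler_wpM2l ?subr_ge0// ltW.
  have e2 : t * `|c - y| < t * r by rewrite ltr_pM2l.
  by have := ler_ltD e1 e2; rewrite -mulrDl subrK mul1r.
by move=> [a1 a2] [b1 b2] t01; split; exact: conv.
Qed.

Let coef (a d : A) (p : R * Z) : R :=
  \sum_j p.2.2 0 j * Om j a d (leaf_sc p.1 p.2).

(** The matrix of the radial equation contains the factor [z.2], hence is small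
    on thin cylinders; doubling the radius leaves room for values of the ray
    parameter slightly larger than 1. *)
Lemma small_cylinder r0 : 0 < r0 -> exists r, [/\ 0 < r, r <= r0, cyl (2 * r) `<=` O &
  small (cyl r) coef].
Proof.
move=> r00.
have nOm j a d : \forall z \near (p0, 0 : W), `|Om j a d (p0, 0) - Om j a d z| < 1.
  have /cvgrPdist_lt/(_ _ ltr01) : {for (p0, 0 : W), continuous (Om j a d)}.
    exact: (Ck_continuous (sOm j a d 0%N) O0).
  by [].
have nall : \forall z \near (p0, 0 : W), O z /\ forall j a d, `|Om j a d (p0, 0) - Om j a d z| < 1.
  have n2 : \forall z \near (p0, 0 : W), forall j a d, `|Om j a d (p0, 0) - Om j a d z| < 1.
    have FF : Filter (nbhs ((p0, 0) : P * W)) by exact: nbhs_filter.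
    have n1 j a := @filter_forall _ A
      (fun d z => `|Om j a d (p0, 0) - Om j a d z| < 1) (nbhs (p0, 0 : W)) FF (nOm j a).
    have n2 j := @filter_forall _ A
      (fun a z => forall d, `|Om j a d (p0, 0) - Om j a d z| < 1) (nbhs (p0, 0 : W)) FF (n1 j).
    exact: (@filter_forall _ 'I_n
      (fun j z => forall a d, `|Om j a d (p0, 0) - Om j a d z| < 1) (nbhs (p0, 0 : W)) FF n2).
  by apply: filterS2 (open_nbhs_nbhs (conj oO O0)) n2 => z Oz H; split.
have /nbhs_ballP[e /= e0 eP] := nall.
have cylball r : r <= e -> cyl r `<=` ball (p0, 0 : W) e.
  by move=> re z [z1 z2]; split; apply: le_ball re _ _.
pose K := \sum_j \sum_a \sum_d (`|Om j a d (p0, 0)| + 1).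
have K0 : 0 <= K.
  by apply: sumr_ge0 => j _; apply: sumr_ge0 => a _; apply: sumr_ge0 => d _; rewrite addr_ge0.
pose r := Num.min r0 (Num.min (e / 2) (2^-1 / (K + 1))).
have K1 : 0 < K + 1 by rewrite ltr_wpDl.
have r_0 : 0 < r by rewrite !lt_min r00 !divr_gt0// invr_gt0.
have r_r0 : r <= r0 by rewrite ge_min lexx.
have re : 2 * r <= e.
  have : r <= e / 2 by rewrite !ge_min lexx !orbT.
  by rewrite ler_pdivlMr// mulrC.
have rK : r * K <= 2^-1.
  have : r <= 2^-1 / (K + 1) by rewrite !ge_min lexx !orbT.
  rewrite ler_pdivlMr// mulrDr mulr1; apply: le_trans; rewrite lerDl; exact: ltW.
exists r; split => //.
  by move=> z /(cylball _ re)/eP[].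
move=> a s z s01 zr.
have s1 : `|s| <= 1 by case/andP: s01 => s0 s1; rewrite ger0_norm.
have [_ Omz] : O (leaf_sc s z) /\ forall j a d,
    `|Om j a d (p0, 0) - Om j a d (leaf_sc s z)| < 1.
  apply: eP; apply: (cylball r); last exact: cyl_scale.
  by move: re r_0; clearbody r; lra.
have zj j : `|z.2 0 j| <= r.
  have [_] := zr; rewrite ball0 => /ltW; apply: le_trans.
  by rewrite /Num.norm/= mx_normrE; exact: (le_bigmax _ (fun i => `|z.2 i.1 i.2|) (ord0, j)).
apply: le_trans rK; rewrite /coef/=.
apply: (@le_trans _ _ (\sum_d \sum_j r * (`|Om j a d (p0, 0)| + 1))).
  apply: ler_sum => d _; apply: le_trans (ler_norm_sum _ _ _) _.
  apply: ler_sum => j _; rewrite normrM; apply: ler_pM => //.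
  have := Omz j a d; rewrite distrC => /ltW h.
  rewrite -(subrK (Om j a d (p0, 0)) (Om j a d (leaf_sc s z))).
  apply: le_trans (ler_normD _ _) _; rewrite addrC; exact: lerD.
rewrite exchange_big/=; under eq_bigr do rewrite -mulr_sumr.
apply: (@le_trans _ _ (r * \sum_j \sum_d (`|Om j a d (p0, 0)| + 1))).
  by rewrite mulr_sumr.
apply: (ler_wpM2l (ltW r_0)); apply: ler_sum => j _.
rewrite [leRHS](bigD1 a)//= lerDl; apply: sumr_ge0 => a' _; apply: sumr_ge0 => d _.
by rewrite addr_ge0.
Qed.

Section Solve.
Variable r : R.
Hypotheses (r_gt0 : 0 < r) (rO : cyl (2 * r) `<=` O) (smallr : small (cyl r) coef).

Let U := cyl r.
(* an open interval containing the values of the ray parameter *)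
Let B := ball (0 : R) 2.

Let UO z : U z -> O z.
Proof.
move=> [z1 z2]; apply: rO; have h : r <= 2 * r by move: r_gt0; lra.
by split; apply: le_ball h _ _.
Qed.

Let B01 (s : R) : 0 <= s <= 1 -> B s.
Proof.
move=> /andP[s0 s1]; rewrite /B -ball_normE/= sub0r normrN ger0_norm//.
by apply: le_lt_trans s1 _; rewrite ltr1n.
Qed.

Let oB : open B. Proof. exact: ball_open. Qed.
Let oU : open U. Proof. exact: open_cyl. Qed.

Let stU (s : R) z : 0 <= s <= 1 -> U z -> U (leaf_scaling s z).
Proof. by move=> /andP[s0 s1] Uz; apply: cyl_scale => //; rewrite ger0_norm. Qed.

Let ccoef k a d : Ck k [set p | B p.1 /\ U p.2] (coef a d).
Proof.
have oBU := open_BU oU oB.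
apply: Ck_sum => // j _; apply: CkM => //.
  apply: (Ck_coord (fV := row_frame (R := R) n) j) => //.
  by apply: Ck_snd_comp => //; apply: Ck_snd_comp => //; exact: Ck_id.
have H := sc_smooth leaf_scaling k oBU.
apply: (Ck_comp fZ oBU H (sOm j a d k)) => -[s z] /= [Bs [z1 z2]].
apply: rO; split.
  by apply: le_ball z1; move: r_gt0; lra.
move: Bs z2; rewrite /B -ball_normE /ball_/= sub0r normrN => s2.
rewrite !ball0 /leaf_sc/= normrZ => z2.
have [->|s0] := eqVneq s 0; first by rewrite normr0 mul0r mulr_gt0.
apply: (@le_lt_trans _ _ (`|s| * r)); first by rewrite ler_wpM2l// ltW.
by rewrite ltr_pM2r.
Qed.

(** A totally integrable linear system, depending smoothly on parameters, has
    smooth solutions with arbitrary smooth initial values along [w = 0].  The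
    solution is found along the rays [t w]; that it solves the system in all
    directions follows from flatness, since the defect solves a homogeneous
    linear system along each ray. *)
Lemma total_system_solution (L : A -> P -> R) :
  (forall a, smooth_on (ball p0 r) (L a)) ->
  exists X : A -> Z -> R,
    [/\ forall a, smooth_on (cyl r) (X a),
        forall a p, ball p0 r p -> X a (p, 0) = L a p &
        forall j a z, cyl r z -> dw j (X a) z = \sum_d Om j a d z * X d z].
Proof.
move=> sL.
pose c a (z : Z) := L a z.1.
have sc a k : Ck k U (c a).
  apply: (Ck_comp fP oU _ (sL a k)); last by move=> z [].
  by apply: Ck_fst_comp => //; exact: Ck_id.
have [X [cX XE]] := radial_exists (S := leaf_scaling) oU oB B01 stU (ccoef 0) smallr
  (fun a => sc a 0%N).
have sX a : smooth_on U (X a).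
  move=> k; apply: (radial_smooth oU oB B01 stU _ smallr (ccoef k) (fun a => sc a k) cX XE).
  by move=> z z' t; exact: cyl_convex.
have X0 a p : ball p0 r p -> X a (p, 0) = L a p.
  move=> pr; have Up : U (p, 0) by split => //; rewrite ball0 normr0.
  rewrite XE// /c/= [X in _ + X](_ : _ = 0) ?addr0// -[RHS]int01_cst.
  apply: eq_int01 => s _; apply: big1 => d _.
  by rewrite /coef big1 ?mul0r// => j _; rewrite /= mxE mul0r.
have dX a z : U z -> differentiable (X a) z by exact: smooth_differentiable.
have dOm j a d z : U z -> differentiable (Om j a d) z.
  by move=> Uz; apply: (smooth_differentiable (sOm j a d)); exact: UO.
(* the equation in the radial direction *)
have radE a z : U z ->
    \sum_j z.2 0 j * dw j (X a) z = \sum_d (\sum_j z.2 0 j * Om j a d z) * X d z.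
  move=> Uz.
  have [t t01 Uz'] : exists2 t : R, 0 < t < 1 & U (z.1, t^-1 *: z.2).
    have [z1 z2] := Uz; move: z2; rewrite ball0 => z2.
    pose t := (`|z.2| + r) / (2 * r).
    have t0 : 0 < t by rewrite divr_gt0// ?mulr_gt0// ltr_wpDl.
    have t1 : t < 1 by rewrite ltr_pdivrMr ?mulr_gt0// mul1r mulrDl mul1r ltrD2r.
    exists t; first by rewrite t0 t1.
    split => //=; rewrite ball0 normrZ normfV (gtr0_norm t0) mulrC ltr_pdivrMr//.
    have -> : r * t = (`|z.2| + r) / 2 by rewrite /t; field; rewrite gt_eqF.
    by rewrite ltr_pdivlMr//; lra.
  move: Uz'; set w := t^-1 *: z.2 => Uz'.
  have [t0 t1] := andP t01.
  have zE : z = leaf_sc t (z.1, w).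
    by rewrite /leaf_sc/= /w scalerA mulfV ?gt_eqF// scale1r; case: (z).
  pose beta (s : R) := \sum_d coef a d (s, (z.1, w)) * X d (leaf_sc s (z.1, w)).
  have cb : cont01 beta by exact: (radial_cont01 oU oB B01 stU (ccoef 0) cX Uz').
  have dbeta := is_derive_int01_scaled cb t01.
  have XtE (s : R) : 0 < s < 1 -> X a (leaf_sc s (z.1, w)) =
      c a z + int01 (fun u => s * beta (u * s)).
    move=> /andP[s0 s1]; rewrite XE; last by apply: stU => //; rewrite !ltW.
    congr (_ + _); apply: eq_int01 => u _; rewrite /beta mulr_sumr.
    apply: eq_bigr => d _; rewrite mulrA; congr (_ * _).
      rewrite /coef mulr_sumr; apply: eq_bigr => j _.
      by rewrite /leaf_sc/= mxE scalerA mulrA.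
    by congr (X d _); rewrite /leaf_scaling/= /leaf_sc/= scalerA.
  have d1 : is_derive t (1 : R) (fun s => X a (leaf_sc s (z.1, w))) (beta t).
    apply: (@near_eq_is_derive _ _ _ (fun s : R => c a z + int01 (fun u => s * beta (u * s)))
      (fun s : R => X a (leaf_sc s (z.1, w))) t (1 : R)).
      have : \forall s \near t, s \in `]0, 1[%R by apply: near_in_itvoo; rewrite in_itv.
      by apply: filterS => s; rewrite in_itv/= => s01; rewrite XtE.
    have := is_deriveD (is_derive_cst (c a z) t (1 : R)) dbeta.
    by rewrite add0r.
  have lin (s : R) : leaf_sc s (z.1, w) = (z.1, 0) + s *: ((0, w) : Z).
    by apply: injective_projections => /=; rewrite ?scaler0 ?addr0 ?add0r.
  have d2 : is_derive t (1 : R) (fun s => X a ((z.1, 0) + s *: ((0, w) : Z)))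
      ('D_((0, w) : Z) (X a) ((z.1, 0) + t *: ((0, w) : Z))).
    by apply: is_derive_line; rewrite -lin -zE; exact: dX.
  have e12 : (fun s => X a ((z.1, 0) + s *: ((0, w) : Z))) =
             (fun s => X a (leaf_sc s (z.1, w))).
    by apply/funext => s; rewrite lin.
  have D12 : 'D_((0, w) : Z) (X a) z = beta t.
    rewrite zE lin -[RHS](@derive_val _ _ _ _ _ _ _ d1) -e12.
    by rewrite (@derive_val _ _ _ _ _ _ _ d2).
  have wz j : z.2 0 j = t * w 0 j by rewrite {1}zE /leaf_sc/= mxE.
  under eq_bigr do rewrite wz -mulrA.
  rewrite -mulr_sumr -derive_dw ?D12; last exact: dX.
  rewrite /beta mulr_sumr; apply: eq_bigr => d _; rewrite -zE mulrA; congr (_ * _).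
  by rewrite /coef mulr_sumr; apply: eq_bigr => j _; rewrite /= -zE wz mulrA.
(* the defect of the equations in the coordinate directions *)
pose Q j a z := dw j (X a) z - \sum_d Om j a d z * X d z.
have sQ j a : smooth_on U (Q j a).
  move=> k; apply: CkB => //.
    exact: (smooth_der _ (sX a)).
  apply: Ck_sum => // d _; apply: CkM => //; last exact: sX.
  by apply: Ck_subset (sOm j a d k) => z; exact: UO.
have dQ j a z : U z -> differentiable (Q j a) z by exact: smooth_differentiable.
have Qrad a z : U z -> \sum_i z.2 0 i * Q i a z = 0.
  move=> Uz; under eq_bigr do rewrite mulrBr; rewrite sumrB radE//.
  under [X in _ - X]eq_bigr do rewrite mulr_sumr.
  rewrite exchange_big/= -sumrB big1// => d _; rewrite mulr_suml -sumrB big1// => j _.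
  by rewrite mulrA subrr.
have dcoord i z : differentiable (fun z : Z => z.2 0 i) z /\
    forall j, dw j (fun z : Z => z.2 0 i) z = (j == i)%:R.
  have Ll : linear (fun z : Z => z.2 0 i) by move=> a u v /=; rewrite !mxE.
  have Lc : continuous (fun z : Z => z.2 0 i).
    exact: (fcoord_continuous fZ (inr i)).
  split => [|j]; first exact: differentiable_linear.
  by rewrite /dw derive_linear//= mxE eqxx /= eq_sym.
have QQ j a z : U z -> Q j a z + \sum_i z.2 0 i * dw j (Q i a) z = 0.
  move=> Uz; have : dw j (fun z => \sum_i z.2 0 i * Q i a z) z = 0.
    rewrite -[RHS](@derive_cst _ _ _ (0 : R) z ((0, delta_mx 0 j) : Z)).
    apply: near_eq_derive; have := open_nbhs_nbhs (conj oU Uz).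
    by apply: filterS => y Uy; rewrite Qrad.
  rewrite {1}/dw derive_sum_fun; last first.
    by move=> i; apply: differentiableM; [exact: (dcoord i z).1|exact: dQ].
  under eq_bigr => i _.
    rewrite deriveM_fun; [|exact: (dcoord i z).1|exact: dQ].
    rewrite -/(dw j (fun z => z.2 0 i) z) (dcoord i z).2 -/(dw j (Q i a) z).
    over.
  rewrite big_split/= (bigD1 j)//= eqxx mul1r big1 ?addr0// => i ij.
  by rewrite eq_sym (negbTE ij) mul0r.
have dwQ i j a z : U z -> dw i (Q j a) z = dw i (dw j (X a)) z -
    \sum_d (dw i (Om j a d) z * X d z + Om j a d z * dw i (X d) z).
  move=> Uz; rewrite /dw /Q deriveB_fun; last 2 first.
  - exact: (smooth_differentiable (smooth_der _ (sX a)) Uz).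
  - by apply: differentiable_sum_fun => d; apply: differentiableM; [exact: dOm|exact: dX].
  rewrite derive_sum_fun; last first.
    by move=> d; apply: differentiableM; [exact: dOm|exact: dX].
  by congr (_ - _); apply: eq_bigr => d _; rewrite deriveM_fun; [|exact: dOm|exact: dX].
have Qsym i j a z : U z -> dw j (Q i a) z - dw i (Q j a) z =
    \sum_d Om j a d z * Q i d z - \sum_d Om i a d z * Q j d z.
  move=> Uz; rewrite !dwQ//.
  have -> : dw j (dw i (X a)) z = dw i (dw j (X a)) z.
    exact: (derive_sym _ _ oU (sX a 2%N) Uz).
  have fl e : dw j (Om i a e) z - dw i (Om j a e) z =
      \sum_d (Om j a d z * Om i d e z - Om i a d z * Om j d e z).
    have := flat j i a e (UO Uz); rewrite -[in LHS](@subr0 _ (_ - _)) => h.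
    apply/eqP; rewrite -subr_eq0; apply/eqP; rewrite -[RHS]h; congr (_ + _); last first.
      by rewrite -sumrN; apply: eq_bigr => d _; rewrite opprB.
    by rewrite subr0.
  have F1 : \sum_e (dw j (Om i a e) z - dw i (Om j a e) z) * X e z =
      \sum_d Om j a d z * (\sum_e Om i d e z * X e z) -
      \sum_d Om i a d z * (\sum_e Om j d e z * X e z).
    under eq_bigr do rewrite fl mulr_suml.
    rewrite exchange_big/= -sumrB; apply: eq_bigr => d _.
    rewrite !mulr_sumr -sumrB; apply: eq_bigr => e _; ring.
  rewrite /Q; under [X in _ = X - _]eq_bigr do rewrite mulrBr.
  under [X in _ = _ - X]eq_bigr do rewrite mulrBr.
  rewrite !sumrB !big_split/=.
  have F0 : \sum_e (dw j (Om i a e) z - dw i (Om j a e) z) * X e z =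
      \sum_e dw j (Om i a e) z * X e z - \sum_e dw i (Om j a e) z * X e z.
    by rewrite -sumrB; apply: eq_bigr => e _; rewrite mulrBl.
  move: F1; rewrite F0.
  set a1 := \sum_e _; set a2 := \sum_e _; set a3 := \sum_d _; set a4 := \sum_d _.
  set a5 := \sum_d _; set a6 := \sum_d _.
  move: a1 a2 a3 a4 a5 a6 (dw i (dw j (X a)) z) => x1 x2 x3 x4 x5 x6 x7 h.
  lra.
have Qexch j a y : U y -> \sum_i y.2 0 i * dw j (Q i a) y =
    \sum_i y.2 0 i * dw i (Q j a) y -
    \sum_d (\sum_i y.2 0 i * Om i a d y) * Q j d y.
  move=> Uy.
    have -> : \sum_i y.2 0 i * dw j (Q i a) y =
      \sum_i (y.2 0 i * dw i (Q j a) y +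
        (\sum_d Om j a d y * (y.2 0 i * Q i d y)
         - \sum_d (y.2 0 i * Om i a d y) * Q j d y)).
      apply: eq_bigr => i _; have := Qsym i j a _ Uy => /eqP.
      rewrite subr_eq addrC => /eqP ->; rewrite mulrDr; congr (_ + _).
      by rewrite mulrBr !mulr_sumr; congr (_ - _); apply: eq_bigr => d _; ring.
    rewrite big_split/= sumrB; congr (_ + _).
    rewrite exchange_big/= big1 => [|d _]; last by rewrite -mulr_sumr Qrad ?mulr0.
    rewrite sub0r exchange_big/=; congr (- _); apply: eq_bigr => d _.
    by rewrite mulr_suml.
exists X; split => //.
move=> j a [p w] Uz.
suff /eqP : Q j a (p, w) = 0 by rewrite subr_eq0 => /eqP.
pose q a (t : R) := t * Q j a (leaf_sc t (p, w)).
pose M a d (t : R) := coef a d (t, (p, w)).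
have lin (s : R) : leaf_sc s (p, w) = (p, 0) + s *: ((0, w) : Z).
  by apply: injective_projections => /=; rewrite ?scaler0 ?addr0 ?add0r.
have dq a' (t : R) : 0 <= t <= 1 -> is_derive t (1 : R) (q a') (\sum_d M a' d t * q d t).
  move=> t01; have Ut : U (leaf_sc t (p, w)) by exact: stU.
  have d2 : is_derive t (1 : R) (fun s => Q j a' (leaf_sc s (p, w)))
      (\sum_i w 0 i * dw i (Q j a') (leaf_sc t (p, w))).
    rewrite -derive_dw; last exact: dQ.
    have -> : (fun s => Q j a' (leaf_sc s (p, w))) =
      (fun s => Q j a' ((p, 0) + s *: ((0, w) : Z))) by apply/funext => s; rewrite lin.
    by rewrite lin; apply: is_derive_line; rewrite -lin; exact: dQ.
  have d3 := is_deriveM (is_derive_id t (1 : R)) d2.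
  apply: is_derive_eq d3 _; rewrite /GRing.scale/= mulr1.
  have h1 := QQ j a' _ Ut.
  have h2 := Qexch j a' _ Ut.
  have -> : t * (\sum_i w 0 i * dw i (Q j a') (leaf_sc t (p, w))) =
    \sum_i (leaf_sc t (p, w)).2 0 i * dw i (Q j a') (leaf_sc t (p, w)).
    by rewrite mulr_sumr; apply: eq_bigr => i _; rewrite /leaf_sc/= mxE mulrA.
  have -> : \sum_d M a' d t * q d t =
    \sum_d (\sum_i (leaf_sc t (p, w)).2 0 i * Om i a' d (leaf_sc t (p, w))) * Q j d (leaf_sc t (p, w)).
    apply: eq_bigr => d _; rewrite /M /q /coef mulrA; congr (_ * _).
    rewrite mulr_suml; apply: eq_bigr => i _; rewrite /leaf_sc/= mxE; ring.
  by move: h1; rewrite h2; set x1 := Q _ _ _; set x2 := \sum_i _; set x3 := \sum_d _;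
    move: x1 x2 x3 => x1 x2 x3; lra.
have : q a 1 = 0.
  apply: (@linear_ode_zero _ A q M 2^-1) => //.
  - move=> a' t t01; have [d _] := dq a' t t01.
    by apply: differentiable_continuous; apply/derivable1_diffP.
  - by move=> a' t /andP[t0 t1]; apply: dq; rewrite !ltW.
  - move=> a' d t /andP[t0 t1]; have t01 : 0 <= t <= 1 by rewrite !ltW.
    apply: le_trans (smallr a' t01 Uz); rewrite (bigD1 d)//= lerDl.
    exact: sumr_ge0.
  - by move=> a'; rewrite /q mul0r.
  - exact: one_in01.
by rewrite /q mul1r /leaf_sc/= scale1r.
Qed.

End Solve.
End TotalSystem.

(** * Smooth families of matrices *)

Section SmoothOn.
Context {R : realType} (V : normedModType R) (U : set V).
Hypothesis oU : open U.
Implicit Types (f g : V -> R).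

Lemma smooth_cst (W : normedModType R) (c : W) : smooth_on U (fun=> c : W).
Proof. by move=> k; exact: Ck_cst. Qed.

Lemma smoothD (W : normedModType R) (f g : V -> W) :
  smooth_on U f -> smooth_on U g -> smooth_on U (fun z => f z + g z).
Proof. by move=> sf sg k; exact: CkD. Qed.

Lemma smoothB (W : normedModType R) (f g : V -> W) :
  smooth_on U f -> smooth_on U g -> smooth_on U (fun z => f z - g z).
Proof. by move=> sf sg k; exact: CkB. Qed.

Lemma smoothN (W : normedModType R) (f : V -> W) :
  smooth_on U f -> smooth_on U (fun z => - f z).
Proof. by move=> sf k; exact: CkN. Qed.

Lemma smoothM f g : smooth_on U f -> smooth_on U g -> smooth_on U (fun z => f z * g z).
Proof. by move=> sf sg k; exact: CkM. Qed.

Lemma smooth_sum (I : Type) (r : seq I) (P : pred I) (f : I -> V -> R) :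
  (forall i, P i -> smooth_on U (f i)) -> smooth_on U (fun z => \sum_(i <- r | P i) f i z).
Proof. by move=> sf k; apply: Ck_sum => // i Pi; exact: sf. Qed.

Lemma smooth_prod (I : Type) (r : seq I) (P : pred I) (f : I -> V -> R) :
  (forall i, P i -> smooth_on U (f i)) -> smooth_on U (fun z => \prod_(i <- r | P i) f i z).
Proof. by move=> sf k; apply: Ck_prod => // i Pi; exact: sf. Qed.

Lemma smoothV f : (forall z, U z -> f z != 0) -> smooth_on U f ->
  smooth_on U (fun z => (f z)^-1).
Proof. by move=> f0 sf k; exact: CkV. Qed.

Lemma smooth_powR f p : (forall z, U z -> 0 < f z) -> smooth_on U f -> smooth_on U p ->
  smooth_on U (fun z => f z `^ p z).
Proof. by move=> f0 sf sp k; exact: Ck_powR. Qed.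

Lemma eq_smooth (W : normedModType R) (f g : V -> W) :
  (forall z, U z -> f z = g z) -> smooth_on U f -> smooth_on U g.
Proof. by move=> fg sf k; apply: eq_Ck (sf k). Qed.

Lemma smooth_subset (W : normedModType R) (U' : set V) (f : V -> W) :
  U' `<=` U -> smooth_on U f -> smooth_on U' f.
Proof. by move=> s sf k; apply: Ck_subset (sf k). Qed.

Lemma smooth_comp (V' : normedModType R) (U' : set V') (fV' : frame V') (f : V' -> R)
    (g : V -> V') : smooth_on U g -> smooth_on U' f ->
  (forall z, U z -> U' (g z)) -> smooth_on U (fun z => f (g z)).
Proof. by move=> sg sf gU k; exact: (Ck_comp fV' oU (sg k) (sf k) gU). Qed.

Lemma smooth_on_row n (f : V -> 'rV[R]_n) :
  (forall i, smooth_on U (fun z => f z 0 i)) -> smooth_on U f.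
Proof. by move=> sf k; apply: smooth_row => // i; exact: sf. Qed.

Lemma smooth_row_coord n (f : V -> 'rV[R]_n) i :
  smooth_on U f -> smooth_on U (fun z => f z 0 i).
Proof. by move=> sf k; exact: (Ck_coord (fV := row_frame (R := R) n) i oU (sf k)). Qed.

Lemma smooth_pair (W W' : normedModType R) (f : V -> W) (g : V -> W') :
  smooth_on U f -> smooth_on U g -> smooth_on U (fun z => (f z, g z)).
Proof. by move=> sf sg k; exact: Ck_pair. Qed.

Definition smooth_mx m n (G : V -> 'M[R]_(m, n)) :=
  forall i j, smooth_on U (fun z => G z i j).

Lemma smooth_det n (G : V -> 'M[R]_n) : smooth_mx G -> smooth_on U (fun z => \det (G z)).
Proof.
move=> sG; rewrite /determinant; apply: smooth_sum => s _; apply: smoothM.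
  exact: smooth_cst.
by apply: smooth_prod => i _; exact: sG.
Qed.

Lemma smooth_invmx n (G : V -> 'M[R]_n) : (forall z, U z -> G z \in unitmx) ->
  smooth_mx G -> smooth_mx (fun z => invmx (G z)).
Proof.
move=> uG sG i j.
apply: (@eq_smooth _ (fun z => (\det (G z))^-1 *
   ((-1) ^+ (j + i) * \det (row' j (col' i (G z)))))).
  by move=> z Uz; rewrite /invmx uG// !mxE.
apply: smoothM.
  apply: smoothV; last exact: smooth_det.
  by move=> z /uG; rewrite unitmxE unitfE.
apply: smoothM; first exact: smooth_cst.
apply: smooth_det => k l; apply: (@eq_smooth _ (fun z => G z (lift j k) (lift i l))).
  by move=> z _; rewrite !mxE.
exact: sG.
Qed.

End SmoothOn.

Section Bilinear.
Context {R : realType} (n : nat).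
Implicit Types (B : 'M[R]_n) (u v w : 'rV[R]_n).

Lemma bilinE B v w : bilin B v w = \sum_i \sum_j v 0 i * B i j * w 0 j.
Proof.
rewrite /bilin mxE exchange_big/=; apply: eq_bigr => j _.
by rewrite !mxE mulr_suml; apply: eq_bigr => i _.
Qed.

Lemma bilinDl B u v w : bilin B (u + v) w = bilin B u w + bilin B v w.
Proof. by rewrite /bilin !mulmxDl mxE. Qed.

Lemma bilinZl B a v w : bilin B (a *: v) w = a * bilin B v w.
Proof. by rewrite /bilin -!scalemxAl mxE. Qed.

Lemma bilinDr B u v w : bilin B w (u + v) = bilin B w u + bilin B w v.
Proof. by rewrite /bilin linearD mulmxDr mxE. Qed.

Lemma bilinZr B a v w : bilin B v (a *: w) = a * bilin B v w.
Proof. by rewrite /bilin linearZ/= -scalemxAr mxE. Qed.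

Lemma bilin_scale B a v w : bilin (a *: B) v w = a * bilin B v w.
Proof. by rewrite /bilin -scalemxAr -scalemxAl mxE. Qed.

Lemma bilin0l B w : bilin B 0 w = 0.
Proof. by rewrite /bilin !mul0mx mxE. Qed.

Lemma bilin_suml B (I : finType) (f : I -> 'rV[R]_n) w :
  bilin B (\sum_i f i) w = \sum_i bilin B (f i) w.
Proof. by rewrite /bilin !mulmx_suml summxE. Qed.

Lemma bilin_sumr B (I : finType) (f : I -> 'rV[R]_n) w :
  bilin B w (\sum_i f i) = \sum_i bilin B w (f i).
Proof. by rewrite /bilin linear_sum/= mulmx_sumr summxE. Qed.

Lemma bilin_sym B v w : B^T = B -> bilin B v w = bilin B w v.
Proof.
move=> sB; rewrite /bilin.
have -> : v *m B *m w^T = (w *m B *m v^T)^T by rewrite !trmx_mul trmxK sB mulmxA.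
by rewrite mxE.
Qed.

Lemma posdef_unit B : posdef B -> B \in unitmx.
Proof.
move=> [_ pB]; rewrite unitmxE unitfE; apply/negP => /det0P[v v0 vB].
by have := pB v v0; rewrite /bilin vB mul0mx mxE ltxx.
Qed.

Lemma posdef_ge0 B v : posdef B -> 0 <= bilin B v v.
Proof.
move=> [_ pB]; have [->|v0] := eqVneq v 0; first by rewrite bilin0l.
exact/ltW/pB.
Qed.

End Bilinear.

Lemma smooth_bilin (R : realType) (V : normedModType R) (U : set V) n
    (B : V -> 'M[R]_n) (v w : V -> 'rV[R]_n) : open U -> smooth_mx U B ->
  smooth_mx U v -> smooth_mx U w -> smooth_on U (fun z => bilin (B z) (v z) (w z)).
Proof.
move=> oU sB sv sw.
apply: (@eq_smooth _ _ _ oU _ (fun z => \sum_i \sum_j v z 0 i * B z i j * w z 0 j)).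
  by move=> z _; rewrite bilinE.
apply: smooth_sum => // i _; apply: smooth_sum => // j _.
by do 2![apply: smoothM => //].
Qed.

(** Cholesky's factorization by induction on the size: the first pivot is
    positive, so that its square root depends smoothly on the parameter, and
    the Schur complement of the pivot is again positive definite. *)
Lemma smooth_cholesky (R : realType) (V : normedModType R) (U : set V) n
    (G : V -> 'M[R]_n) : open U -> smooth_mx U G -> (forall z, U z -> posdef (G z)) ->
  exists L : V -> 'M[R]_n, smooth_mx U L /\ forall z, U z -> (L z)^T *m L z = G z.
Proof.
move=> oU; elim: n G => [|n IH] G sG pG.
  by exists (fun=> 0); split; [case|move=> z _; apply/matrixP; case].
pose G' z : 'M[R]_(1 + n) := G z.
pose a z := G z 0 0.
pose b z : 'rV[R]_n := ursubmx (G' z).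
pose D z : 'M[R]_n := drsubmx (G' z).
pose S z := D z - (a z)^-1 *: ((b z)^T *m b z).
have GE z : U z -> G' z = block_mx (a z)%:M (b z) (b z)^T (D z).
  move=> Uz; rewrite -[LHS]submxK; congr block_mx.
    rewrite [LHS]mx11_scalar; congr (_%:M); rewrite !mxE; congr (G z _ _); exact/val_inj.
  have [sym _] := pG z Uz; rewrite /b trmx_ursub.
  by congr (dlsubmx _); rewrite /G' sym.
have a0 z : U z -> 0 < a z.
  move=> Uz; have [_ /(_ (delta_mx 0 0))] := pG z Uz.
  rewrite bilinE (bigD1 0)//= (bigD1 0)//= !mxE !eqxx/= mul1r mulr1.
  rewrite [X in _ + X + _]big1 => [|j j0]; last by rewrite !mxE (negbTE j0) andbF mulr0.
  rewrite [X in _ + X]big1 ?addr0 => [|i i0]; last first.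
    by rewrite big1// => j _; rewrite !mxE (negbTE i0) andbF !mul0r.
  by apply; apply/eqP => /matrixP/(_ 0 0); rewrite !mxE !eqxx => /eqP; rewrite oner_eq0.
have sa : smooth_on U a by exact: sG.
have sb : smooth_mx U b.
  move=> i j; apply: (@eq_smooth _ _ _ oU _ (fun z => G z (lshift n i) (rshift 1 j))).
    by move=> z _; rewrite !mxE.
  exact: sG.
have sS : smooth_mx U S.
  move=> i j; apply: (@eq_smooth _ _ _ oU _ (fun z => G z (rshift 1 i) (rshift 1 j) -
      (a z)^-1 * (b z 0 i * b z 0 j))).
    by move=> z _; rewrite !mxE big_ord1 !mxE.
  apply: (smoothB oU); first exact: sG.
  apply: (smoothM oU); first by apply: (smoothV oU) => // z /a0 /lt0r_neq0.
  by apply: (smoothM oU); exact: sb.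
have pS z : U z -> posdef (S z).
  move=> Uz; have [sym pos] := pG z Uz.
  have symD : (D z)^T = D z by rewrite /D trmx_drsub; congr drsubmx.
  split.
    rewrite /S linearB/= linearZ/= trmx_mul trmxK symD.
    by [].
  move=> v v0; pose x : 'M[R]_1 := - ((a z)^-1 *: (v *m (b z)^T)).
  have := pos (row_mx x v).
  have xv0 : row_mx x v != 0 :> 'rV_(1 + n).
    apply: contra v0 => /eqP xv; have := congr1 rsubmx xv.
    by rewrite row_mxKr => ->; apply/eqP/matrixP => i j; rewrite !mxE.
  move=> /(_ xv0); congr (0 < _); rewrite /bilin -[G z]/(G' z) GE//.
  transitivity ((row_mx (x *m (a z)%:M + v *m (b z)^T) (x *m b z + v *m D z)
    *m (row_mx x v)^T) 0 0); first by rewrite -mul_row_block.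
  rewrite tr_row_mx mul_row_col.
  have -> : x *m (a z)%:M + v *m (b z)^T = 0.
    rewrite mul_mx_scalar /x scalerN scalerA divff ?gt_eqF ?a0// scale1r.
    by rewrite addNr.
  rewrite mul0mx add0r /S mulmxBr; congr ((_ *m _) 0 0).
  rewrite addrC; congr (_ + _).
  by rewrite /x mulNmx -scalemxAl -scalemxAr mulmxA.
have [L' [sL' L'E]] := IH S sS pS.
pose s z := a z `^ 2^-1.
have ss : smooth_on U s by apply: smooth_powR => //; exact: smooth_cst.
have s0 z : U z -> s z != 0 by move=> Uz; rewrite gt_eqF// powR_gt0// a0.
have s2 z : U z -> s z * s z = a z.
  move=> Uz; rewrite /s -powRD; last by rewrite gt_eqF ?a0// implybT.
  have -> : 2^-1 + 2^-1 = 1 :> R by lra.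
  by rewrite powRr1// ltW// a0.
pose L z : 'M[R]_(1 + n) := block_mx (s z)%:M ((s z)^-1 *: b z) 0 (L' z).
have sL (i j : 'I_(1 + n)) : smooth_on U (fun z => L z i j).
  case: (@split_ordP 1 n i) => i' ->; case: (@split_ordP 1 n j) => j' ->.
  - apply: (@eq_smooth _ _ _ oU _ s) => // z _.
    by rewrite /L block_mxEul mxE !ord1.
  - apply: (@eq_smooth _ _ _ oU _ (fun z => (s z)^-1 * b z 0 j')) => [z _|].
      by rewrite /L block_mxEur (ord1 i') [RHS]mxE.
    by apply: (smoothM oU); [exact: smoothV|exact: sb].
  - apply: (@eq_smooth _ _ _ oU _ (fun=> 0)) => [z _|]; last exact: smooth_cst.
    by rewrite /L block_mxEdl mxE.
  - apply: (@eq_smooth _ _ _ oU _ (fun z => L' z i' j')) => [z _|]; last exact: sL'.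
    by rewrite /L block_mxEdr.
suff LE z : U z -> (L z)^T *m L z = G' z by exists L; split; [exact: sL|exact: LE].
move=> Uz; rewrite GE// /L tr_block_mx.
rewrite mulmx_block !trmx0 !mulmx0 !mul0mx !addr0 tr_scalar_mx; congr block_mx.
- by rewrite -scalar_mxM s2.
- by rewrite mul_scalar_mx scalerA divff ?s0// scale1r.
- by rewrite mul_mx_scalar linearZ/= scalerA divff ?s0// scale1r.
- have -> : ((s z)^-1 *: b z)^T = (s z)^-1 *: (b z)^T by apply/matrixP => i j; rewrite !mxE.
  rewrite L'E// /S -scalemxAl -scalemxAr scalerA -invfM s2//.
  by rewrite addrC subrK.
Qed.

Section Jacobi.
Context {R : realType} (V : normedModType R).

Lemma derive_prod_seq (I : eqType) (r : seq I) (f : I -> V -> R) (z v : V) : uniq r ->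
  (forall i, differentiable (f i) z) ->
  differentiable (fun z => \prod_(i <- r) f i z) z /\
  'D_v (fun z => \prod_(i <- r) f i z) z =
    \sum_(i <- r) \prod_(j <- r) (if j == i then 'D_v (f i) z else f j z).
Proof.
move=> ur df; elim: r ur => [_|i r IH /andP[ir /IH[d1 d2]]].
  have -> : (fun z => \prod_(i <- [::]) f i z) = cst 1.
    by apply/funext => y; rewrite big_nil.
  by rewrite big_nil derive_cst; split => //; exact: differentiable_cst.
have -> : (fun z => \prod_(j <- i :: r) f j z) = (fun z => f i z * \prod_(j <- r) f j z).
  by apply/funext => y; rewrite big_cons.
split; first exact: differentiableM.
rewrite deriveM_fun// d2 !big_cons eqxx; congr (_ * _ + _).
  by apply: eq_big_seq => j jr; case: eqP => // ji; rewrite -ji jr in ir.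
rewrite mulr_sumr; apply: eq_big_seq => j jr; rewrite big_cons.
by case: eqP => // ij; rewrite ij jr in ir.
Qed.

(** Jacobi's formula for the derivative of a determinant. *)
Lemma derive_det n (G : V -> 'M[R]_n) (z v : V) :
  (forall i j, differentiable (fun z => G z i j) z) ->
  'D_v (fun z => \det (G z)) z =
  \sum_i \sum_j 'D_v (fun z => G z i j) z * cofactor (G z) i j.
Proof.
move=> dG; pose r := index_enum 'I_n.
have ur : uniq r by exact: index_enum_uniq.
have dp (s : {perm 'I_n}) := derive_prod_seq v ur (fun i => dG i (s i)).
rewrite /determinant derive_sum_fun; last first.
  by move=> s; apply: differentiableM; [exact: differentiable_cst|have [] := dp s].
transitivity (\sum_i \det (\matrix_(k, l) if k == i then 'D_v (fun z => G z i l) z else G z k l)).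
  rewrite /determinant exchange_big/=; apply: eq_bigr => s _.
  rewrite deriveZ_fun; last by have [] := dp s.
  have [_ ->] := dp s; rewrite mulr_sumr; apply: eq_bigr => i _; congr (_ * _).
  by apply: eq_bigr => k _; rewrite mxE; case: eqP => // ->.
apply: eq_bigr => i _; rewrite (expand_det_row _ i); apply: eq_bigr => j _.
rewrite mxE eqxx; congr (_ * _); rewrite /cofactor; congr (_ * \det _).
by apply/matrixP => k l; rewrite !mxE eq_sym (negbTE (neq_lift _ _)).
Qed.

End Jacobi.

(** * Riemannian metrics and the equation of spheres *)

Section Riemannian.
Context {R : realType} (n : nat).
Local Notation W := 'rV[R]_n.
Implicit Types (G : W -> 'M[R]_n) (V : set W).

Lemma near_partial_der V (f g : W -> R) w i : open V -> V w ->
  (forall z, V z -> f z = g z) -> partial_der i f w = partial_der i g w.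
Proof.
move=> oV Vw fg; apply: near_eq_derive.
by apply: filterS (open_nbhs_nbhs (conj oV Vw)) => z; exact: fg.
Qed.

(** Christoffel symbols of the first kind. *)
Definition christoffel1 G (l i j : 'I_n) (w : W) : R :=
  2^-1 * (partial_der i (fun z => G z j l) w + partial_der j (fun z => G z i l) w
          - partial_der l (fun z => G z i j) w).

Lemma christoffelE G k i j w :
  christoffel G k i j w = \sum_l invmx (G w) k l * christoffel1 G l i j w.
Proof.
rewrite /christoffel mulr_sumr; apply: eq_bigr => l _.
by rewrite /christoffel1 mulrCA.
Qed.

Section Metric.
Variables (V : set W) (G : W -> 'M[R]_n).
Hypotheses (oV : open V) (sG : smooth_mx V G).
Hypothesis symG : forall w, V w -> (G w)^T = G w.
Hypothesis unitG : forall w, V w -> G w \in unitmx.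

Lemma metric_entry_sym w i j : V w -> G w i j = G w j i.
Proof. by move=> Vw; rewrite -[in RHS](symG Vw) mxE. Qed.

Lemma partial_metric_sym w k i j : V w ->
  partial_der k (fun z => G z i j) w = partial_der k (fun z => G z j i) w.
Proof. by move=> Vw; apply: (near_partial_der _ oV Vw) => z; exact: metric_entry_sym. Qed.

Lemma christoffel1_sym w l i j : V w -> christoffel1 G l i j w = christoffel1 G l j i w.
Proof.
move=> Vw; rewrite /christoffel1 (partial_metric_sym l i j Vw); congr (_ * (_ - _)).
exact: addrC.
Qed.

Lemma christoffel_sym w k i j : V w -> christoffel G k i j w = christoffel G k j i w.
Proof.
by move=> Vw; rewrite !christoffelE; apply: eq_bigr => l _; rewrite (christoffel1_sym l i j Vw).
Qed.

Lemma sum_metric_inv w l k : V w -> \sum_m G w l m * invmx (G w) m k = (l == k)%:R.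
Proof.
move=> Vw; have := congr1 (fun M : 'M[R]_n => M l k) (mulmxV (unitG Vw)).
by rewrite !mxE.
Qed.

Lemma sum_metric_christoffel w l i j : V w ->
  \sum_k G w l k * christoffel G k i j w = christoffel1 G l i j w.
Proof.
move=> Vw; under eq_bigr do rewrite christoffelE mulr_sumr.
rewrite exchange_big/= (bigD1 l)//= [X in _ + X]big1 ?addr0 => [|m ml].
  under eq_bigr do rewrite mulrA.
  by rewrite -mulr_suml sum_metric_inv// eqxx mul1r.
under eq_bigr do rewrite mulrA.
by rewrite -mulr_suml sum_metric_inv// eq_sym (negbTE ml) mul0r.
Qed.

(** The Levi-Civita connection is metric. *)
Lemma partial_metric w k i j : V w ->
  partial_der k (fun z => G z i j) w = christoffel1 G i k j w + christoffel1 G j k i w.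
Proof.
move=> Vw; rewrite /christoffel1 (partial_metric_sym k j i Vw) (partial_metric_sym j k i Vw).
by rewrite (partial_metric_sym i k j Vw); lra.
Qed.

Lemma smooth_partial (f : W -> R) i : smooth_on V f -> smooth_on V (partial_der i f).
Proof. exact: smooth_der. Qed.

Lemma smooth_christoffel1 l i j : smooth_on V (christoffel1 G l i j).
Proof.
apply: (smoothM oV); first exact: smooth_cst.
by apply: (smoothB oV); [apply: (smoothD oV)|]; apply: smooth_partial; exact: sG.
Qed.

Lemma smooth_christoffel k i j : smooth_on V (christoffel G k i j).
Proof.
have -> : christoffel G k i j = (fun w => \sum_l invmx (G w) k l * christoffel1 G l i j w).
  by apply/funext => w; exact: christoffelE.
apply: (smooth_sum oV) => l _; apply: (smoothM oV); last exact: smooth_christoffel1.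
exact: smooth_invmx.
Qed.

Lemma metric_differentiable w i j : V w -> differentiable (fun z => G z i j) w.
Proof. by move=> Vw; exact: smooth_differentiable (sG i j) Vw. Qed.

Lemma christoffel_differentiable w k i j : V w -> differentiable (christoffel G k i j) w.
Proof. by move=> Vw; exact: smooth_differentiable (smooth_christoffel k i j) Vw. Qed.

(** Lowering the index replaces the derivatives of the inverse metric by
    products of Christoffel symbols, through [partial_metric]. *)
Lemma riemann_lower w l k i j : V w ->
  \sum_m G w l m * riemann G m k i j w =
  partial_der i (christoffel1 G l j k) w - partial_der j (christoffel1 G l i k) w
  - \sum_m (christoffel1 G m i l w * christoffel G m j k w
            - christoffel1 G m j l w * christoffel G m i k w).
Proof.
move=> Vw.
have E i' j' : \sum_m G w l m * partial_der i' (christoffel G m j' k) w =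
    partial_der i' (christoffel1 G l j' k) w -
    \sum_m (christoffel1 G l i' m w + christoffel1 G m i' l w) * christoffel G m j' k w.
  have -> : partial_der i' (christoffel1 G l j' k) w =
    partial_der i' (fun z => \sum_m G z l m * christoffel G m j' k z) w.
    by apply: (near_partial_der _ oV Vw) => z Vz; rewrite sum_metric_christoffel.
  rewrite /partial_der derive_sum_fun; last first.
    by move=> m; apply: differentiableM; [exact: metric_differentiable|exact: christoffel_differentiable].
  rewrite -sumrB; apply: eq_bigr => m _.
  rewrite deriveM_fun; [|exact: metric_differentiable|exact: christoffel_differentiable].
  rewrite -/(partial_der i' (fun z => G z l m) w) partial_metric//.
  by rewrite addrC addKr.
have F i' j' : \sum_m G w l m * (\sum_p christoffel G m i' p w * christoffel G p j' k w) =
    \sum_p christoffel1 G l i' p w * christoffel G p j' k w.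
  under eq_bigr do rewrite mulr_sumr.
  rewrite exchange_big/=; apply: eq_bigr => p _.
  under eq_bigr do rewrite mulrA.
  by rewrite -mulr_suml sum_metric_christoffel.
have S i' j' : \sum_m (christoffel1 G l i' m w + christoffel1 G m i' l w) * christoffel G m j' k w =
    \sum_p christoffel1 G l i' p w * christoffel G p j' k w +
    \sum_m christoffel1 G m i' l w * christoffel G m j' k w.
  by under eq_bigr do rewrite mulrDl; rewrite big_split.
have -> : \sum_m G w l m * riemann G m k i j w =
    \sum_m G w l m * partial_der i (christoffel G m j k) w -
    \sum_m G w l m * partial_der j (christoffel G m i k) w +
    (\sum_m G w l m * (\sum_p christoffel G m i p w * christoffel G p j k w) -
     \sum_m G w l m * (\sum_p christoffel G m j p w * christoffel G p i k w)).
  rewrite -!sumrB -big_split/=; apply: eq_bigr => m _.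
  by rewrite /riemann sumrB -!mulrBr -mulrDr.
have comb (a1 a2 b1 b2 p1 p2 s1 s2 q1 q2 r1 r2 t : R) : a1 = p1 - s1 -> a2 = p2 - s2 ->
    b1 = q1 -> b2 = q2 -> s1 = q1 + r1 -> s2 = q2 + r2 -> t = r1 - r2 ->
    a1 - a2 + (b1 - b2) = p1 - p2 - t by lra.
apply: (comb _ _ _ _ _ _ _ _ _ _ _ _ _ (E i j) (E j i) (F i j) (F j i) (S i j) (S j i)).
exact: sumrB.
Qed.

End Metric.

(** The matrix of the linear system for a function and its partial derivatives that expresses [Hess u = - C u G], the equation of the linear
    coordinates of R^(n+1) restricted to a sphere of curvature C. *)
Definition sphere_system (G : W -> 'M[R]_n) (C : R) (j : 'I_n) (a d : 'I_n.+1) (w : W) : R :=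
  match unlift ord0 a, unlift ord0 d with
  | None, None => 0
  | None, Some k => (k == j)%:R
  | Some i, None => - C * G w i j
  | Some i, Some k => christoffel G k i j w
  end.

Lemma sphere_system00 G C j : sphere_system G C j ord0 ord0 = fun=> 0.
Proof. by apply/funext => w; rewrite /sphere_system unlift_none. Qed.

Lemma sphere_system0l G C j k : sphere_system G C j ord0 (lift ord0 k) = fun=> (k == j)%:R.
Proof. by apply/funext => w; rewrite /sphere_system unlift_none liftK. Qed.

Lemma sphere_systeml0 G C j i : sphere_system G C j (lift ord0 i) ord0 = fun w => - C * G w i j.
Proof. by apply/funext => w; rewrite /sphere_system unlift_none liftK. Qed.

Lemma sphere_systemll G C j i k :
  sphere_system G C j (lift ord0 i) (lift ord0 k) = christoffel G k i j.
Proof. by apply/funext => w; rewrite /sphere_system !liftK. Qed.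

Definition sphere_systemE := (sphere_system00, sphere_system0l, sphere_systeml0, sphere_systemll).

(** Constant curvature with the first index raised. *)
Lemma const_curvature_riemann (V : set W) G C w m i k j : V w -> G w \in unitmx ->
  const_curvature V G C ->
  riemann G m i k j w = C * ((m == k)%:R * G w i j - (m == j)%:R * G w i k).
Proof.
move=> Vw uG cc.
have inv l p : \sum_m invmx (G w) l m * G w m p = (l == p)%:R.
  by have := congr1 (fun M : 'M[R]_n => M l p) (mulVmx uG); rewrite !mxE.
transitivity (\sum_l invmx (G w) m l * \sum_m G w l m * riemann G m i k j w).
  under [RHS]eq_bigr do rewrite mulr_sumr.
  rewrite [RHS]exchange_big/= (bigD1 m)//= [X in _ = _ + X]big1 ?addr0.
    under [RHS]eq_bigr do rewrite mulrA.
    by rewrite -mulr_suml inv eqxx mul1r.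
  move=> p pm; under eq_bigr do rewrite mulrA.
  by rewrite -mulr_suml inv eq_sym (negbTE pm) mul0r.
transitivity (\sum_l (C * G w i j * (invmx (G w) m l * G w l k) -
    C * G w i k * (invmx (G w) m l * G w l j))).
  apply: eq_bigr => l _; rewrite (cc _ Vw); ring.
by rewrite sumrB -!mulr_sumr !inv; ring.
Qed.

(** The sphere system is completely integrable exactly because the curvature is [C]. *)
Lemma sphere_system_flat (V : set W) G C : open V -> smooth_mx V G ->
  (forall w, V w -> (G w)^T = G w) -> (forall w, V w -> G w \in unitmx) ->
  const_curvature V G C -> forall i j a e w, V w ->
  partial_der i (sphere_system G C j a e) w - partial_der j (sphere_system G C i a e) w +
  \sum_d (sphere_system G C j a d w * sphere_system G C i d e w -
          sphere_system G C i a d w * sphere_system G C j d e w) = 0.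
Proof.
move=> oV sG symG unitG cc k j a e w Vw.
have csym := fun p i q => @christoffel_sym V G oV symG w p i q Vw.
have dG i q : differentiable (fun z => G z i q) w by exact: (metric_differentiable sG).
have cst0 (c : R) i : partial_der i (fun=> c) w = 0 by exact: derive_cst.
have pG i q r : partial_der i (fun z => - C * G z q r) w =
    - C * partial_der i (fun z => G z q r) w by exact: deriveZ_fun.
have deltaS (f : 'I_n -> R) q : \sum_(d < n) (d == q)%:R * f d = f q.
  by rewrite (bigD1 q)//= eqxx mul1r big1 ?addr0// => p /negbTE ->; rewrite mul0r.
rewrite big_ord_recl.
case: (unliftP ord0 a) => [i ->|->]; case: (unliftP ord0 e) => [m ->|->].
- under eq_bigr do rewrite !sphere_systemll.
  rewrite !sphere_systemE.
  rewrite (near_partial_der (g := christoffel G m j i) k oV Vw); last first.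
    by move=> z Vz; exact: (christoffel_sym oV symG).
  rewrite (near_partial_der (f := christoffel G m i k) (g := christoffel G m k i) j oV Vw); last first.
    by move=> z Vz; exact: (christoffel_sym oV symG).
  have := const_curvature_riemann m i k j Vw (unitG w Vw) cc.
  rewrite /riemann.
  have -> : \sum_(d < n) (christoffel G d i j w * christoffel G m d k w -
      christoffel G d i k w * christoffel G m d j w) =
    \sum_p (christoffel G m k p w * christoffel G p j i w -
      christoffel G m j p w * christoffel G p k i w).
    apply: eq_bigr => p _; rewrite (csym p i j) (csym p i k) (csym m p k) (csym m p j).
    by move: (christoffel G p j i w) (christoffel G m k p w) => x1 x2; ring.
  move: (partial_der k _ w) (partial_der j _ w) (\sum_p _) => x1 x2 x3 h.
  by rewrite (_ : x3 = C * ((m == k)%:R * G w i j - (m == j)%:R * G w i k) - (x1 - x2)); [ring|lra].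
- under eq_bigr do rewrite !sphere_systemE.
  rewrite !sphere_systemE !pG.
  rewrite (@partial_metric V G oV symG w) // (@partial_metric V G oV symG w j) //.
  have -> : \sum_(d < n) (christoffel G d i j w * (- C * G w d k) -
      christoffel G d i k w * (- C * G w d j)) =
    - C * (\sum_d G w k d * christoffel G d i j w) +
    C * (\sum_d G w j d * christoffel G d i k w).
    rewrite !mulr_sumr -big_split/=; apply: eq_bigr => d _.
    rewrite (@metric_entry_sym V G symG w d k)// (@metric_entry_sym V G symG w d j)//.
    by move: (christoffel G d i j w) (christoffel G d i k w) => x1 x2; ring.
  rewrite !(@sum_metric_christoffel V G unitG w)//.
  rewrite (@christoffel1_sym V G oV symG w k i j)// (@christoffel1_sym V G oV symG w j i k)//.
  rewrite (@christoffel1_sym V G oV symG w i j k)//.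
  move: (christoffel1 G i k j w) (christoffel1 G j k i w) (christoffel1 G k j i w) => x1 x2 x3.
  by ring.
- under eq_bigr do rewrite !sphere_systemE.
  rewrite !sphere_systemE !cst0 sumrB !deltaS csym.
  by move: (christoffel G m k j w) => x; ring.
- under eq_bigr do rewrite !sphere_systemE.
  rewrite !sphere_systemE !cst0 sumrB.
  rewrite !(deltaS (fun d => - C * G w d _)) (@metric_entry_sym V G symG w j k)//.
  by ring.
Qed.

End Riemannian.

(** * Metrics of dual pairs and Gauss' equation *)

Section Locality.
Context {R : realType} (n : nat).
Local Notation W := 'rV[R]_n.

(** A constant factor does not change the Levi-Civita connection. *)
Lemma christoffel_scale (V : set W) (G G' : W -> 'M[R]_n) (c : R) k i j w : open V -> V w ->
  smooth_mx V G' -> G' w \in unitmx -> c != 0 -> (forall z, V z -> G z = c *: G' z) ->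
  christoffel G k i j w = christoffel G' k i j w.
Proof.
move=> oV Vw sG' uG' c0 GE.
have pE i' p q : partial_der i' (fun z => G z p q) w = c * partial_der i' (fun z => G' z p q) w.
  rewrite (near_partial_der (g := fun z => c * G' z p q) i' oV Vw); last first.
    by move=> z Vz; rewrite GE// mxE.
  by apply: deriveZ_fun; exact: smooth_differentiable (sG' p q) Vw.
rewrite /christoffel; congr (_ * _); apply: eq_bigr => l _.
have -> : invmx (G w) k l = c^-1 * invmx (G' w) k l.
  by rewrite GE// invmxZ ?unitmxZ ?unitfE// mxE.
rewrite !pE; move: (partial_der i _ w) (partial_der j _ w) (partial_der l _ w) (invmx _ k l).
by move=> x1 x2 x3 x4; rewrite -mulrDr -mulrBr mulrACA mulVf// mul1r.
Qed.

Lemma const_curvature_scale (V : set W) (G G' : W -> 'M[R]_n) (c C : R) : open V ->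
  smooth_mx V G' -> (forall w, V w -> G' w \in unitmx) -> c != 0 ->
  (forall z, V z -> G z = c *: G' z) -> const_curvature V G' C -> const_curvature V G (C / c).
Proof.
move=> oV sG' uG' c0 GE cc w Vw l k i j.
have chr p q r z : V z -> christoffel G p q r z = christoffel G' p q r z.
  by move=> Vz; exact: (christoffel_scale p q r oV Vz sG' (uG' z Vz) c0 GE).
have rE m : riemann G m k i j w = riemann G' m k i j w.
  rewrite /riemann (near_partial_der (g := christoffel G' m j k) i oV Vw); last exact: chr.
  rewrite (near_partial_der (f := christoffel G m i k) (g := christoffel G' m i k) j oV Vw);
    last exact: chr.
  by congr (_ + _); apply: eq_bigr => p _; rewrite !chr.
transitivity (c * \sum_m G' w l m * riemann G' m k i j w).
  by rewrite mulr_sumr; apply: eq_bigr => m _; rewrite rE GE// mxE mulrA.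
by rewrite (cc w Vw) GE// !mxE; field.
Qed.

Lemma const_curvature_local (V : set W) (G G' : W -> 'M[R]_n) (C : R) : open V ->
  smooth_mx V G' -> (forall w, V w -> G' w \in unitmx) ->
  (forall z, V z -> G z = G' z) -> const_curvature V G' C -> const_curvature V G C.
Proof.
move=> oV sG' uG' GE cc; rewrite -[C]divr1; apply: (const_curvature_scale oV sG' uG') cc.
  exact: oner_neq0.
by move=> z Vz; rewrite scale1r GE.
Qed.

End Locality.

(** [dual_a] and [dual_b] are the Christoffel symbols of the first kind of two
    connections, conjugate with respect to the metric of the pair; their mean
    is the Levi-Civita connection. *)
HB.lock Definition dual_a (R : realType) (n : nat) (f g : 'I_n.+1 -> 'rV[R]_n -> R)
  (l i j : 'I_n) (w : 'rV[R]_n) : R :=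
  \sum_a partial_der i (partial_der j (f a)) w * partial_der l (g a) w.

HB.lock Definition dual_b (R : realType) (n : nat) (f g : 'I_n.+1 -> 'rV[R]_n -> R)
  (l i j : 'I_n) (w : 'rV[R]_n) : R :=
  \sum_a partial_der l (f a) w * partial_der i (partial_der j (g a)) w.

(** The cubic form measures how far the pair is from its dual pair [(g, f)]. *)
HB.lock Definition dual_cubic (R : realType) (n : nat) (f g : 'I_n.+1 -> 'rV[R]_n -> R)
  (i j : 'I_n) (w : 'rV[R]_n) : 'rV[R]_n :=
  \row_l (2^-1 * (dual_b f g l i j w - dual_a f g l i j w)).

Section DualPair.
Context {R : realType} (n : nat).
Local Notation W := 'rV[R]_n.
Variables (V : set W) (f g : 'I_n.+1 -> W -> R).
Hypotheses (oV : open V) (sf : forall a, smooth_on V (f a)) (sg : forall a, smooth_on V (g a)).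

Definition dual_metric (w : W) : 'M[R]_n :=
  \matrix_(i, j) \sum_a partial_der i (f a) w * partial_der j (g a) w.
Local Notation G := dual_metric.

Hypothesis fg1 : forall w, V w -> \sum_a f a w * g a w = 1.
Hypothesis dfg0 : forall w i, V w -> \sum_a partial_der i (f a) w * g a w = 0.
Hypothesis symG : forall w, V w -> (G w)^T = G w.
Hypothesis unitG : forall w, V w -> G w \in unitmx.

Let dif (h : W -> R) w : smooth_on V h -> V w -> differentiable h w.
Proof. exact: smooth_differentiable. Qed.

Let sp (h : W -> R) i : smooth_on V h -> smooth_on V (partial_der i h).
Proof. exact: smooth_der. Qed.

Lemma partial_sym (h : W -> R) i j w : smooth_on V h -> V w ->
  partial_der i (partial_der j h) w = partial_der j (partial_der i h) w.
Proof. by move=> sh Vw; apply: (derive_sym _ _ oV (sh 2%N) Vw). Qed.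

Lemma partial_dot (u v : 'I_n.+1 -> W -> R) i w : V w ->
  (forall a, smooth_on V (u a)) -> (forall a, smooth_on V (v a)) ->
  partial_der i (fun z => \sum_a u a z * v a z) w =
  \sum_a partial_der i (u a) w * v a w + \sum_a u a w * partial_der i (v a) w.
Proof.
move=> Vw su sv; rewrite /partial_der derive_sum_fun => [|a]; last first.
  by apply: differentiableM; apply: dif Vw.
by rewrite -big_split/=; apply: eq_bigr => a _; apply: deriveM_fun; apply: dif Vw.
Qed.

Lemma dual_fdg w i : V w -> \sum_a f a w * partial_der i (g a) w = 0.
Proof.
move=> Vw; have := partial_dot i Vw sf sg.
rewrite (near_partial_der (g := fun=> 1) i oV Vw)// dfg0// add0r => <-.
exact: derive_cst.
Qed.

Lemma dual_ddfg w i j : V w -> \sum_a partial_der i (partial_der j (f a)) w * g a w = - G w j i.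
Proof.
move=> Vw; have := partial_dot i Vw (fun a => sp j (sf a)) sg.
rewrite (near_partial_der (g := fun=> 0) i oV Vw); last by move=> z Vz; rewrite dfg0.
rewrite [X in X = _]derive_cst mxE => /eqP; rewrite eq_sym addr_eq0 => /eqP ->.
by [].
Qed.

Lemma dual_fddg w i j : V w -> \sum_a f a w * partial_der i (partial_der j (g a)) w = - G w i j.
Proof.
move=> Vw; have := partial_dot i Vw sf (fun a => sp j (sg a)).
rewrite (near_partial_der (g := fun=> 0) i oV Vw); last by move=> z Vz; rewrite dual_fdg.
rewrite [X in X = _]derive_cst mxE addrC => /eqP; rewrite eq_sym addr_eq0 => /eqP ->.
by [].
Qed.

Local Notation fa := (dual_a f g).
Local Notation fb := (dual_b f g).
Local Notation cubic := (dual_cubic f g).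

Lemma cubicE i j l w : cubic i j w 0 l = 2^-1 * (fb l i j w - fa l i j w).
Proof. by rewrite dual_cubic.unlock mxE. Qed.

Lemma dual_a_sym l i j w : V w -> fa l i j w = fa l j i w.
Proof. by move=> Vw; rewrite dual_a.unlock; apply: eq_bigr => a _; rewrite (partial_sym i j (sf a) Vw). Qed.

Lemma dual_b_sym l i j w : V w -> fb l i j w = fb l j i w.
Proof. by move=> Vw; rewrite dual_b.unlock; apply: eq_bigr => a _; rewrite (partial_sym i j (sg a) Vw). Qed.

Lemma smooth_dual_metric : smooth_mx V G.
Proof.
move=> i j; apply: (@eq_smooth _ _ _ oV _ (fun w => \sum_a partial_der i (f a) w * partial_der j (g a) w)).
  by move=> w _; rewrite mxE.
by apply: (smooth_sum oV) => a _; apply: (smoothM oV); apply: sp.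
Qed.

Lemma partial_dual_metric k i j w : V w ->
  partial_der k (fun z => G z i j) w = fa j k i w + fb i k j w.
Proof.
move=> Vw; rewrite dual_a.unlock dual_b.unlock -(partial_dot k Vw (fun a => sp i (sf a)) (fun a => sp j (sg a))).
by apply: (near_partial_der k oV Vw) => z _; rewrite mxE.
Qed.

Lemma cubic_sym i j w : V w -> cubic i j w = cubic j i w.
Proof.
by move=> Vw; apply/rowP => l; rewrite !cubicE (dual_a_sym l i j Vw) (dual_b_sym l i j Vw).
Qed.

(** The metric is symmetric, hence so are its derivatives. *)
Lemma cubic_rot i j l w : V w -> cubic i j w 0 l = cubic i l w 0 j.
Proof.
move=> Vw; have := partial_dual_metric i j l Vw.
rewrite (partial_metric_sym oV symG i j l Vw) (partial_dual_metric i l j Vw).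
rewrite !cubicE.
by move: (fa j i l w) (fb l i j w) (fa l i j w) (fb j i l w) => x1 x2 x3 x4; lra.
Qed.

Lemma dual_christoffel1 l i j w : V w ->
  christoffel1 G l i j w = fa l i j w + cubic i j w 0 l.
Proof.
move=> Vw; have := cubic_rot i j l Vw.
rewrite !cubicE /christoffel1 (partial_dual_metric i j l Vw) (partial_dual_metric j i l Vw).
rewrite (partial_dual_metric l i j Vw) (dual_a_sym l j i Vw) (dual_b_sym i j l Vw).
rewrite (dual_b_sym j i l Vw) (dual_a_sym j l i Vw).
move: (fa l i j w) (fb l i j w) (fa j i l w) (fb j i l w) (fb j l i w) (fb i l j w).
by move=> x1 x2 x3 x4 x5 x6; lra.
Qed.

(** The frame [(f, d f)] and the coframe [(g, d g)] resolve the identity. *)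
Lemma dual_completeness w (u v : 'I_n.+1 -> R) : V w ->
  \sum_a u a * v a = (\sum_a u a * g a w) * (\sum_a f a w * v a) +
  bilin (invmx (G w)) (\row_p \sum_a u a * partial_der p (g a) w)
                      (\row_p \sum_a partial_der p (f a) w * v a).
Proof.
move=> Vw.
pose P : 'M[R]_(1 + n, n.+1) := col_mx (\row_a f a w) (\matrix_(i, a) partial_der i (f a) w).
pose Q : 'M[R]_(1 + n, n.+1) := col_mx (\row_a g a w) (\matrix_(i, a) partial_der i (g a) w).
have PQ : P *m Q^T = block_mx 1%:M 0 0 (G w).
  rewrite tr_col_mx mul_col_row; congr block_mx.
  - apply/matrixP => i j; rewrite !ord1 !mxE eqxx -(fg1 Vw).
    by apply: eq_bigr => a _; rewrite !mxE.
  - apply/matrixP => i j; rewrite !mxE -[RHS](dual_fdg j Vw).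
    by apply: eq_bigr => a _; rewrite !mxE.
  - apply/matrixP => i j; rewrite !mxE -[RHS](dfg0 i Vw).
    by apply: eq_bigr => a _; rewrite !mxE.
  - by apply/matrixP => i j; rewrite !mxE; apply: eq_bigr => a _; rewrite !mxE.
pose J : 'M[R]_(1 + n) := block_mx 1%:M 0 0 (invmx (G w)).
have PJ : P *m (Q^T *m J) = 1%:M.
  by rewrite mulmxA PQ mulmx_block !mulmx0 !mul0mx !add0r !addr0 mulmx1 mulmxV ?unitG// -scalar_mx_block.
have QP : Q^T *m J *m P = 1%:M by exact: (mulmx1C PJ).
pose U : 'rV[R]_n.+1 := \row_a u a; pose X : 'cV[R]_n.+1 := \col_a v a.
have -> : \sum_a u a * v a = (U *m X) 0 0.
  by rewrite mxE; apply: eq_bigr => a _; rewrite !mxE.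
have -> : U *m X = (U *m Q^T) *m J *m (P *m X).
  by rewrite !mulmxA -(mulmxA U) -(mulmxA U) QP mulmx1.
rewrite tr_col_mx mul_mx_row mul_col_mx mul_row_block mul_row_col !mulmx0 addr0 add0r mulmx1.
rewrite mxE; congr (_ + _).
  rewrite mxE big_ord1 !mxE; congr (_ * _); apply: eq_bigr => a _; by rewrite !mxE.
rewrite /bilin; congr ((_ *m _ *m _) 0 0).
  by apply/rowP => p; rewrite !mxE; apply: eq_bigr => a _; rewrite !mxE.
by apply/colP => p; rewrite !mxE; apply: eq_bigr => a _; rewrite !mxE.
Qed.

(** Gauss' equation of the centroaffine immersion [f] with conormal [g]: in the
    derivatives of the Christoffel symbols the third derivatives of [f] and [g]
    cancel, and the products of second derivatives are resolved by
    [dual_completeness]. *)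
Lemma dual_curvature w l k i j : V w ->
  \sum_m G w l m * riemann G m k i j w =
  (G w l i * G w k j - G w l j * G w k i)
  - bilin (invmx (G w)) (cubic i l w) (cubic j k w)
  + bilin (invmx (G w)) (cubic j l w) (cubic i k w).
Proof.
move=> Vw; rewrite (riemann_lower oV smooth_dual_metric symG unitG)//.
pose gam i j : 'rV[R]_n := \row_l christoffel1 G l i j w.
pose T := bilin (invmx (G w)).
have Tsym u v : T u v = T v u by apply: bilin_sym; rewrite trmx_inv symG.
have gT i' j' l' k' : \sum_m christoffel1 G m i' l' w * christoffel G m j' k' w =
    T (gam i' l') (gam j' k').
  rewrite /T bilinE; apply: eq_bigr => m _; rewrite christoffelE mulr_sumr.
  by apply: eq_bigr => q _; rewrite !mxE mulrA.
rewrite sumrB !gT.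
pose ra i j : 'rV[R]_n := \row_l fa l i j w.
pose rb i j : 'rV[R]_n := \row_l fb l i j w.
have raE i' j' : ra i' j' = gam i' j' + (-1) *: cubic i' j' w.
  apply/rowP => q; rewrite [LHS]mxE [RHS]mxE [X in _ = _ + X]mxE [X in _ = X + _]mxE.
  by rewrite dual_christoffel1//; move: (cubic _ _ _ _ _) => x; lra.
have rbE i' j' : rb i' j' = gam i' j' + cubic i' j' w.
  apply/rowP => q; rewrite [LHS]mxE [RHS]mxE [X in _ = X + _]mxE.
  by rewrite (dual_christoffel1 q i' j' Vw) cubicE; move: (fa _ _ _ _) (fb _ _ _ _) => x1 x2; lra.
have [X XE] : exists X : 'I_n -> 'I_n -> 'I_n -> 'I_n -> R, forall p q r s,
    X p q r s = \sum_a partial_der p (partial_der q (f a)) w *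
                       partial_der r (partial_der s (g a)) w.
  exists (fun p q r s => \sum_a partial_der p (partial_der q (f a)) w *
                       partial_der r (partial_der s (g a)) w); move=> p q r s; exact: erefl.
have XT p q r s : X p q r s = G w q p * G w r s + T (ra p q) (rb r s).
  rewrite XE (dual_completeness _ _ Vw) (dual_ddfg p q Vw) (dual_fddg r s Vw) mulrNN /T.
  rewrite /ra /rb dual_a.unlock dual_b.unlock.
  by [].
have [Y YE] : exists Y : 'I_n -> 'I_n -> 'I_n -> 'I_n -> R, forall p q r s, Y p q r s =
    \sum_a partial_der p (partial_der r (partial_der s (f a))) w * partial_der q (g a) w.
  exists (fun p q r s =>
    \sum_a partial_der p (partial_der r (partial_der s (f a))) w * partial_der q (g a) w); move=> p q r s; exact: erefl.
have [Z ZE] : exists Z : 'I_n -> 'I_n -> 'I_n -> 'I_n -> R, forall p q r s, Z p q r s =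
    \sum_a partial_der q (f a) w * partial_der p (partial_der r (partial_der s (g a))) w.
  exists (fun p q r s =>
    \sum_a partial_der q (f a) w * partial_der p (partial_der r (partial_der s (g a))) w); move=> p q r s; exact: erefl.
have Ysym p q r s : Y p q r s = Y r q p s.
  by rewrite !YE; apply: eq_bigr => a _; rewrite (partial_sym p r (sp s (sf a)) Vw).
have Zsym p q r s : Z p q r s = Z r q p s.
  by rewrite !ZE; apply: eq_bigr => a _; rewrite (partial_sym p r (sp s (sg a)) Vw).
have dchr p q r s : partial_der p (christoffel1 G q r s) w =
    2^-1 * (Y p q r s + X r s p q + (X p q r s + Z p q r s)).
  transitivity (2^-1 * (partial_der p (fa q r s) w + partial_der p (fb q r s) w)).
    rewrite (near_partial_der (g := fun z => 2^-1 * (fa q r s z + fb q r s z)) p oV Vw); last first.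
      move=> z Vz; rewrite (dual_christoffel1 q r s Vz) cubicE.
      by move: (fa q r s z) (fb q r s z) => x1 x2; lra.
    have sa : smooth_on V (fa q r s).
      by rewrite dual_a.unlock; apply: (smooth_sum oV) => a _; apply: (smoothM oV); do ?apply: sp.
    have sb : smooth_on V (fb q r s).
      by rewrite dual_b.unlock; apply: (smooth_sum oV) => a _; apply: (smoothM oV); do ?apply: sp.
    rewrite /partial_der deriveZ_fun; last by apply: differentiableD; apply: dif Vw.
    by rewrite deriveD_fun//; apply: dif Vw.
  rewrite YE ZE !XE dual_a.unlock dual_b.unlock.
  congr (_ * (_ + _)).
    exact: (partial_dot p Vw (fun a => sp r (sp s (sf a))) (fun a => sp q (sg a))).
  exact: (partial_dot p Vw (fun a => sp q (sf a)) (fun a => sp r (sp s (sg a)))).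
rewrite !dchr (Ysym j l i k) (Zsym j l i k).
rewrite !XT !raE !rbE /T !bilinDl !bilinDr !bilinZl -!/T.
rewrite (metric_entry_sym symG k j Vw) (metric_entry_sym symG i l Vw).
rewrite (metric_entry_sym symG k i Vw) (metric_entry_sym symG j l Vw).
have Ks p q : cubic p q w = cubic q p w by exact: cubic_sym.
have gs p q : gam p q = gam q p.
  by apply/rowP => r; rewrite !mxE; apply: christoffel1_sym Vw.
move: (Y i l j k) (Z i l j k) => t1 t2.
rewrite -!/(T _ _).
rewrite (Tsym (cubic j k w) (gam i l)) (Tsym (cubic i k w) (gam j l)).
rewrite (Tsym (cubic i l w) (gam j k)) (Tsym (cubic j l w) (gam i k)).
rewrite (Tsym (gam j k) (gam i l)) (Tsym (cubic j k w) (cubic i l w)).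
rewrite (Tsym (gam i k) (gam j l)) (Tsym (cubic i k w) (cubic j l w)).
move: (T (gam i l) (gam j k)) (T (gam j l) (gam i k)) => x1 x2.
move: (T (gam i l) (cubic j k w)) (T (gam j l) (cubic i k w)) => x3 x4.
move: (T (gam j k) (cubic i l w)) (T (gam i k) (cubic j l w)) => x5 x6.
move: (T (cubic i l w) (cubic j k w)) (T (cubic j l w) (cubic i k w)) => x7 x8.
move: (G w _ _) (G w _ _) (G w _ _) (G w _ _) => y1 y2 y3 y4.
by field.
Qed.

End DualPair.

(** * Homogeneous functions and Minkowski norms *)

Section Homogeneous.
Context {R : realType} (n : nat).
Local Notation W := 'rV[R]_n.

Lemma derive_row (q : W -> R) z v : differentiable q z ->
  'D_v q z = \sum_a v 0 a * partial_der a q z.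
Proof. by move=> dq; rewrite (derive_frame (row_frame n)). Qed.

Lemma derive_coord (V : normedModType R) (phi : V -> W) z v a : differentiable phi z ->
  'D_v (fun z => phi z 0 a) z = ('D_v phi z) 0 a.
Proof.
move=> dphi; have cl : linear (fun v : W => v 0 a) by move=> k u u'; rewrite !mxE.
have cc : continuous (fun v : W => v 0 a) by exact: coord_continuous.
by have [_ ->] := differentiable_linear_comp cl cc dphi.
Qed.

Lemma derive_scaled_dir (V W' : normedModType R) (q : V -> W') z v (l : R) : differentiable q z ->
  'D_(l *: v) q z = l *: 'D_v q z.
Proof. by move=> dq; rewrite !deriveE// linearZ. Qed.

Lemma bilin_gram m (phi : 'rV[R]_m -> W) (B : 'M[R]_n) w v v' : differentiable phi w ->
  bilin (\matrix_(i, j) bilin B (partial_der i phi w) (partial_der j phi w)) v v' =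
  bilin B ('D_v phi w) ('D_v' phi w).
Proof.
move=> dphi; rewrite (derive_frame (row_frame m) v dphi) (derive_frame (row_frame m) v' dphi).
rewrite bilin_suml bilinE; apply: eq_bigr => i _; rewrite bilin_sumr; apply: eq_bigr => j _.
by rewrite mxE bilinZl bilinZr -mulrA; congr (_ * _); exact: mulrC.
Qed.

(** Euler's identity, by differentiating along the ray of [y]. *)
Lemma euler_homogeneous (q : W -> R) y (p : R) : differentiable q y ->
  (forall l : R, 0 < l -> q (l *: y) = l `^ p * q y) -> 'D_y q y = p * q y.
Proof.
move=> dq hq; pose g (l : R) := l *: y.
have gl : linear g by move=> k u u'; rewrite /g scalerDl scalerA.
have gc : continuous g by move=> l; apply: cvgZr_tmp; exact: cvg_id.
have dg : differentiable g (1 : R) by exact: differentiable_linear.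
have g1 : g 1 = y by rewrite /g scale1r.
have dqg : differentiable q (g 1) by rewrite g1.
have := derive_comp (1 : R) dg dqg.
rewrite (derive_linear _ _ gl gc) g1 => <-.
have -> : 'D_(1 : R) (q \o g) (1 : R) = 'D_(1 : R) (fun l : R => q y * l `^ p) (1 : R).
  apply: near_eq_derive; near=> l; rewrite /= /g hq 1?mulrC//.
  by near: l; exact: lt_nbhsr.
have dp : is_derive (1 : R) (1 : R) ((powR (R:=R))^~ p) (p * 1 `^ (p - 1)).
  by apply: is_derive1_powR; exact: ltr01.
transitivity (q y *: 'D_(1 : R) ((powR (R:=R))^~ p) (1 : R)).
  by apply: (@deriveZ _ _ _ ((powR (R:=R))^~ p)); exact: ex_derive.
by rewrite (derive_val (is_derive := dp)) powR1 mulr1 /GRing.scale/= mulrC.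
Unshelve. all: by end_near. Qed.

Lemma derive_homogeneous (q : W -> R) y v (l c : R) : differentiable q y ->
  differentiable q (l *: y) -> (\forall z \near y, q (l *: z) = c * q z) ->
  l * 'D_v q (l *: y) = c * 'D_v q y.
Proof.
move=> dq dql hq; pose g (z : W) := l *: z.
have gl : linear g by move=> k u u'; rewrite /g scalerDr !scalerA mulrC.
have gc : continuous g by move=> z; exact: (@scaler_continuous _ W l z).
have dg : differentiable g y by exact: differentiable_linear.
have := derive_comp (f := q) v dg dql.
rewrite (derive_linear _ _ gl gc) (derive_scaled_dir v l dql) => H.
transitivity ('D_v (q \o g) y); first exact: (esym H).
rewrite -deriveZ_fun//; exact: near_eq_derive.
Qed.

End Homogeneous.

Section MinkowskiNorm.
Context {R : realType} (n : nat).
Local Notation W := 'rV[R]_n.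
Variables (U : set W) (h : W -> R).
Hypotheses (oU : open U) (sh : smooth_on U h).
Hypothesis coneU : forall y (l : R), 0 < l -> U y -> U (l *: y).
Hypothesis homh : forall y (l : R), 0 < l -> U y -> h (l *: y) = l * h y.

(** The Legendre transform of the norm, in coordinates. *)
Definition momentum (j : 'I_n) (y : W) : R := 2^-1 * partial_der j (fun y' => h y' ^+ 2) y.

Definition norm_hessian (y : W) : 'M[R]_n :=
  \matrix_(i, j) (2^-1 * partial_der i (partial_der j (fun y' => h y' ^+ 2)) y).

Local Notation g := norm_hessian.

Lemma hessianE i j y :
  g y i j = 2^-1 * partial_der i (partial_der j (fun y' => h y' ^+ 2)) y.
Proof. exact: mxE. Qed.

Lemma smooth_sqr : smooth_on U (fun y => h y ^+ 2).
Proof. exact: smoothM. Qed.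

Lemma smooth_momentum j : smooth_on U (momentum j).
Proof. by apply: smoothM => //; [exact: smooth_cst|apply: smooth_der; exact: smooth_sqr]. Qed.

Lemma partial_momentum i j y : U y -> partial_der i (momentum j) y = g y i j.
Proof.
move=> Uy; rewrite mxE /momentum; apply: deriveZ_fun.
by apply: (smooth_differentiable _ Uy); apply: smooth_der; exact: smooth_sqr.
Qed.

Lemma smooth_hessian : smooth_mx U g.
Proof.
move=> i j; apply: (@eq_smooth _ _ _ oU _ (partial_der i (momentum j))).
  by move=> y Uy; exact: partial_momentum.
by apply: smooth_der; exact: smooth_momentum.
Qed.

Lemma hessian_sym y : U y -> (g y)^T = g y.
Proof.
move=> Uy; apply/matrixP => i j; have e := partial_sym oU j i smooth_sqr Uy.
by rewrite [LHS]mxE (hessianE j i) e -hessianE.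
Qed.

Let near_U y : U y -> \forall z \near y, U z.
Proof. by move=> Uy; exact: open_nbhs_nbhs. Qed.

Lemma momentum_hom j y (l : R) : 0 < l -> U y -> momentum j (l *: y) = l * momentum j y.
Proof.
move=> l0 Uy; have ds z : U z -> differentiable (fun y' => h y' ^+ 2) z.
  by move=> Uz; exact: smooth_differentiable smooth_sqr Uz.
have H : l * 'D_(delta_mx 0 j) (fun y' => h y' ^+ 2) (l *: y) =
    l ^+ 2 * 'D_(delta_mx 0 j) (fun y' => h y' ^+ 2) y.
  apply: derive_homogeneous; [exact: ds|by apply: ds; exact: coneU|].
  apply: filterS (near_U Uy) => z Uz; by rewrite homh// exprMn.
rewrite /momentum /partial_der mulrCA; congr (_ * _).
by apply: (mulfI (lt0r_neq0 l0)); rewrite H expr2 mulrA.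
Qed.

Lemma hessian_hom y (l : R) : 0 < l -> U y -> g (l *: y) = g y.
Proof.
move=> l0 Uy; have ds j z : U z -> differentiable (momentum j) z.
  by move=> Uz; exact: smooth_differentiable (smooth_momentum j) Uz.
apply/matrixP => i j; have H : l * 'D_(delta_mx 0 i) (momentum j) (l *: y) =
    l * 'D_(delta_mx 0 i) (momentum j) y.
  apply: derive_homogeneous; [exact: ds|by apply: ds; exact: coneU|].
  by apply: filterS (near_U Uy) => z Uz; exact: momentum_hom.
transitivity (partial_der i (momentum j) (l *: y)).
  by apply/esym; apply: partial_momentum; exact: coneU.
transitivity (partial_der i (momentum j) y); first exact: (mulfI (lt0r_neq0 l0) H).
exact: partial_momentum.
Qed.

(** Euler's identity for the momentum, of degree 1. *)
Lemma hessian_momentum y j : U y -> \sum_i y 0 i * g y i j = momentum j y.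
Proof.
move=> Uy; have dm : differentiable (momentum j) y.
  exact: smooth_differentiable (smooth_momentum j) Uy.
rewrite -[RHS]mul1r -(euler_homogeneous dm); last first.
  by move=> l l0; rewrite powRr1 ?(ltW l0)//; exact: momentum_hom.
by rewrite derive_row//; apply: eq_bigr => i _; rewrite partial_momentum.
Qed.

(** Euler's identity for the square of the norm, of degree 2. *)
Lemma momentum_dot y : U y -> \sum_j y 0 j * momentum j y = h y ^+ 2.
Proof.
move=> Uy; have ds : differentiable (fun y' => h y' ^+ 2) y.
  exact: smooth_differentiable smooth_sqr Uy.
have := euler_homogeneous (p := 2) ds.
rewrite derive_row// => H.
transitivity (2^-1 * \sum_a y 0 a * partial_der a (fun y' => h y' ^+ 2) y).
  by rewrite mulr_sumr; apply: eq_bigr => a _; rewrite /momentum mulrCA.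
rewrite H; first by rewrite mulrA mulVf ?mul1r// pnatr_eq0.
by move=> l l0; rewrite homh// exprMn (powR_mulrn 2 (ltW l0)).
Qed.

Lemma bilin_hessian_self y : U y -> bilin (g y) y y = h y ^+ 2.
Proof.
move=> Uy; rewrite -(momentum_dot Uy) bilinE exchange_big/=; apply: eq_bigr => j _.
by rewrite -mulr_suml hessian_momentum// mulrC.
Qed.

Section Chain.
Context (m : nat) (V : set 'rV[R]_m) (phi : 'rV[R]_m -> W).
Hypotheses (oV : open V) (sphi : smooth_on V phi).
Hypothesis phiU : forall w, V w -> U (phi w).

Lemma partial_comp (q : W -> R) i w : smooth_on U q -> V w ->
  partial_der i (fun w => q (phi w)) w =
  \sum_a partial_der i (fun w => phi w 0 a) w * partial_der a q (phi w).
Proof.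
move=> sq Vw; have dphi := smooth_differentiable sphi Vw.
have dq := smooth_differentiable sq (phiU Vw).
rewrite /partial_der (derive_comp _ dphi dq) derive_row//.
by apply: eq_bigr => a _; rewrite derive_coord.
Qed.

Lemma smooth_momentum_comp a : smooth_on V (fun w => momentum a (phi w)).
Proof. by apply: (smooth_comp oV (row_frame n) sphi (smooth_momentum a)). Qed.

End Chain.
End MinkowskiNorm.

Section UnitSphere.
Context {R : realType} (n : nat).
Local Notation W := 'rV[R]_n.+1.
Variables (U : set W) (h : W -> R).
Hypotheses (oU : open U) (sh : smooth_on U h).
Hypothesis coneU : forall y (l : R), 0 < l -> U y -> U (l *: y).
Hypothesis homh : forall y (l : R), 0 < l -> U y -> h (l *: y) = l * h y.
Variables (V : set 'rV[R]_n) (phi : 'rV[R]_n -> W).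
Hypotheses (oV : open V) (sphi : smooth_on V phi).
Hypothesis phiU : forall w, V w -> U (phi w).
Hypothesis phi1 : forall w, V w -> h (phi w) = 1.

Let f a w := phi w 0 a.
Let m a w := momentum h a (phi w).

Lemma sphere_dual1 w : V w -> \sum_a f a w * m a w = 1.
Proof. by move=> Vw; rewrite (@momentum_dot _ _ U h oU sh homh _ (phiU Vw)) phi1// expr1n. Qed.

Lemma sphere_dual0 w i : V w -> \sum_a partial_der i (f a) w * m a w = 0.
Proof.
move=> Vw; have := partial_comp sphi phiU i (smooth_sqr oU sh) Vw.
rewrite (near_partial_der (g := fun=> 1) i oV Vw); last by move=> z Vz; rewrite phi1// expr1n.
rewrite [X in X = _]derive_cst => H.
transitivity (2^-1 * \sum_a partial_der i (f a) w * partial_der a (fun y' => h y' ^+ 2) (phi w)).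
  by rewrite mulr_sumr; apply: eq_bigr => a _; rewrite /m /momentum mulrCA.
by rewrite -H mulr0.
Qed.

(** The induced metric is that of the pair made of [phi] and its conormal, the
    Legendre transform of [phi]. *)
Lemma sphere_dual_metric w : V w ->
  dual_metric f m w = \matrix_(i, j) bilin (norm_hessian h (phi w))
     (partial_der i phi w) (partial_der j phi w).
Proof.
move=> Vw; apply/matrixP => i j; rewrite !mxE bilinE.
have dphi := smooth_differentiable sphi Vw.
apply: eq_bigr => a _.
rewrite /m (partial_comp sphi phiU j (smooth_momentum oU sh a) Vw) mulr_sumr.
apply: eq_bigr => b _; rewrite (partial_momentum oU sh _ _ (phiU Vw)).
rewrite /partial_der /f derive_coord// derive_coord//.
have -> : norm_hessian h (phi w) b a = norm_hessian h (phi w) a b.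
  by rewrite -[in LHS](@hessian_sym _ _ U h oU sh _ (phiU Vw)) mxE.
move: (_ 0 a) (_ 0 b) (norm_hessian h (phi w) a b) => x1 x2 x3; ring.
Qed.

End UnitSphere.

(** * Deformed Euclidean spaces *)

Section RoundSphere.
Context {R : realType} (n : nat).
Variables (V : set 'rV[R]_n) (psi : 'rV[R]_n -> 'rV[R]_n.+1) (A : 'M[R]_n.+1).
Hypotheses (oV : open V) (spsi : smooth_on V psi) (symA : A^T = A).
Hypothesis psi1 : forall w, V w -> bilin A (psi w) (psi w) = 1.

Let G w : 'M[R]_n := \matrix_(i, j) bilin A (partial_der i psi w) (partial_der j psi w).
Hypothesis unitG : forall w, V w -> G w \in unitmx.

Let f a w := psi w 0 a.
Let g a w := \sum_b A a b * psi w 0 b.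

Let sf a : smooth_on V (f a). Proof. exact: smooth_row_coord. Qed.

Let sg a : smooth_on V (g a).
Proof. by apply: smooth_sum => // b _; apply: smoothM => //; [exact: (smooth_cst V (A a b))|exact: sf]. Qed.

Let df a w : V w -> differentiable (f a) w.
Proof. exact: smooth_differentiable. Qed.

Let derive_g v a w : V w -> 'D_v (g a) w = \sum_b A a b * 'D_v (f b) w.
Proof.
move=> Vw; rewrite derive_sum_fun => [|b].
  by apply: eq_bigr => b _; apply: deriveZ_fun; exact: df.
by apply: differentiableM; [exact: differentiable_cst|exact: df].
Qed.

Let partial_g i a w : V w -> partial_der i (g a) w = \sum_b A a b * partial_der i (f b) w.
Proof. exact: derive_g. Qed.

Let derive2_g i j a w : V w -> partial_der i (partial_der j (g a)) w =
  \sum_b A a b * partial_der i (partial_der j (f b)) w.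
Proof.
move=> Vw; rewrite (near_partial_der (g := fun w => \sum_b A a b * partial_der j (f b) w) i oV Vw).
  have d2 b : differentiable (partial_der j (f b)) w.
    by apply: (smooth_differentiable _ Vw); exact: smooth_der.
  rewrite /partial_der derive_sum_fun => [|b].
    by apply: eq_bigr => b _; apply: deriveZ_fun; exact: d2.
  by apply: differentiableM; [exact: differentiable_cst|exact: d2].
by move=> z Vz; exact: partial_g.
Qed.

Let symAS (u v : 'I_n.+1 -> R) :
  \sum_a u a * (\sum_b A a b * v b) = \sum_a v a * (\sum_b A a b * u b).
Proof.
under eq_bigr do rewrite mulr_sumr; under [RHS]eq_bigr do rewrite mulr_sumr.
rewrite exchange_big/=; apply: eq_bigr => b _; apply: eq_bigr => a _.
rewrite -{1}symA mxE; ring.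
Qed.

Let bilinS (u v : 'rV[R]_n.+1) : bilin A u v = \sum_a u 0 a * (\sum_b A a b * v 0 b).
Proof.
rewrite bilinE; apply: eq_bigr => a _; rewrite mulr_sumr; apply: eq_bigr => b _.
by rewrite mulrA.
Qed.

Let GE w : V w -> dual_metric f g w = G w.
Proof.
move=> Vw; have dpsi := smooth_differentiable spsi Vw.
apply/matrixP => i j; rewrite !mxE bilinS; apply: eq_bigr => a _.
rewrite partial_g// /partial_der /f derive_coord//; congr (_ * _).
by apply: eq_bigr => b _; rewrite derive_coord.
Qed.

(** A sphere in a Euclidean space is self-dual up to the identification [A], so
    that its cubic form vanishes and Gauss' equation gives curvature 1. *)
Lemma round_sphere_curvature : const_curvature V G 1.
Proof.
have fg1 w : V w -> \sum_a f a w * g a w = 1 by move=> Vw; rewrite -bilinS psi1.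
have dfg0 w i : V w -> \sum_a partial_der i (f a) w * g a w = 0.
  move=> Vw; have := partial_dot i Vw sf sg.
  rewrite (near_partial_der (g := fun=> 1) i oV Vw)//.
  under [X in _ = _ + X]eq_bigr do rewrite partial_g//.
  rewrite (symAS (fun a => f a w)) [X in X = _]derive_cst -mulr2n => /esym/eqP.
  by rewrite mulrn_eq0/= => /eqP.
have sG w : V w -> (dual_metric f g w)^T = dual_metric f g w.
  by move=> Vw; rewrite GE//; apply/matrixP => i j; rewrite !mxE bilin_sym.
have uG w : V w -> dual_metric f g w \in unitmx by move=> Vw; rewrite GE//; exact: unitG.
apply: (const_curvature_local oV (smooth_dual_metric oV sf sg) uG).
  by move=> w Vw; rewrite GE.
have K0 w i j : V w -> dual_cubic f g i j w = 0.
  move=> Vw; apply/rowP => l; rewrite cubicE mxE dual_a.unlock dual_b.unlock.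
  have -> : \sum_a partial_der l (f a) w * partial_der i (partial_der j (g a)) w =
      \sum_a partial_der i (partial_der j (f a)) w * partial_der l (g a) w.
    under eq_bigr do rewrite derive2_g//.
    by rewrite symAS; apply: eq_bigr => a _; rewrite partial_g.
  by rewrite subrr mulr0.
move=> w Vw l k i j; rewrite (dual_curvature oV sf sg fg1 dfg0 sG uG)//.
by rewrite !K0// !bilin0l mul1r subr0 addr0.
Qed.

End RoundSphere.

Lemma open_preimage (T T' : topologicalType) (V : set T) (O : set T') (phi : T -> T') :
  open V -> (forall z, V z -> {for z, continuous phi}) -> open O ->
  open (V `&` [set z | O (phi z)]).
Proof.
move=> oV cphi oO; rewrite openE => z [Vz Oz]; apply: filterI.
  exact: open_nbhs_nbhs.
by apply: (cphi z Vz); exact: open_nbhs_nbhs.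
Qed.

Section Fibres.
Context {R : realType} (P V : normedModType R).

Lemma open_section (D : set (P * V)) x : open D -> open [set y | D (x, y)].
Proof.
move=> oD; apply: (open_comp (f := fun y : V => (x, y))) oD => y _.
by apply: cvg_pair; [exact: cvg_cst|exact: cvg_id].
Qed.

Lemma smooth_section (fP : frame P) (fV : frame V) (D : set (P * V)) (f : P * V -> R) x :
  open D -> smooth_on D f -> smooth_on [set y | D (x, y)] (fun y => f (x, y)).
Proof.
move=> oD sf; have os := open_section x oD.
apply: (smooth_comp os (prod_frame fP fV) (g := fun y : V => (x, y)) _ sf) => //.
by apply: smooth_pair => //; [exact: smooth_cst|move=> k; exact: Ck_id].
Qed.

Lemma smooth_row_section (fP : frame P) (fV : frame V) m (D : set (P * V)) (f : P * V -> 'rV[R]_m) x :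
  open D -> smooth_on D f -> smooth_on [set y | D (x, y)] (fun y => f (x, y)).
Proof.
move=> oD sf; have os := open_section x oD; apply: smooth_on_row => // i.
apply: (smooth_section fP fV (f := fun z => f z 0 i)) => //.
exact: smooth_row_coord.
Qed.

End Fibres.

Section Deformations.
Context {R : realType} (n : nat).
Local Notation W := 'rV[R]_n.+1.
Variables (M : set W) (D : set (W * W)) (F : W * W -> R).
Hypothesis hF : finsler_space M D F.

Let oD := finsler_domain_open hF.

Lemma fundamental_tensorE x : fundamental_tensor F x = norm_hessian (fun y => F (x, y)).
Proof. by []. Qed.

Lemma smooth_norm x : smooth_on [set y | D (x, y)] (fun y => F (x, y)).
Proof. exact: (smooth_section (row_frame _) (row_frame _) x oD (finsler_smooth hF)). Qed.

Let homF x y (l : R) (l0 : 0 < l) (Dxy : D (x, y)) := finsler_hom hF l0 Dxy.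
Let conF x y (l : R) (l0 : 0 < l) (Dxy : D (x, y)) := finsler_domain_conic hF l0 Dxy.

Lemma posdef_induced_metric x V phi w : indicatrix_param D F x V phi -> V w ->
  posdef (induced_metric F x phi w).
Proof.
move=> [oV sphi ind imm] Vw; have [symF posF] := finsler_posdef hF (ind w Vw).1.
have dphi := smooth_differentiable sphi Vw; split.
  by apply/matrixP => p r; rewrite !mxE bilin_sym.
move=> v v0; rewrite /induced_metric (bilin_gram _ _ _ dphi); apply: posF.
by apply/eqP => /(imm _ Vw) vE; rewrite vE eqxx in v0.
Qed.

Variables (A : W -> 'M[R]_n.+1) (H a : W -> R).

Section Local.
Variables (D' : set (W * W)) (ybar : W * W -> W) (f : W * W -> R).
Hypotheses (D'D : D' `<=` D) (def : deformation F A H a D' ybar f).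
Variable x : W.
Hypothesis pA : posdef (A x).

Let q y := ybar (x, y).

Let sq : smooth_on [set y | D' (x, y)] q.
Proof. exact: (smooth_row_section (row_frame _) (row_frame _) x (deform_open def) (deform_smooth def)). Qed.

Let dq y : D' (x, y) -> differentiable q y.
Proof. by move=> D'y; exact: smooth_differentiable sq D'y. Qed.

(** The point [y / F] is a unit vector of [F], hence goes to a unit vector of [A]. *)
Lemma deform_norm y : D' (x, y) -> bilin (A x) (q y) (q y) = F (x, y) `^ H x * F (x, y) `^ H x.
Proof.
move=> D'y; have Dy := D'D D'y; have r0 := finsler_pos hF Dy.
set r := F (x, y) in r0 *.
pose y1 := r^-1 *: y; have ri : 0 < r^-1 by rewrite invr_gt0.
have D'y1 : D' (x, y1) by exact: (deform_conic def).
have F1 : F (x, y1) = 1 by rewrite (homF ri Dy) mulVf// lt0r_neq0.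
have b1 : bilin (A x) (q y1) (q y1) = 1.
  have /(deform_unit def D'y1) := F1; rewrite /riemannian_norm => s1.
  by rewrite -[LHS]sqr_sqrtr ?s1 ?expr1n//; exact: posdef_ge0.
have -> : q y = r `^ H x *: q y1.
  by rewrite -(deform_hom def r0 D'y1) scalerA mulfV ?lt0r_neq0// scale1r.
by rewrite bilinZl bilinZr b1 mulr1.
Qed.

Lemma deform_euler y : D' (x, y) -> 'D_y q y = H x *: q y.
Proof.
move=> D'y; apply/rowP => i; rewrite -derive_coord; last exact: dq.
rewrite (euler_homogeneous (p := H x)) ?mxE//.
  by apply: (smooth_differentiable (smooth_row_coord (open_section x (deform_open def)) i sq)).
by move=> l l0; rewrite /q (deform_hom def l0 D'y) mxE.
Qed.

Lemma deform_pullback y v v' : D' (x, y) ->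
  bilin (fundamental_tensor F x y) v v' = f (x, y) * bilin (A x) ('D_v q y) ('D_v' q y).
Proof.
by move=> D'y; rewrite (deform_conformal def D'y) bilin_scale (bilin_gram _ _ _ (dq D'y)).
Qed.

(** Both tensors are evaluated on the pair [(y, y)], with Euler's identity on each side. *)
Lemma deform_energy y : D' (x, y) ->
  F (x, y) ^+ 2 = f (x, y) * H x ^+ 2 * (F (x, y) `^ H x) ^+ 2.
Proof.
move=> D'y; have Dy := D'D D'y.
rewrite -(bilin_hessian_self (open_section x oD) (@smooth_norm x) (@conF x) (@homF x) Dy).
rewrite deform_pullback// deform_euler// bilinZl bilinZr deform_norm//.
by rewrite !expr2 !mulrA.
Qed.

Lemma deform_degree_neq0 y : D' (x, y) -> H x != 0.
Proof.
move=> D'y; have r0 := finsler_pos hF (D'D D'y).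
apply/eqP => H0; have := deform_energy D'y.
rewrite H0 (_ : 0 ^+ 2 = 0 :> R) ?expr0n// mulr0 mul0r => /eqP; rewrite expf_eq0/= => /eqP r00.
by rewrite r00 ltxx in r0.
Qed.

(** The previous identity at [y] and at [2 y]: the degrees [2 a + 2 H] and [2]
    of its two members agree. *)
Lemma deform_degree y : D' (x, y) -> H x = 1 - a x.
Proof.
move=> D'y; have Dy := D'D D'y; have r0 := finsler_pos hF Dy.
have t0 : 0 < 2 :> R by [].
have e1 := deform_energy D'y; have e2 := deform_energy (deform_conic def t0 D'y).
have f0 := deform_mult_pos def D'y.
have H0 : 0 < H x ^+ 2 by rewrite exprn_even_gt0//= (deform_degree_neq0 D'y).
rewrite (homF t0 Dy) (deform_mult_hom def t0 D'y) in e2.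
set r := F (x, y) in r0 e1 e2; rewrite powRM ?(ltW r0)// in e2.
have lr : r ^+ 2 != 0 by rewrite expf_neq0// lt0r_neq0.
have : 2 ^+ 2 = 2 `^ (2 * a x) * (2 `^ H x) ^+ 2 :> R.
  apply: (mulIf lr); rewrite -exprMn e2 [in RHS]e1 exprMn; ring.
move=> /(congr1 (@ln R)).
rewrite -(powR_mulrn 2 (ltW t0)) expr2 -!powRD ?pnatr_eq0 ?implybT// !ln_powR => e.
have l2 : ln 2 != 0 :> R by rewrite lt0r_neq0// ln_gt0// ltr1n.
have := mulIf l2 e => e'; lra.
Qed.

Lemma deform_multiplier y : D' (x, y) -> f (x, y) = (`|H x|^-1 * F (x, y) `^ a x) ^+ 2.
Proof.
move=> D'y; have r0 := finsler_pos hF (D'D D'y).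
have := deform_energy D'y; have H0 := deform_degree_neq0 D'y.
set r := F (x, y) in r0 *.
have -> : r `^ a x = r / r `^ H x.
  have -> : a x = 1 - H x by rewrite (deform_degree D'y); lra.
  by rewrite powRB ?(lt0r_neq0 r0) ?implybT// powRr1// ltW.
rewrite !exprMn exprVn real_normK ?num_real// => ->.
have p0 : r `^ H x != 0 by rewrite lt0r_neq0// powR_gt0.
by field; rewrite p0 H0.
Qed.

End Local.

(** The map [ybar] sends the indicatrix into the unit sphere of [A x], and the
    multiplier is the constant [H^-2] on the indicatrix. *)
Lemma FN_curvature x : FN_structure M D F A H a -> M x ->
  indicatrix_const_curvature D F x (H x ^+ 2).
Proof.
move=> [[_ pA] loc] Mx V phi [oV sphi ind imm] w Vw l k i j.
have [D' [ybar [f [D'w D'D def]]]] := loc (x, phi w) (ind _ Vw).1.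
pose V' := V `&` [set w | D' (x, phi w)].
have oV' : open V'.
  apply: (open_preimage oV _ (open_section x (deform_open def))) => z Vz.
  exact: (Ck_continuous (sphi 0%N)).
have V'w : V' w by [].
have sV' : V' `<=` V by move=> z [].
have sphi' : smooth_on V' phi by exact: smooth_subset sphi.
pose q y := ybar (x, y); pose psi z := q (phi z).
have sq : smooth_on [set y | D' (x, y)] q.
  exact: (smooth_row_section (row_frame _) (row_frame _) x (deform_open def) (deform_smooth def)).
have dq y : D' (x, y) -> differentiable q y by move=> D'y; exact: smooth_differentiable sq D'y.
have spsi : smooth_on V' psi.
  apply: smooth_on_row => // m; apply: (smooth_comp oV' (row_frame _) (f := fun y => q y 0 m) sphi').
    exact: (smooth_row_coord (open_section x (deform_open def)) m sq).
  by move=> z [].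
have pAx := pA x Mx.
have psi1 z : V' z -> bilin (A x) (psi z) (psi z) = 1.
  by move=> [Vz D'z]; rewrite (deform_norm D'D def pAx D'z) (ind _ Vz).2 powR1 mulr1.
pose G' z : 'M[R]_n := \matrix_(i, j) bilin (A x) (partial_der i psi z) (partial_der j psi z).
have dpsi z m : V' z -> partial_der m psi z = 'D_(partial_der m phi z) q (phi z).
  move=> [Vz D'z]; apply: derive_comp (dq _ D'z).
  exact: smooth_differentiable sphi Vz.
have H0 : H x != 0 by exact: (deform_degree_neq0 D'D def pAx D'w).
have GE z : V' z -> induced_metric F x phi z = (H x ^+ 2)^-1 *: G' z.
  move=> V'z; have [Vz D'z] := V'z; apply/matrixP => p r; rewrite [LHS]mxE [RHS]mxE [in RHS]mxE.
  rewrite (deform_pullback def _ _ D'z) (deform_multiplier D'D def pAx D'z) (ind _ Vz).2 powR1 mulr1.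
  by rewrite !dpsi// exprVn real_normK ?num_real.
have pG z : V' z -> posdef (induced_metric F x phi z).
  by move=> [Vz _]; exact: (posdef_induced_metric (And4 oV sphi ind imm) Vz).
have uG' z : V' z -> G' z \in unitmx.
  move=> V'z; have := posdef_unit (pG z V'z); rewrite GE//.
  by rewrite unitmxZ// unitfE invr_eq0 expf_neq0.
have := const_curvature_scale oV' _ uG' _ GE (round_sphere_curvature oV' spsi (proj1 pAx) psi1 uG').
rewrite div1r invrK; apply => //.
  move=> p r; apply: (@eq_smooth _ _ _ oV' _ (fun z => bilin (A x) (partial_der p psi z) (partial_der r psi z))).
    by move=> z _; rewrite mxE.
  apply: (smooth_bilin (B := fun=> A x)) => //.
  - by move=> ? ?; exact: smooth_cst.
  - by move=> u u'; rewrite ord1; apply: smooth_row_coord => //; exact: smooth_der.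
  - by move=> u u'; rewrite ord1; apply: smooth_row_coord => //; exact: smooth_der.
by rewrite invr_eq0 expf_neq0.
Qed.


End Deformations.

(** * Orthonormal frames and central projection charts *)

Section OrthonormalFrame.
Context {R : realType} (n : nat).

Lemma dot_ge0 m (u : 'rV[R]_m) : 0 <= (u *m u^T) 0 0.
Proof. by rewrite mxE sumr_ge0// => i _; rewrite mxE -expr2 sqr_ge0. Qed.

Lemma dot_eq0 m (u : 'rV[R]_m) : (u *m u^T) 0 0 = 0 -> u = 0.
Proof.
rewrite mxE => /eqP; rewrite psumr_eq0 => [/allP H|i _]; last by rewrite mxE -expr2 sqr_ge0.
apply/rowP => i; have := H i (mem_index_enum i); rewrite !mxE -expr2 expf_eq0/=.
by move/eqP.
Qed.

(** Householder's reflection takes the first vector of the standard basis to [u]. *)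
Lemma orthogonal_completion (u : 'rV[R]_(1 + n)) : u *m u^T = 1%:M ->
  exists Q : 'M[R]_(1 + n), Q *m Q^T = 1%:M /\ usubmx Q = u.
Proof.
move=> u1; pose e : 'rV[R]_(1 + n) := row_mx 1%:M 0.
have e1 : e *m e^T = 1%:M by rewrite tr_row_mx mul_row_col trmx1 mul1mx mul0mx addr0.
have eQ (Q : 'M[R]_(1 + n)) : e *m Q = usubmx Q.
  by rewrite -[in LHS](vsubmxK Q) mul_row_col mul1mx mul0mx addr0.
have [ue|ue] := eqVneq u e.
  by exists 1%:M; rewrite trmx1 mulmx1 -eQ mulmx1 ue.
pose v := e - u; pose t : R := (v *m v^T) 0 0.
have tE : v *m v^T = t%:M by rewrite [LHS]mx11_scalar.
have t0 : t != 0.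
  by apply/eqP => /dot_eq0 /eqP; rewrite subr_eq0 eq_sym (negbTE ue).
pose s := (e *m u^T) 0 0.
have sE : e *m u^T = s%:M by rewrite [LHS]mx11_scalar.
have sE' : u *m e^T = s%:M by rewrite -[RHS]tr_scalar_mx -sE trmx_mul trmxK.
have ts : t = 2 * (1 - s).
  rewrite /t /v linearB/= mulmxBl !mulmxBr e1 u1 sE sE' !mxE !mulr1n; lra.
have vE : v = e - u by [].
clearbody s t v; pose X := v^T *m v.
have XX : X *m X = t *: X by rewrite mulmxA -(mulmxA v^T) tE mul_mx_scalar -scalemxAl.
have symQ : (1%:M - (2 / t) *: X)^T = 1%:M - (2 / t) *: X.
  have XT : X^T = X by rewrite trmx_mul trmxK.
  clearbody X; apply/matrixP => i j; rewrite !mxE eq_sym; congr (_ - _ * _).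
  by rewrite -[in LHS]XT mxE.
exists (1%:M - (2 / t) *: X); split.
  rewrite symQ; clearbody X; rewrite mulmxBl !mulmxBr !mul1mx mulmx1 -scalemxAl -scalemxAr.
  rewrite XX !scalerA -[RHS]subr0 -addrA; congr (_ + _).
  rewrite opprB addrCA -scaleNr -!scalerDl (_ : _ + _ = 0) ?scale0r ?oppr0//; by field.
rewrite -eQ mulmxBr mulmx1 -scalemxAr mulmxA.
have -> : e *m v^T = (1 - s)%:M by rewrite vE linearB/= mulmxBr e1 sE -raddfB.
have e3 : 2 / t * (1 - s) = 1.
  have st : s = 1 - t / 2 by rewrite ts; field.
  by rewrite st; field.
by rewrite mul_scalar_mx scalerA e3 scale1r vE opprB addrCA subrr addr0.
Qed.

(** The rows of [B] complete the unit vector [y0] to an orthonormal basis for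
    [g]: Cholesky's factor of [g] reduces this to the standard scalar product. *)
Lemma orthonormal_frame (g : 'M[R]_n.+1) (y0 : 'rV[R]_n.+1) : posdef g -> bilin g y0 y0 = 1 ->
  exists B : 'M[R]_(n, n.+1), [/\ B *m g *m y0^T = 0, B *m g *m B^T = 1%:M &
    invmx g = y0^T *m y0 + B^T *m B].
Proof.
move=> pg y1.
have [L [_ /(_ 0 I) LE]] := @smooth_cholesky R R setT n.+1 (fun=> g) openT
  (fun _ _ => smooth_cst _ _) (fun _ _ => pg).
pose l := L 0; have gE : l^T *m l = g := LE.
have ug := posdef_unit pg.
have ul : l \in unitmx by move: ug; rewrite -gE unitmx_mul => /andP[].
have ult : l^T \in unitmx by rewrite unitmx_tr.
pose u : 'rV[R]_(1 + n) := y0 *m l^T.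
have u1 : u *m u^T = 1%:M.
  by rewrite trmx_mul trmxK -mulmxA (mulmxA l^T) gE mulmxA [LHS]mx11_scalar -/(bilin g y0 y0) y1.
have [Q [QQ Qu]] := orthogonal_completion u1.
pose E : 'M[R]_(1 + n, n.+1) := Q *m invmx l^T.
pose B : 'M[R]_(n, n.+1) := dsubmx E.
have Ey : E = col_mx y0 B.
  by rewrite -[E in LHS]vsubmxK; congr col_mx; rewrite /E -mul_usub_mx Qu /u mulmxK.
have EgE : E *m g *m E^T = 1%:M.
  rewrite /E trmx_mul -gE trmx_inv trmxK !mulmxA mulmxKV//.
  by rewrite mulmxK.
have gEE : g *m (E^T *m E) = 1%:M.
  by rewrite mulmxA; apply: mulmx1C; rewrite mulmxA.
move: EgE; rewrite Ey tr_col_mx mul_col_mx mul_col_row scalar_mx_block => /eq_block_mx[_ _ H1 H2].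
exists B; split => //.
have <- : E^T *m E = y0^T *m y0 + B^T *m B by rewrite Ey tr_col_mx mul_row_col.
by rewrite -[LHS]mulmx1 -gEE mulKmx.
Qed.

End OrthonormalFrame.

Section RayChart.
Context {R : realType} (n : nat).
Local Notation W := 'rV[R]_n.+1.
Variables (M : set W) (D : set (W * W)) (F : W * W -> R).
Hypothesis hF : finsler_space M D F.
Variables (y0 : W) (B : 'M[R]_(n, n.+1)).
Hypothesis free : forall (c : R) (v : 'rV[R]_n), c *: y0 + v *m B = 0 -> c = 0 /\ v = 0.

Definition ray_point (w : 'rV[R]_n) : W := y0 + w *m B.
Definition ray_dom : set (W * 'rV[R]_n) := [set z | D (z.1, ray_point z.2)].
(** Central projection of the affine hyperplane through [y0] spanned by the
    rows of [B] onto the indicatrices. *)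
Definition ray_chart (z : W * 'rV[R]_n) : W := (F (z.1, ray_point z.2))^-1 *: ray_point z.2.

Lemma ray_linear : linear (fun w : 'rV[R]_n => w *m B).
Proof. by move=> c u v; rewrite mulmxDl -scalemxAl. Qed.

Lemma mulmxr_smooth (p q : nat) (V : normedModType R) (U : set V) (f : V -> 'rV[R]_p)
    (C : 'M[R]_(p, q)) : open U -> smooth_on U f -> smooth_on U (fun z => f z *m C).
Proof.
move=> oU sf; apply: smooth_on_row => // j.
apply: (@eq_smooth _ _ _ oU _ (fun z => \sum_i f z 0 i * C i j)) => [z _|]; first by rewrite mxE.
by apply: smooth_sum => // i _; apply: smoothM => //; [exact: smooth_row_coord|exact: (smooth_cst U (C i j))].
Qed.

Lemma smooth_ray_point U : open U -> smooth_on U ray_point.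
Proof.
move=> oU; apply: smoothD => //; first exact: smooth_cst.
by apply: mulmxr_smooth => // k; exact: Ck_id.
Qed.

Lemma smooth_ray_arg : smooth_on setT (fun z : W * 'rV[R]_n => (z.1, ray_point z.2)).
Proof.
apply: smooth_pair; first exact: openT.
  by move=> k; apply: Ck_fst_comp openT _; exact: Ck_id.
apply: (smoothD openT (f := fun=> y0)); first exact: smooth_cst.
apply: (mulmxr_smooth B openT) => k; apply: Ck_snd_comp openT _; exact: Ck_id.
Qed.

Lemma open_ray_dom : open ray_dom.
Proof.
have := open_preimage openT _ (finsler_domain_open hF).
move=> /(_ _ (fun z : W * 'rV[R]_n => (z.1, ray_point z.2))).
rewrite setTI; apply => z _; exact: (Ck_continuous (smooth_ray_arg 0%N)).
Qed.

Lemma smooth_ray_norm : smooth_on ray_dom (fun z => F (z.1, ray_point z.2)).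
Proof.
apply: (smooth_comp open_ray_dom (prod_frame (row_frame _) (row_frame _))
  (f := F) _ (finsler_smooth hF)) => //.
exact: smooth_subset smooth_ray_arg.
Qed.

Lemma ray_norm_gt0 z : ray_dom z -> 0 < F (z.1, ray_point z.2).
Proof. exact: (finsler_pos hF). Qed.

Lemma smooth_ray_chart : smooth_on ray_dom ray_chart.
Proof.
have oD := open_ray_dom.
apply: smooth_on_row => // i.
apply: (@eq_smooth _ _ _ oD _ (fun z => (F (z.1, ray_point z.2))^-1 * ray_point z.2 0 i)).
  by move=> z _; rewrite [RHS]mxE.
apply: smoothM => //.
  by apply: (smoothV oD _ smooth_ray_norm) => z /ray_norm_gt0/lt0r_neq0.
apply: smooth_row_coord => //.
apply: (smoothD oD (f := fun=> y0)); first exact: smooth_cst.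
by apply: (mulmxr_smooth B oD) => k; apply: Ck_snd_comp oD _; exact: Ck_id.
Qed.

Lemma ray_chart_unit z : ray_dom z -> indicatrix D F z.1 (ray_chart z).
Proof.
move=> Dz; have F0 := ray_norm_gt0 Dz; have Fi : 0 < (F (z.1, ray_point z.2))^-1 by rewrite invr_gt0.
split; first exact: (finsler_domain_conic hF).
by rewrite (finsler_hom hF)// mulVf// lt0r_neq0.
Qed.

Lemma derive_ray_chart x w v : ray_dom (x, w) ->
  'D_v (fun w' => ray_chart (x, w')) w =
  (F (x, ray_point w))^-1 *: (v *m B - ('D_(v *m B) (fun y => F (x, y)) (ray_point w) /
     F (x, ray_point w)) *: ray_point w).
Proof.
move=> Dw; have oS : open [set w | ray_dom (x, w)] := open_section x open_ray_dom.
have r0 := ray_norm_gt0 Dw; set r := F (x, _) in r0 *.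
have sr : smooth_on [set w | ray_dom (x, w)] (fun w' => F (x, ray_point w')).
  exact: (smooth_section (row_frame _) (row_frame _) x open_ray_dom smooth_ray_norm).
have dr := smooth_differentiable sr Dw.
have dp : differentiable ray_point w := smooth_differentiable (smooth_ray_point oS) Dw.
have dc : differentiable (fun w' => ray_chart (x, w')) w.
  apply: (smooth_differentiable (O := [set w | ray_dom (x, w)]) _ Dw).
  exact: (smooth_row_section (row_frame _) (row_frame _) x open_ray_dom smooth_ray_chart).
have Dp u : 'D_u ray_point w = u *m B.
  have lc : continuous (fun w : 'rV[R]_n => w *m B).
    have sid : smooth_on setT (@id 'rV[R]_n) by move=> k; exact: Ck_id.
    by move=> z; exact: (mulmxr_smooth B openT sid 0%N).
  rewrite /ray_point (@deriveD _ _ _ (fun=> y0) (fun w : 'rV[R]_n => w *m B)).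
  - by rewrite derive_cst add0r (derive_linear _ _ ray_linear lc).
  - exact: derivable_cst.
  - apply: diff_derivable; exact: (differentiable_linear _ ray_linear lc).
have Dr : 'D_v (fun w' => F (x, ray_point w')) w = 'D_(v *m B) (fun y => F (x, y)) (ray_point w).
  have dF : differentiable (fun y => F (x, y)) (ray_point w).
    exact: smooth_differentiable (smooth_norm hF x) Dw.
  by rewrite (derive_comp v dp dF) Dp.
apply/rowP => i; rewrite -derive_coord//.
have e w' : ray_dom (x, w') -> ray_point w' 0 i = F (x, ray_point w') * ray_chart (x, w') 0 i.
  by move=> /ray_norm_gt0/lt0r_neq0 n0; rewrite [X in _ = _ * X]mxE mulrA mulfV// mul1r.
have := near_eq_derive (f := fun w' => ray_point w' 0 i)
   (g := fun w' => F (x, ray_point w') * ray_chart (x, w') 0 i) (a := w) v.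
have nw : \near w, ray_point w 0 i = F (x, ray_point w) * ray_chart (x, w) 0 i.
  by apply: filterS (open_nbhs_nbhs (conj oS Dw)) => w' /e.
move=> /(_ nw); rewrite derive_coord// Dp deriveM_fun//; last first.
  exact: smooth_differentiable (smooth_row_coord oS i (smooth_row_section (row_frame _) (row_frame _) x open_ray_dom smooth_ray_chart)) Dw.
rewrite Dr [ray_chart (x, w) 0 i]mxE !mxE/= -/r.
move: ('D_v _ w) ('D_ _ _ _) => d1 d2 ->.
have rn := lt0r_neq0 r0.
have comb (a b p q : R) : q != 0 -> a = q^-1 * (b * (q^-1 * p) + q * a - b / q * p).
  by move=> q0; field.
exact: comb.
Qed.

(** A velocity of the hyperplane killed by the projection is radial, and no
    nonzero vector of the hyperplane's direction is. *)
Lemma ray_chart_immersion x w v : ray_dom (x, w) ->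
  'D_v (fun w' => ray_chart (x, w')) w = 0 -> v = 0.
Proof.
move=> Dw; rewrite derive_ray_chart// => /eqP; rewrite scaler_eq0 invr_eq0.
rewrite (gt_eqF (ray_norm_gt0 Dw))/= subr_eq0 => /eqP.
set c := _ / _; rewrite /ray_point scalerDr scalemxAl => h.
have [c0 v0] : - c = 0 /\ v - c *: w = 0.
  by apply: free; rewrite mulmxBl h scaleNr addrK addNr.
by move/eqP: c0; rewrite oppr_eq0 => /eqP c0; rewrite c0 scale0r subr0 in v0.
Qed.

Lemma ray_chart_param x :
  indicatrix_param D F x [set w | ray_dom (x, w)] (fun w => ray_chart (x, w)).
Proof.
split.
- exact: open_section open_ray_dom.
- exact: (smooth_row_section (row_frame _) (row_frame _) x open_ray_dom smooth_ray_chart).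
- by move=> w /ray_chart_unit.
- by move=> w Dw v; exact: ray_chart_immersion.
Qed.

End RayChart.

(** * Traceless cubic forms *)

Section LocalMaximum.
Context {R : realType} (V : normedModType R).

Lemma derive_local_max (U : set V) (u : V -> R) (z v : V) : open U -> U z ->
  (forall y, U y -> differentiable u y) -> (forall y, U y -> u y <= u z) -> 'D_v u z = 0.
Proof.
move=> oU Uz du um; pose g (t : R) := z + t *: v.
have gc : continuous g.
  by move=> t; apply: cvgD; [exact: cvg_cst|apply: cvgZr_tmp; exact: cvg_id].
have g0 : g 0 = z by rewrite /g scale0r addr0.
have /nbhs_ballP[e /= e0 eU] : \forall t \near (0 : R), U (g t).
  by apply: (gc 0); rewrite g0; exact: open_nbhs_nbhs.
have inU t : t \in `]-e, e[ -> U (g t).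
  rewrite in_itv/= => te; apply: eU; rewrite -ball_normE/= sub0r normrN ltr_norml.
  exact: te.
have ld t : t \in `]-e, e[ -> is_derive t 1 (fun t => u (g t)) ('D_v u (g t)).
  by move=> /inU Ut; apply: is_derive_line; exact: du.
have e00 : 0 \in `]-e, e[ by rewrite in_itv/= oppr_lt0 e0.
have := derive1_at_max (f := fun t => u (g t)) _ _ e00.
have d1 := ld 0 e00; rewrite g0 in d1.
move=> H; rewrite -(derive_val (is_derive := d1)).
apply: derive_val; apply: H => [|t te|t te].
- by apply: le_trans (ltW e0); rewrite oppr_le0; exact: ltW.
- by have [] := ld t te.
- by rewrite g0; apply: um; exact: inU.
Qed.

End LocalMaximum.

Section Apolar.
Context {R : realType} (n : nat).
Variables (V : set 'rV[R]_n) (f g : 'I_n.+1 -> 'rV[R]_n -> R).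
Hypotheses (oV : open V) (sf : forall a, smooth_on V (f a)) (sg : forall a, smooth_on V (g a)).
Local Notation G := (dual_metric f g).
Hypothesis fg1 : forall w, V w -> \sum_a f a w * g a w = 1.
Hypothesis dfg0 : forall w i, V w -> \sum_a partial_der i (f a) w * g a w = 0.
Hypothesis symG : forall w, V w -> (G w)^T = G w.
Hypothesis unitG : forall w, V w -> G w \in unitmx.

(** Contracting Gauss' equation twice gives the scalar curvature, which exceeds
    that of the unit sphere by the squared norm of a traceless cubic form. *)
Lemma apolar_curvature (C : R) w : (1 < n)%N -> V w -> G w = 1%:M ->
  (forall i, \sum_l dual_cubic f g i l w 0 l = 0) -> const_curvature V G C -> 1 <= C.
Proof.
move=> n2 Vw G1 tr0 cc; pose K i j := dual_cubic f g i j w.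
pose s : R := \sum_(i < n) \sum_(j < n) (1 - (i == j)%:R).
pose q : R := \sum_(i < n) \sum_(j < n) (K j i *m (K j i)^T) 0 0.
have Tq u v : bilin (invmx (G w)) u v = (u *m v^T) 0 0.
  by rewrite G1 invmx1 /bilin mulmx1.
have trK : \sum_i K i i = 0.
  apply/rowP => l; rewrite summxE [RHS]mxE -[RHS](tr0 l); apply: eq_bigr => i _.
  rewrite /K (cubic_rot oV sf sg symG i i l Vw) .
  by rewrite (cubic_sym oV sf sg i l Vw).
have E i j : C * (1 - (i == j)%:R) = 1 - (i == j)%:R
    - (K i i *m (K j j)^T) 0 0 + (K j i *m (K j i)^T) 0 0.
  have := dual_curvature oV sf sg fg1 dfg0 symG unitG i j i j Vw.
  rewrite (cc w Vw i j i j) !Tq (cubic_sym oV sf sg i j Vw) -!/(K _ _) G1 !mxE !eqxx mulr1.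
  by rewrite (eq_sym j i); case: (i == j); rewrite ?mulr1n ?mulr0n ?mulr1 ?mulr0.
have Cs : C * s = s + q.
  rewrite {1}/s mulr_sumr; under eq_bigr do rewrite mulr_sumr.
  under eq_bigr do under eq_bigr do rewrite E.
  have z0 : \sum_(i < n) \sum_(j < n) (K i i *m (K j j)^T) 0 0 = 0.
    under eq_bigr => i _.
      rewrite -summxE -mulmx_sumr -(raddf_sum (@trmx R 1 n)) trK.
      over.
    by rewrite -summxE -mulmx_suml trK mul0mx mxE.
  transitivity (s - 0 + q); last by rewrite subr0.
  rewrite -[X in s - X]z0 /s /q -sumrB -big_split/=; apply: eq_bigr => i _.
  by rewrite -sumrB -big_split/=.
have t0 (i j : 'I_n) : 0 <= 1 - (i == j)%:R :> R.
  by case: (i == j); rewrite ?subrr// subr0 ler01.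
have s0 : 0 < s.
  have n0 : (0 < n)%N by exact: ltnW.
  rewrite /s (bigD1 (Ordinal n0))//= (bigD1 (Ordinal n2))//=.
  rewrite subr0 -addrA ltr_pwDl ?ltr01// addr_ge0// sumr_ge0// => i _.
  by rewrite sumr_ge0.
have q0 : 0 <= q by rewrite sumr_ge0// => i _; rewrite sumr_ge0// => j _; exact: dot_ge0.
by rewrite -(ler_pM2r s0) mul1r Cs lerDl.
Qed.

End Apolar.

Section CubicForm.
Context {R : realType} (n : nat).
Local Notation W := 'rV[R]_n.+1.
Variables (U : set W) (h : W -> R).
Hypotheses (oU : open U) (sh : smooth_on U h).
Hypothesis coneU : forall y (l : R), 0 < l -> U y -> U (l *: y).
Hypothesis homh : forall y (l : R), 0 < l -> U y -> h (l *: y) = l * h y.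

Let g a b y := norm_hessian h y a b.

Lemma hessian_entry_sym a b y : U y -> g a b y = g b a y.
Proof. by move=> Uy; rewrite /g -[in LHS](hessian_sym oU sh Uy) mxE. Qed.

(** The derivative of [hessian_momentum]: the Cartan tensor vanishes on [y]. *)
Lemma hessian_derive_self y v j : U y -> \sum_i y 0 i * 'D_v (g i j) y = 0.
Proof.
move=> Uy; have dg i : differentiable (g i j) y.
  exact: smooth_differentiable (smooth_hessian oU sh i j) Uy.
have dc i : differentiable (fun y : W => y 0 i) y.
  apply: differentiable_linear; first by move=> k u u'; rewrite !mxE.
  exact: coord_continuous.
have dcE i : 'D_v (fun y : W => y 0 i) y = v 0 i.
  apply: derive_linear; first by move=> k u u'; rewrite !mxE.
  exact: coord_continuous.
have e : 'D_v (fun y : W => \sum_i y 0 i * g i j y) y = 'D_v (momentum h j) y.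
  apply: near_eq_derive; apply: filterS (open_nbhs_nbhs (conj oU Uy)) => z Uz.
  exact: (hessian_momentum oU sh coneU homh).
rewrite derive_sum_fun in e; last by move=> i; apply: differentiableM.
have dm : differentiable (momentum h j) y.
  exact: smooth_differentiable (smooth_momentum oU sh j) Uy.
rewrite (derive_row _ dm) in e.
have e1 : \sum_i 'D_v (fun y : W => y 0 i * g i j y) y =
    \sum_i (v 0 i * g i j y + y 0 i * 'D_v (g i j) y).
  by apply: eq_bigr => i _; rewrite deriveM_fun// dcE.
rewrite e1 big_split/= in e.
have e2 : \sum_a v 0 a * partial_der a (momentum h j) y = \sum_i v 0 i * g i j y.
  by apply: eq_bigr => a _; rewrite (partial_momentum oU sh a j Uy).
by apply: (addrI (\sum_i v 0 i * g i j y)); rewrite addr0 e.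
Qed.

Lemma derive_norm_hessian y v : U y -> h y * 'D_v h y = bilin (norm_hessian h y) y v.
Proof.
move=> Uy; have dh := smooth_differentiable sh Uy.
have ds : differentiable (fun y => h y ^+ 2) y := smooth_differentiable (smooth_sqr oU sh) Uy.
have e : 'D_v (fun y => h y ^+ 2) y = h y * 'D_v h y + h y * 'D_v h y.
  have -> : (fun y => h y ^+ 2) = (fun y => h y * h y) by apply/funext => z; rewrite expr2.
  by rewrite deriveM_fun// [X in X + _]mulrC.
have -> : bilin (norm_hessian h y) y v = \sum_j v 0 j * momentum h j y.
  rewrite bilinE exchange_big/=; apply: eq_bigr => j _.
  by rewrite -mulr_suml (hessian_momentum oU sh coneU homh)// mulrC.
transitivity (2^-1 * 'D_v (fun y => h y ^+ 2) y).
  by rewrite e; move: (h y * _) => x; lra.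
rewrite (derive_row _ ds) mulr_sumr; apply: eq_bigr => j _.
by rewrite mulrCA.
Qed.

(** The determinant of the fundamental tensor being stationary means that the
    Cartan tensor is traceless. *)
Lemma stationary_apolar y v (B : 'M[R]_(n, n.+1)) : U y -> norm_hessian h y \in unitmx ->
  'D_v (fun y => \det (norm_hessian h y)) y = 0 ->
  invmx (norm_hessian h y) = y^T *m y + B^T *m B ->
  \sum_a \sum_b 'D_v (g a b) y * (B^T *m B) a b = 0.
Proof.
move=> Uy ug; rewrite derive_det => [|i j]; last first.
  exact: smooth_differentiable (smooth_hessian oU sh i j) Uy.
move=> J inv.
have BE : B^T *m B = invmx (norm_hessian h y) - y^T *m y by rewrite inv addrC addKr.
have yE a b : (y^T *m y) a b = y 0 a * y 0 b.
  by rewrite mxE big_ord1 mxE.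
have invE a b : invmx (norm_hessian h y) b a = (\det (norm_hessian h y))^-1 * cofactor (norm_hessian h y) a b.
  by rewrite /invmx ug !mxE.
transitivity (\sum_a \sum_b 'D_v (g a b) y * invmx (norm_hessian h y) b a -
   \sum_a \sum_b 'D_v (g a b) y * (y 0 a * y 0 b)).
  rewrite -sumrB; apply: eq_bigr => a _; rewrite -sumrB; apply: eq_bigr => b _.
  rewrite BE -mulrBr; congr (_ * _).
  have -> : invmx (norm_hessian h y) b a = invmx (norm_hessian h y) a b.
    by rewrite -[in LHS](hessian_sym oU sh Uy) -trmx_inv mxE.
  by rewrite -yE; move: (y^T *m y) (invmx _) => X Y; rewrite !mxE.
have -> : \sum_a \sum_b 'D_v (g a b) y * (y 0 a * y 0 b) = 0.
  rewrite exchange_big/= big1// => b _.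
  transitivity (y 0 b * \sum_a y 0 a * 'D_v (g a b) y).
    rewrite mulr_sumr; apply: eq_bigr => a _.
    by move: ('D_v _ _) (y 0 a) (y 0 b) => x1 x2 x3; ring.
  by rewrite hessian_derive_self// mulr0.
rewrite subr0.
transitivity ((\det (norm_hessian h y))^-1 * 
  \sum_i \sum_j 'D_v (fun y => norm_hessian h y i j) y * cofactor (norm_hessian h y) i j).
  rewrite mulr_sumr; apply: eq_bigr => a _; rewrite mulr_sumr; apply: eq_bigr => b _.
  by rewrite invE mulrCA.
by rewrite J mulr0.
Qed.

Variables (V : set 'rV[R]_n) (phi : 'rV[R]_n -> W).
Hypotheses (oV : open V) (sphi : smooth_on V phi).
Hypothesis phiU : forall w, V w -> U (phi w).

Let f a w := phi w 0 a.
Let m a w := momentum h a (phi w).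

(** Half the derivative of the fundamental tensor, that is the Cartan tensor,
    evaluated on tangent vectors of the indicatrix: the terms with second
    derivatives of [phi] cancel. *)
Lemma sphere_cubic i j l w : V w -> dual_cubic f m i j w 0 l =
  2^-1 * \sum_a \sum_b 'D_(partial_der i phi w) (g a b) (phi w) *
    (partial_der l (f a) w * partial_der j (f b) w).
Proof.
move=> Vw; have dphi := smooth_differentiable sphi Vw.
have sf a : smooth_on V (f a) by exact: smooth_row_coord.
have sg a b := smooth_hessian oU sh a b.
have dg a b : differentiable (g a b) (phi w).
  exact: smooth_differentiable (sg a b) (phiU Vw).
have dm a k z : V z -> partial_der k (m a) z = \sum_b partial_der k (f b) z * g b a (phi z).
  move=> Vz; rewrite /m (partial_comp sphi phiU k (smooth_momentum oU sh a) Vz).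
  by apply: eq_bigr => b _; rewrite (partial_momentum oU sh b a (phiU Vz)).
have dgphi a b : partial_der i (fun z => g a b (phi z)) w = 'D_(partial_der i phi w) (g a b) (phi w).
  exact: derive_comp (dg a b).
have dpf k b : differentiable (partial_der k (f b)) w.
  by apply: (smooth_differentiable _ Vw); exact: smooth_der.
have dgp a b : differentiable (fun z => g a b (phi z)) w.
  exact: differentiable_comp (dg a b).
have ddm a : partial_der i (partial_der j (m a)) w =
    \sum_b (partial_der i (partial_der j (f b)) w * g b a (phi w) +
      partial_der j (f b) w * 'D_(partial_der i phi w) (g b a) (phi w)).
  rewrite (near_partial_der (g := fun z => \sum_b partial_der j (f b) z * g b a (phi z)) i oV Vw);
    last by move=> z; exact: dm.
  rewrite /partial_der derive_sum_fun => [|b]; last by apply: differentiableM; [exact: dpf|exact: dgp].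
  apply: eq_bigr => b _; rewrite -[X in _ = _ + _ * X](dgphi b a).
  exact: (deriveM_fun (delta_mx 0 i) (dpf j b) (dgp b a)).
rewrite cubicE; congr (_ * _).
have -> : dual_b f m l i j w =
    \sum_a \sum_b partial_der i (partial_der j (f b)) w * (partial_der l (f a) w * g b a (phi w)) +
    \sum_a \sum_b 'D_(partial_der i phi w) (g a b) (phi w) *
      (partial_der l (f a) w * partial_der j (f b) w).
  rewrite dual_b.unlock -big_split/=; apply: eq_bigr => a _.
  rewrite ddm mulr_sumr -big_split/=; apply: eq_bigr => b _.
  have -> : 'D_(partial_der i phi w) (g b a) (phi w) = 'D_(partial_der i phi w) (g a b) (phi w).
    apply: near_eq_derive; apply: filterS (open_nbhs_nbhs (conj oU (phiU Vw))) => z Uz.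
    exact: hessian_entry_sym.
  move: ('D_(partial_der i phi w) _ _) (partial_der i _ w) (partial_der l _ w) (partial_der j _ w).
  by move=> x1 x2 x3 x4; ring.
have -> : dual_a f m l i j w =
    \sum_a \sum_b partial_der i (partial_der j (f b)) w * (partial_der l (f a) w * g b a (phi w)).
  rewrite dual_a.unlock exchange_big/=; apply: eq_bigr => a _.
  rewrite dm// mulr_sumr; apply: eq_bigr => b _.
  by rewrite (hessian_entry_sym a b (phiU Vw)).
by rewrite addrAC subrr add0r.
Qed.

End CubicForm.

(** * Curvature of a complete indicatrix *)

Section FrameChart.
Context {R : realType} (n : nat).
Local Notation W := 'rV[R]_n.+1.
Variables (M : set W) (D : set (W * W)) (F : W * W -> R).
Hypothesis hF : finsler_space M D F.
Variables (x y0 : W) (B : 'M[R]_(n, n.+1)).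
Let g := fundamental_tensor F x.
Hypotheses (Dy0 : D (x, y0)) (F1 : F (x, y0) = 1).
Hypotheses (By0 : B *m g y0 *m y0^T = 0) (BB : B *m g y0 *m B^T = 1%:M).

Let pg : posdef (g y0) := finsler_posdef hF Dy0.
Let symg : (g y0)^T = g y0 := proj1 pg.

Lemma bilin_y0B v : bilin (g y0) y0 (v *m B) = 0.
Proof.
rewrite bilin_sym// /bilin.
by rewrite -!mulmxA (mulmxA B) By0 mulmx0 mxE.
Qed.

Lemma frame_free (c : R) (v : 'rV[R]_n) : c *: y0 + v *m B = 0 -> c = 0 /\ v = 0.
Proof.
move=> h; have v0 : v = 0.
  have yB : y0 *m g y0 *m B^T = 0.
    by apply: trmx_inj; rewrite !trmx_mul trmxK symg mulmxA By0 trmx0.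
  have := congr1 (fun u : W => u *m g y0 *m B^T) h.
  have e : v *m B *m g y0 *m B^T = v by rewrite -!mulmxA (mulmxA B) BB mulmx1.
  by rewrite /= !mulmxDl !mul0mx -!scalemxAl yB scaler0 add0r e.
split => //; move: h; rewrite v0 mul0mx addr0 => /eqP; rewrite scaler_eq0.
case/orP => [/eqP//|/eqP y00]; have [_ Dn] := finsler_domain_sub hF Dy0.
by rewrite y00 eqxx in Dn.
Qed.

Local Notation phi := (fun w => ray_chart F y0 B (x, w)).

Lemma ray_point0 : ray_point y0 B 0 = y0.
Proof. by rewrite /ray_point mul0mx addr0. Qed.

Lemma ray_dom0 : ray_dom D y0 B (x, 0).
Proof. by rewrite /ray_dom/= ray_point0. Qed.

Lemma ray_chart0 : phi 0 = y0.
Proof. by rewrite /ray_chart/= ray_point0 F1 invr1 scale1r. Qed.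

(** At the centre the norm is stationary along the hyperplane, which is
    orthogonal to [y0]. *)
Lemma derive_ray_chart0 v : 'D_v phi 0 = v *m B.
Proof.
rewrite (derive_ray_chart hF v ray_dom0) ray_point0 F1 invr1 scale1r.
have -> : 'D_(v *m B) (fun y => F (x, y)) y0 = 0.
  have := derive_norm_hessian (open_section x (finsler_domain_open hF)) (smooth_norm hF x)
    (fun y l l0 => finsler_domain_conic hF l0) (fun y l l0 => finsler_hom hF l0) (v *m B) Dy0.
  by rewrite F1 mul1r => ->; exact: bilin_y0B.
by rewrite mul0r scale0r subr0.
Qed.

End FrameChart.

Section SlitSpace.
Context {R : realType} (n : nat).
Local Notation W := 'rV[R]_n.+1.
Variables (M : set W) (F : W * W -> R).
Local Notation D := (slit_tangent M).
Hypothesis hF : finsler_space M D F.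

Lemma det_tensor_max x : M x -> exists y0, y0 != 0 /\ forall y, y != 0 ->
  \det (fundamental_tensor F x y) <= \det (fundamental_tensor F x y0).
Proof.
move=> Mx; pose S : set W := [set y | `|y| = 1].
have Sn0 y : S y -> y != 0 by move=> Sy; rewrite -normr_gt0 Sy ltr01.
have SN (y : W) : y != 0 -> S (`|y|^-1 *: y).
  move=> y0; rewrite /S/= normrZ normfV normr_id mulVf// ?normr_eq0//.
have S0 : S !=set0.
  exists (`|delta_mx 0 0 : W|^-1 *: delta_mx 0 0); apply: SN.
  by apply/eqP => /matrixP/(_ 0 0); rewrite !mxE !eqxx => /eqP; rewrite oner_eq0.
have cS : compact S.
  apply: bounded_closed_compact.
    exists 1; split; first exact: num_real.
    by move=> e e1 y; rewrite /S/= => ->; exact: ltW.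
  apply: (closed_comp (f := fun y : W => `|y|) (D := [set r | r = 1])).
    by move=> y _; exact: norm_continuous.
  exact: closed_eq.
have oU := open_section x (finsler_domain_open hF).
have coneU := fun y l (l0 : 0 < l) => finsler_domain_conic hF (x := x) (y := y) l0.
have homU := fun y l (l0 : 0 < l) => finsler_hom hF (x := x) (y := y) l0.
have sg := smooth_hessian oU (smooth_norm hF x).
have cd : {within S, continuous (fun y => \det (fundamental_tensor F x y))}.
  apply: continuous_in_subspaceT => y; rewrite inE => Sy.
  by apply: (Ck_continuous (smooth_det oU sg 0%N)); split => //; exact: Sn0.
have [y0 y0S ym] := compact_EVT_max S0 cS cd.
rewrite inE in y0S; exists y0; split; first exact: Sn0.
move=> y yn0; have := ym (`|y|^-1 *: y); rewrite inE => /(_ (SN y yn0)).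
rewrite !fundamental_tensorE (hessian_hom oU (smooth_norm hF x) coneU homU)//.
by rewrite invr_gt0 normr_gt0.
Qed.

(** The determinant of the fundamental tensor is homogeneous of degree zero, so
    it attains its maximum on the slit tangent space; there the Cartan tensor is
    traceless, and the curvature of the indicatrix is at least 1. *)
Lemma slit_curvature_ge1 x C : (1 < n)%N -> M x -> indicatrix_const_curvature D F x C -> 1 <= C.
Proof.
move=> n2 Mx cc; have [y1 [y1n0 y1m]] := det_tensor_max Mx.
have oU := open_section x (finsler_domain_open hF).
have coneU := fun y l (l0 : 0 < l) => finsler_domain_conic hF (x := x) (y := y) l0.
have homU := fun y l (l0 : 0 < l) => finsler_hom hF (x := x) (y := y) l0.
have sF := smooth_norm hF x.
have sg := smooth_hessian oU sF.
have Dy1 : D (x, y1) by [].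
have r0 := finsler_pos hF Dy1.
have ri : 0 < (F (x, y1))^-1 by rewrite invr_gt0.
pose y0 := (F (x, y1))^-1 *: y1.
have Dy0 : D (x, y0) by exact: (finsler_domain_conic hF).
have F1 : F (x, y0) = 1 by rewrite (finsler_hom hF)// mulVf// lt0r_neq0.
have y0m y : y != 0 -> \det (fundamental_tensor F x y) <= \det (fundamental_tensor F x y0).
  move=> /y1m h; apply: le_trans h _.
  by rewrite !fundamental_tensorE (hessian_hom oU sF coneU homU ri Dy1).
have pg := finsler_posdef hF Dy0.
have by0 : bilin (fundamental_tensor F x y0) y0 y0 = 1.
  by rewrite fundamental_tensorE (bilin_hessian_self oU sF coneU homU Dy0) F1 expr1n.
have [B [By0 BB inv]] := orthonormal_frame pg by0.
have fr := frame_free hF Dy0 By0 BB.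
have param := ray_chart_param hF fr x.
pose V := [set w | ray_dom D y0 B (x, w)].
pose phi w := ray_chart F y0 B (x, w).
have [oV sphi ind imm] := param.
have V0 : V 0 := ray_dom0 B Dy0.
have phi0 : phi 0 = y0 := ray_chart0 B F1.
have phiU w : V w -> D (x, phi w) by move=> /ind[].
have phi1 w : V w -> F (x, phi w) = 1 by move=> /ind[].
pose f a w := phi w 0 a.
pose m a w := momentum (fun y => F (x, y)) a (phi w).
have GE w : V w -> dual_metric f m w = induced_metric F x phi w.
  move=> Vw; exact: (sphere_dual_metric oU sF sphi phiU Vw).
have pG w : V w -> posdef (dual_metric f m w).
  by move=> Vw; rewrite GE//; exact: (posdef_induced_metric hF param Vw).
have sf a : smooth_on V (f a) by exact: smooth_row_coord.
have sm a : smooth_on V (m a) by exact: (smooth_momentum_comp oU sF oV sphi phiU).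
have symG w (Vw : V w) := proj1 (pG w Vw).
have unitG w (Vw : V w) := posdef_unit (pG w Vw).
have d0 i : partial_der i phi 0 = row i B.
  by rewrite /partial_der (derive_ray_chart0 hF Dy0 F1 By0) rowE.
have G1 : dual_metric f m 0 = 1%:M.
  rewrite GE//; apply/matrixP => i j; rewrite mxE phi0 !d0.
  have <- : (B *m fundamental_tensor F x y0 *m B^T) i j = bilin (fundamental_tensor F x y0) (row i B) (row j B).
    by rewrite /bilin tr_row -row_mul [RHS]mxE mxE; apply: eq_bigr => k _; rewrite !mxE.
  by rewrite BB.
apply: (apolar_curvature oV sf sm _ _ symG unitG n2 V0 G1).
- by move=> w Vw; exact: (sphere_dual1 oU sF homU phiU phi1 Vw).
- by move=> w i Vw; exact: (sphere_dual0 oU sF oV sphi phiU phi1 i Vw).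
- move=> i.
  have st := stationary_apolar oU sF coneU homU (v := row i B) Dy0 (posdef_unit pg) _ inv.
  have max0 : 'D_(row i B) (fun y => \det (norm_hessian (fun y => F (x, y)) y)) y0 = 0.
    apply: (derive_local_max _ oU Dy0) => y Dy.
      exact: smooth_differentiable (smooth_det oU sg) Dy.
    exact: y0m Dy.2.
  have pf l a : partial_der l (f a) 0 = B l a.
    rewrite /partial_der /f derive_coord; last exact: smooth_differentiable sphi V0.
    by have := d0 l; rewrite /partial_der => ->; rewrite mxE.
  transitivity (2^-1 * \sum_a \sum_b 'D_(row i B) (fun y => norm_hessian (fun y => F (x, y)) y a b) y0 *
      (B^T *m B) a b); last by rewrite st// mulr0.
  transitivity (\sum_l 2^-1 * \sum_a \sum_b 'D_(row i B) (fun y => norm_hessian (fun y => F (x, y)) y a b) y0 *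
      (B l a * B l b)).
    apply: eq_bigr => l _; rewrite (sphere_cubic oU sF oV sphi phiU i l l V0) d0 -[ray_chart F y0 B (x, 0)]/(phi 0) phi0.
    congr (_ * _); apply: eq_bigr => a _; apply: eq_bigr => b _; rewrite !pf.
    by [].
  rewrite -mulr_sumr; congr (_ * _).
  rewrite exchange_big/=; apply: eq_bigr => a _; rewrite exchange_big/=; apply: eq_bigr => b _.
  rewrite -mulr_sumr; congr (_ * _); rewrite mxE; apply: eq_bigr => l _; by rewrite mxE.
- have cc' : const_curvature V (induced_metric F x phi) C by exact: cc.
  move=> w Vw l k i j.
  have sI : smooth_mx V (induced_metric F x phi).
    move=> p q; apply: (@eq_smooth _ _ _ oV _ (fun w => dual_metric f m w p q)).
      by move=> z Vz; rewrite GE.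
    exact: smooth_dual_metric.
  apply: (const_curvature_local oV sI _ GE cc' Vw) => z Vz.
  by rewrite -GE//; exact: unitG.
Qed.

End SlitSpace.

(** * Families of metrics on leaves *)

Section BilinearDefect.
Context {R : realType} (P : normedModType R) (fP : frame P) (n : nat).
Local Notation Z := (P * 'rV[R]_n)%type.
Variables (A : finType) (Om : 'I_n -> A -> A -> Z -> R) (p0 : P) (r : R).
Hypothesis r_gt0 : 0 < r.
Let coef a d (p : R * Z) := \sum_j p.2.2 0 j * Om j a d (leaf_sc p.1 p.2).
Hypothesis smallr : small (cyl p0 r) coef.

Lemma cyl_base p : ball p0 r p -> cyl p0 r (p, 0 : 'rV[R]_n).
Proof. by move=> pr; split => //; exact: ballxx. Qed.

(** A bilinear expression in solutions of a linear system is determined by its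
    values along [w = 0]. *)
Lemma bilinear_defect_zero (Q : A -> A -> Z -> R) :
  (forall a b, smooth_on (cyl p0 r) (Q a b)) ->
  (forall j a b z, cyl p0 r z ->
     dw j (Q a b) z = \sum_d (Om j a d z * Q d b z + Om j b d z * Q a d z)) ->
  (forall a b p, ball p0 r p -> Q a b (p, 0) = 0) ->
  forall a b z, cyl p0 r z -> Q a b z = 0.
Proof.
move=> sQ dQ Q0 a b [p w] Uz.
have st (t : R) : 0 <= t <= 1 -> cyl p0 r (leaf_sc t (p, w)).
  by move=> /andP[t0 t1]; apply: cyl_scale => //; rewrite ger0_norm.
have lin (s : R) : leaf_sc s (p, w) = (p, 0) + s *: ((0, w) : Z).
  by apply: injective_projections => /=; rewrite ?scaler0 ?addr0 ?add0r.
have difQ c e z : cyl p0 r z -> differentiable (Q c e) z.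
  by move=> Uz'; exact: smooth_differentiable (sQ c e) Uz'.
pose q (ab : A * A) (t : R) := Q ab.1 ab.2 ((p, 0) + t *: ((0, w) : Z)).
pose K (ab cd : A * A) (t : R) := (cd.2 == ab.2)%:R * coef ab.1 cd.1 (t, (p, w)) +
   (cd.1 == ab.1)%:R * coef ab.2 cd.2 (t, (p, w)).
have ders (ab : A * A) (t : R) : 0 <= t <= 1 -> is_derive t (1 : R) (q ab) (\sum_cd K ab cd t * q cd t).
  move=> t01; have Ut := st t t01; rewrite lin in Ut.
  suff -> : \sum_cd K ab cd t * q cd t = 'D_((0, w) : Z) (Q ab.1 ab.2) ((p, 0) + t *: ((0, w) : Z)).
    by apply: is_derive_line; exact: difQ.
  rewrite derive_dw//; last exact: difQ.
  under [RHS]eq_bigr do rewrite dQ// mulr_sumr.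
  rewrite [RHS]exchange_big/=.
  transitivity (\sum_d (coef ab.1 d (t, (p, w)) * q (d, ab.2) t + coef ab.2 d (t, (p, w)) * q (ab.1, d) t)).
    rewrite big_split/= -(pair_big xpredT xpredT (fun c e => K ab (c, e) t * q (c, e) t))/= /K/=.
    under eq_bigr do under eq_bigr do rewrite mulrDl.
    under eq_bigr do rewrite big_split/=.
    rewrite big_split/=; congr (_ + _).
      apply: eq_bigr => c _; rewrite (bigD1 ab.2)//= eqxx mul1r big1 ?addr0// => e /negbTE ->.
      by rewrite !mul0r.
    rewrite exchange_big/=; apply: eq_bigr => c _.
    rewrite (bigD1 ab.1)//= eqxx mul1r big1 ?addr0// => e /negbTE ->.
    by rewrite !mul0r.
  apply: eq_bigr => d _; rewrite /coef/= lin !mulr_suml -big_split/=; apply: eq_bigr => j _.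
  by rewrite /q/= mulrDr !mulrA.
have cq (ab : A * A) (t : R) : 0 <= t <= 1 -> {for t, continuous (q ab)}.
  move=> t01; have d := ders ab t t01.
  by apply: differentiable_continuous; apply/derivable1_diffP; have [] := d.
have cb c d (t : R) : 0 <= t <= 1 -> `|coef c d (t, (p, w))| <= 2^-1.
  move=> t01; apply: le_trans (smallr c t01 Uz).
  by rewrite (bigD1 d)//= lerDl sumr_ge0.
have t01 (t : R) : 0 < t < 1 -> 0 <= t <= 1 by move=> /andP[? ?]; rewrite !ltW.
have dlt (x y : A) (v : R) : `|v| <= 2^-1 -> `|(x == y)%:R * v| <= 2^-1.
  by case: (x == y) => ?; rewrite ?mul1r// mul0r normr0 invr_ge0.
have Kb (ab cd : A * A) (t : R) : 0 < t < 1 -> `|K ab cd t| <= 2^-1 + 2^-1.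
  by move=> /t01 tt; apply: le_trans (ler_normD _ _) _; apply: lerD; apply: dlt; exact: cb.
have i0 (ab : A * A) : q ab 0 = 0.
  by rewrite /q scale0r addr0; apply: Q0; case: Uz.
have t1 : (0 : R) <= 1 <= (1 : R) by rewrite ler01 lexx.
have := linear_ode_zero cq (fun ab t tt => ders ab t (t01 t tt)) Kb i0 (a, b) t1.
by rewrite /q -lin /leaf_sc/= scale1r.
Qed.

End BilinearDefect.

Section LeafMetric.
Context {R : realType} (P : normedModType R) (fP : frame P) (n : nat).
Local Notation Z := (P * 'rV[R]_n)%type.
Let fZ := prod_frame fP (row_frame (R := R) n).
Variables (O : set Z) (G : Z -> 'M[R]_n).
Hypotheses (oO : open O) (sG : smooth_mx O G) (pG : forall z, O z -> posdef (G z)).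

Definition leaf (p : P) : set 'rV[R]_n := [set w | O (p, w)].
Definition leaf_metric (p : P) (w : 'rV[R]_n) := G (p, w).

Lemma open_leaf p : open (leaf p).
Proof. exact: open_section. Qed.

Lemma leaf_partial (f : Z -> R) j p w :
  partial_der j (fun w => f (p, w)) w = dw j f (p, w).
Proof. exact: derive_pair_snd. Qed.

Lemma smooth_dw (f : Z -> R) j : smooth_on O f -> smooth_on O (dw j f).
Proof. exact: smooth_der. Qed.

Lemma smooth_leaf_metric p : smooth_mx (leaf p) (leaf_metric p).
Proof. by move=> i j; exact: (smooth_section fP (row_frame _) p oO (sG i j)). Qed.

Lemma smooth_leaf_christoffel k i j :
  smooth_on O (fun z => christoffel (leaf_metric z.1) k i j z.2).
Proof.
have uG z : O z -> G z \in unitmx by move=> /pG/posdef_unit.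
have si := smooth_invmx oO uG sG.
apply: (@eq_smooth _ _ _ oO _ (fun z => 2^-1 * \sum_l invmx (G z) k l *
  (dw i (fun z => G z j l) z + dw j (fun z => G z i l) z - dw l (fun z => G z i j) z))).
  move=> [p w] _; rewrite /christoffel/=; congr (_ * _); apply: eq_bigr => l _.
  by rewrite -!leaf_partial.
apply: (smoothM oO); first exact: smooth_cst.
apply: (smooth_sum oO) => l _; apply: (smoothM oO); first exact: si.
by apply: (smoothB oO); [apply: (smoothD oO)|]; apply: smooth_dw; exact: sG.
Qed.

Lemma smooth_leaf_riemann l k i j :
  smooth_on O (fun z => riemann (leaf_metric z.1) l k i j z.2).
Proof.
pose chr k i j (z : Z) := christoffel (leaf_metric z.1) k i j z.2.
have sc := smooth_leaf_christoffel.
apply: (@eq_smooth _ _ _ oO _ (fun z => dw i (chr l j k) z - dw j (chr l i k) z +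
  \sum_p (chr l i p z * chr p j k z - chr l j p z * chr p i k z))).
  by move=> [p w] _; rewrite /riemann/= -!leaf_partial.
apply: (smoothD oO); first by apply: (smoothB oO); apply: smooth_dw; exact: sc.
apply: (smooth_sum oO) => p _.
by apply: (smoothB oO); apply: (smoothM oO); exact: sc.
Qed.

Lemma bilin_delta (B : 'M[R]_n) a b : bilin B (delta_mx 0 a) (delta_mx 0 b) = B a b.
Proof.
rewrite /bilin -rowE mxE (bigD1 b)//= !mxE !eqxx mulr1 big1 ?addr0// => k kb.
by rewrite !mxE eqxx (negbTE kb) mulr0.
Qed.

(** The 2 by 2 minor is, up to the factor [B j j], the value of [B] on the vector [v] below. *)
Lemma posdef_minor (B : 'M[R]_n) i j : posdef B -> i != j ->
  B i i * B j j - B i j * B j i != 0.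
Proof.
move=> [sB pB] ij.
have dd := bilin_delta B.
have Bji : B j i = B i j by rewrite -[in LHS]sB mxE.
have d0 (a : 'I_n) : delta_mx 0 a != 0 :> 'rV[R]_n.
  by apply/eqP => /rowP/(_ a); rewrite !mxE !eqxx => /eqP; rewrite oner_eq0.
have Bjj : 0 < B j j by rewrite -dd; exact: pB.
pose v := B j j *: (delta_mx 0 i : 'rV[R]_n) + (- B i j) *: delta_mx 0 j.
have v0 : v != 0.
  apply/eqP => /rowP/(_ i); rewrite !mxE !eqxx (negbTE ij) mulr0 addr0 mulr1 => h.
  by rewrite h ltxx in Bjj.
have := pB v v0; rewrite /v !bilinDl !bilinDr !bilinZl !bilinZr !dd Bji.
apply: contraTneq => h.
rewrite (_ : _ + _ = B j j * (B i i * B j j - B i j * B i j)); first by rewrite h mulr0 ltxx.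
ring.
Qed.

(** The curvature of the leaves is a quotient of a component of the curvature
    tensor by a minor of the metric. *)
Lemma smooth_leaf_curvature (C : P -> R) : (1 < n)%N ->
  (forall p, const_curvature (leaf p) (leaf_metric p) (C p)) ->
  smooth_on O (fun z => C z.1).
Proof.
move=> n2 cc; pose i : 'I_n := Ordinal (ltnW n2); pose j : 'I_n := Ordinal n2.
have minor z : O z -> G z i i * G z j j - G z i j * G z j i != 0.
  by move=> Oz; apply: posdef_minor => //; exact: pG.
apply: (@eq_smooth _ _ _ oO _ (fun z => (\sum_m G z i m * riemann (leaf_metric z.1) m j i j z.2) /
  (G z i i * G z j j - G z i j * G z j i))).
  move=> [p w] Oz; have := cc p w Oz i j i j; rewrite /leaf_metric/= => ->.
  by rewrite mulfK//; exact: minor.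
apply: (smoothM oO).
  by apply: (smooth_sum oO) => m _; apply: (smoothM oO); [exact: sG|exact: smooth_leaf_riemann].
by apply: (smoothV oO) => //; apply: (smoothB oO); apply: (smoothM oO); exact: sG.
Qed.

End LeafMetric.

(** * Development into the unit sphere *)

Section Development.
Context {R : realType} (P : normedModType R) (fP : frame P) (n : nat).
Local Notation Z := (P * 'rV[R]_n)%type.
Let fZ := prod_frame fP (row_frame (R := R) n).
Variables (O : set Z) (G : Z -> 'M[R]_n) (C : P -> R) (p0 : P).
Hypotheses (oO : open O) (O0 : O (p0, 0)) (sG : smooth_mx O G).
Hypothesis pG : forall z, O z -> posdef (G z).
Hypotheses (sC : smooth_on O (fun z => C z.1)) (C_gt0 : forall z, O z -> 0 < C z.1).
Hypothesis cc : forall p, const_curvature (leaf O p) (leaf_metric G p) (C p).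

Let Om j a d (z : Z) := sphere_system (leaf_metric G z.1) (C z.1) j a d z.2.

Let symG p w : leaf O p w -> (leaf_metric G p w)^T = leaf_metric G p w.
Proof. by move=> Ow; have [] := pG Ow. Qed.

Let unitG p w : leaf O p w -> leaf_metric G p w \in unitmx.
Proof. by move=> Ow; exact: posdef_unit (pG Ow). Qed.

Lemma smooth_sphere_system j a d : smooth_on O (Om j a d).
Proof.
rewrite /Om; case: (unliftP ord0 a) => [i ->|->]; case: (unliftP ord0 d) => [k ->|->].
- apply: (@eq_smooth _ _ _ oO _ (fun z => christoffel (leaf_metric G z.1) k i j z.2)).
    by move=> z _; rewrite sphere_systemll.
  exact: smooth_leaf_christoffel.
- apply: (@eq_smooth _ _ _ oO _ (fun z => - C z.1 * G z i j)).
    by move=> [p w] _; rewrite sphere_systeml0.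
  by apply: (smoothM oO); [exact: smoothN|exact: sG].
- apply: (@eq_smooth _ _ _ oO _ (fun=> (k == j)%:R : R)); last exact: smooth_cst.
  by move=> z _; rewrite sphere_system0l.
- apply: (@eq_smooth _ _ _ oO _ (fun=> 0 : R)); last exact: smooth_cst.
  by move=> z _; rewrite sphere_system00.
Qed.

Lemma sphere_system_leaf_flat i j a e z : O z ->
  dw i (Om j a e) z - dw j (Om i a e) z
  + \sum_d (Om j a d z * Om i d e z - Om i a d z * Om j d e z) = 0.
Proof.
case: z => p w Oz; rewrite -!leaf_partial.
have := sphere_system_flat (@open_leaf _ _ _ _ oO p) (@smooth_leaf_metric _ _ fP _ _ _ oO sG p)
  (@symG p) (@unitG p) (@cc p) i j a e Oz.
by rewrite /Om/=.
Qed.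

(** The Gram matrix of the position vector and the tangent vectors of the
    unit sphere carrying [C] times the metric. *)
Definition sphere_gram (a b : 'I_n.+1) (z : Z) : R :=
  match unlift ord0 a, unlift ord0 b with
  | None, None => 1
  | Some i, Some k => C z.1 * G z i k
  | _, _ => 0
  end.

Lemma sphere_gram00 z : sphere_gram ord0 ord0 z = 1.
Proof. by rewrite /sphere_gram unlift_none. Qed.

Lemma sphere_gram0l i z : sphere_gram ord0 (lift ord0 i) z = 0.
Proof. by rewrite /sphere_gram unlift_none liftK. Qed.

Lemma sphere_graml0 i z : sphere_gram (lift ord0 i) ord0 z = 0.
Proof. by rewrite /sphere_gram unlift_none liftK. Qed.

Lemma sphere_gramll i k z : sphere_gram (lift ord0 i) (lift ord0 k) z = C z.1 * G z i k.
Proof. by rewrite /sphere_gram !liftK. Qed.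

Let gramE := (sphere_gram00, sphere_gram0l, sphere_graml0, sphere_gramll).

Lemma smooth_sphere_gram a b : smooth_on O (sphere_gram a b).
Proof.
case: (unliftP ord0 a) => [i ->|->]; case: (unliftP ord0 b) => [k ->|->].
- apply: (@eq_smooth _ _ _ oO _ (fun z => C z.1 * G z i k)).
    by move=> z _; rewrite gramE.
  by apply: (smoothM oO) => //; exact: sG.
- by apply: (@eq_smooth _ _ _ oO _ (fun=> 0 : R)); [move=> z _; rewrite gramE|exact: smooth_cst].
- by apply: (@eq_smooth _ _ _ oO _ (fun=> 0 : R)); [move=> z _; rewrite gramE|exact: smooth_cst].
- by apply: (@eq_smooth _ _ _ oO _ (fun=> 1 : R)); [move=> z _; rewrite gramE|exact: smooth_cst].
Qed.

(** The Gram matrix solves the system of scalar products of solutions because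
    the Levi-Civita connection is metric. *)
Lemma dw_sphere_gram j a b z : O z -> dw j (sphere_gram a b) z =
  \sum_d (Om j a d z * sphere_gram d b z + Om j b d z * sphere_gram a d z).
Proof.
case: z => p w Oz; rewrite -leaf_partial big_ord_recl /Om/=.
have oL := @open_leaf _ _ _ _ oO p; have sL := @smooth_leaf_metric _ _ fP _ _ _ oO sG p.
have cst0 (c : R) : partial_der j (fun=> c) w = 0 by exact: derive_cst.
have deltaS (f : 'I_n -> R) q : \sum_(d < n) (d == q)%:R * f d = f q.
  by rewrite (bigD1 q)//= eqxx mul1r big1 ?addr0// => d /negbTE ->; rewrite mul0r.
case: (unliftP ord0 a) => [i ->|->]; case: (unliftP ord0 b) => [k ->|->].
- under [in RHS]eq_bigr do rewrite !sphere_systemll !gramE.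
  rewrite !sphere_systemE !gramE !mulr0 !add0r.
  under [in LHS]eq_fun do rewrite gramE/=.
  transitivity (C p * partial_der j (fun w => leaf_metric G p w i k) w).
    by apply: deriveZ_fun; exact: smooth_differentiable (sL i k) Oz.
  rewrite (partial_metric oL (@symG p) j i k Oz).
  rewrite -(sum_metric_christoffel (@unitG p) i j k Oz) -(sum_metric_christoffel (@unitG p) k j i Oz).
  rewrite -big_split/= mulr_sumr; apply: eq_bigr => d _.
  rewrite (christoffel_sym oL (@symG p) d j i Oz) (christoffel_sym oL (@symG p) d j k Oz).
  rewrite (metric_entry_sym (@symG p) k d Oz) /leaf_metric.
  move: (christoffel _ d i j w) (christoffel _ d k j w) => x1 x2; ring.
- under [in RHS]eq_bigr do rewrite !sphere_systemll !sphere_system0l !gramE mulr0 add0r.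
  rewrite deltaS !sphere_systemE !gramE/=.
  under [in LHS]eq_fun do rewrite gramE/=.
  by rewrite cst0 /leaf_metric; ring.
- under [in RHS]eq_bigr do rewrite !sphere_systemll !sphere_system0l !gramE mulr0 addr0.
  rewrite deltaS !sphere_systemE !gramE/=.
  under [in LHS]eq_fun do rewrite gramE/=.
  by rewrite cst0 /leaf_metric (metric_entry_sym (@symG p) j k Oz) /leaf_metric; ring.
- under [in RHS]eq_bigr do rewrite !sphere_system0l !gramE !mulr0 addr0.
  rewrite !sphere_systemE !gramE/= big1//.
  under [in LHS]eq_fun do rewrite gramE/=.
  by rewrite cst0; ring.
Qed.

(** The solutions with orthonormal initial values: their Gram matrix solves the
    same system as [sphere_gram], with the same initial values. *)
Lemma development_system : exists (r : R) (X : 'I_n.+1 -> 'I_n.+1 -> Z -> R),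
  [/\ 0 < r, cyl p0 r `<=` O, forall al a, smooth_on (cyl p0 r) (X al a),
      forall al j z, cyl p0 r z -> dw j (X al ord0) z = X al (lift ord0 j) z &
      forall a b z, cyl p0 r z -> \sum_al X al a z * X al b z = sphere_gram a b z].
Proof.
have [r [r0 _ rO smallr]] := small_cylinder oO O0 smooth_sphere_system ltr01.
have rsub : (cyl p0 r : set Z) `<=` cyl p0 (2 * r).
  by move=> z [z1 z2]; split; [apply: le_ball z1|apply: le_ball z2]; lra.
have rO' : (cyl p0 r : set Z) `<=` O by move=> z /rsub/rO.
have bO p : ball p0 r p -> O (p, 0) by move=> pr; apply: rO'; exact: cyl_base.
(* initial values: an orthonormal frame for [C] times the metric at [w = 0] *)
pose B0 := [set p | O (p, 0 : 'rV[R]_n)].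
have sp U : open U -> smooth_on U (fun p : P => (p, 0 : 'rV[R]_n)).
  by move=> oU; apply: (smooth_pair oU); [move=> k; exact: Ck_id|exact: smooth_cst].
have oB0 : open B0.
  by apply: (open_comp (f := fun p : P => (p, 0 : 'rV[R]_n))) oO => p _; exact: (sp setT openT 0%N).
have [Lc [sLc LcE]] : exists L : P -> 'M[R]_n, smooth_mx B0 L /\
    forall p, B0 p -> (L p)^T *m L p = C p *: G (p, 0).
  apply: smooth_cholesky => // [i j|p Op]; last first.
    have [sg pg] := pG Op; have c0 := C_gt0 Op; split; first by rewrite linearZ/= sg.
    by move=> v v0; rewrite bilin_scale mulr_gt0// pg.
  apply: (@eq_smooth _ _ _ oB0 _ (fun p => sphere_gram (lift ord0 i) (lift ord0 j) (p, 0))).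
    by move=> p _; rewrite gramE mxE.
  by apply: (smooth_comp oB0 fZ (sp _ oB0) (smooth_sphere_gram _ _)).
pose L (al a : 'I_n.+1) (p : P) : R := match unlift ord0 al, unlift ord0 a with
  | None, None => 1 | Some i, Some k => Lc p i k | _, _ => 0 end.
have sL al a : smooth_on (ball p0 r) (L al a).
  have ob : open (ball p0 r) by exact: ball_open.
  rewrite /L; case: (unlift ord0 al) => [i|]; case: (unlift ord0 a) => [k|]; try exact: smooth_cst.
  by apply: smooth_subset (sLc i k) => p /bO.
have LL a b p : ball p0 r p -> \sum_al L al a p * L al b p = sphere_gram a b (p, 0).
  move=> pr; rewrite big_ord_recl /L unlift_none.
  under eq_bigr do rewrite liftK.
  case: (unliftP ord0 a) => [i ->|->]; case: (unliftP ord0 b) => [k ->|->];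
    rewrite ?liftK ?unlift_none gramE/=.
  - rewrite mul0r add0r; have := congr1 (fun M : 'M[R]_n => M i k) (LcE p (bO p pr)).
    by rewrite !mxE => <-; apply: eq_bigr => al _; rewrite mxE.
  - by rewrite mul0r big1 ?addr0// => al _; rewrite mulr0.
  - by rewrite mulr0 big1 ?addr0// => al _; rewrite mul0r.
  - by rewrite mul1r big1 ?addr0// => al _; rewrite mul0r.
have /choice[X XP] : forall al, exists X : 'I_n.+1 -> Z -> R,
    [/\ forall a, smooth_on (cyl p0 r) (X a),
        forall a p, ball p0 r p -> X a (p, 0) = L al a p &
        forall j a z, cyl p0 r z -> dw j (X a) z = \sum_d Om j a d z * X d z].
  by move=> al; exact: (total_system_solution fP smooth_sphere_system sphere_system_leaf_flat r0 rO smallr (sL al)).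
have oU : open (cyl p0 r : set Z) by exact: open_cyl.
have sX al a : smooth_on (cyl p0 r) (X al a) by have [] := XP al.
have dX al a z : cyl p0 r z -> differentiable (X al a) z.
  by move=> Uz; exact: smooth_differentiable (sX al a) Uz.
have dwX al j a z : cyl p0 r z -> dw j (X al a) z = \sum_d Om j a d z * X al d z.
  by have [_ _ h] := XP al; exact: h.
exists r, X; split => // [al j z Uz|a b z Uz].
  rewrite dwX// big_ord_recl /Om sphere_system00 mul0r add0r.
  under eq_bigr do rewrite sphere_system0l.
  by rewrite (bigD1 j)//= eqxx mul1r big1 ?addr0// => d /negbTE ->; rewrite mul0r.
pose Q a b z := \sum_al X al a z * X al b z - sphere_gram a b z.
suff /eqP : Q a b z = 0 by rewrite subr_eq0 => /eqP.
have sS c d : smooth_on (cyl p0 r) (fun z => \sum_al X al c z * X al d z).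
  by apply: (smooth_sum oU) => al _; apply: (smoothM oU); exact: sX.
have sgr c d : smooth_on (cyl p0 r) (sphere_gram c d).
  exact: smooth_subset (smooth_sphere_gram c d).
apply: (bilinear_defect_zero fP (p0 := p0) (Om := Om) smallr (Q := Q)) => // {a b z Uz}[a b|j a b z Uz|a b p pr].
- exact: (smoothB oU).
- transitivity (dw j (fun z => \sum_al X al a z * X al b z) z - dw j (sphere_gram a b) z).
    apply: deriveB_fun; first exact: smooth_differentiable (sS a b) Uz.
    exact: smooth_differentiable (sgr a b) Uz.
  rewrite (dw_sphere_gram j a b (rO' _ Uz)).
  have -> : dw j (fun z => \sum_al X al a z * X al b z) z =
     \sum_al (dw j (X al a) z * X al b z + X al a z * dw j (X al b) z).
    rewrite /dw derive_sum_fun => [|al]; last by apply: differentiableM; exact: dX.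
    by apply: eq_bigr => al _; apply: deriveM_fun; exact: dX.
  under eq_bigr do rewrite !dwX// mulr_suml mulr_sumr -big_split/=.
  rewrite exchange_big/= -sumrB; apply: eq_bigr => d _.
  rewrite /Q !mulrBr !mulr_sumr.
  have -> : \sum_i (Om j a d z * X i d z * X i b z + X i a z * (Om j b d z * X i d z)) =
     \sum_i Om j a d z * (X i d z * X i b z) + \sum_i Om j b d z * (X i a z * X i d z).
    by rewrite -big_split/=; apply: eq_bigr => i _; ring.
  move: (\sum_i _) (\sum_i _) (Om j a d z * sphere_gram _ _ _) (Om j b d z * sphere_gram _ _ _).
  by move=> x1 x2 x3 x4; ring.
- rewrite /Q -LL//; apply/eqP; rewrite subr_eq0; apply/eqP; apply: eq_bigr => al _.
  by have [_ h _] := XP al; rewrite !h.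
Qed.

Lemma bilin1E m (u v : 'rV[R]_m) : bilin 1%:M u v = \sum_a u 0 a * v 0 a.
Proof. by rewrite /bilin mulmx1 mxE; apply: eq_bigr => a _; rewrite mxE. Qed.

(** Simply connected leaves of constant curvature [C] develop isometrically, up
    to the factor [C], into the unit sphere, smoothly in the parameter. *)
Lemma parametric_development : exists (r : R) (Psi : Z -> 'rV[R]_n.+1),
  [/\ 0 < r, cyl p0 r `<=` O, smooth_on (cyl p0 r) Psi,
      (forall z, cyl p0 r z -> bilin 1%:M (Psi z) (Psi z) = 1) /\
      (forall z v v', cyl p0 r z ->
        bilin 1%:M (Psi z) ('D_((0, v) : Z) Psi z) = 0 /\
        bilin 1%:M ('D_((0, v) : Z) Psi z) ('D_((0, v') : Z) Psi z) = C z.1 * bilin (G z) v v') &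
      forall p w w', cyl p0 r (p, w) -> cyl p0 r (p, w') -> Psi (p, w) = Psi (p, w') -> w = w'].
Proof.
have [r [X [r0 rO sX dX gX]]] := development_system.
have oU : open (cyl p0 r : set Z) by exact: open_cyl.
pose Psi z : 'rV[R]_n.+1 := \row_al X al ord0 z.
have PsiE z al : Psi z 0 al = X al ord0 z by rewrite mxE.
have sPsi : smooth_on (cyl p0 r) Psi.
  apply: smooth_on_row => // al; apply: (@eq_smooth _ _ _ oU _ (X al ord0)) => //.
have dPsi z v al : cyl p0 r z -> ('D_((0, v) : Z) Psi z) 0 al = \sum_j v 0 j * X al (lift ord0 j) z.
  move=> Uz; rewrite -derive_coord; last exact: smooth_differentiable sPsi Uz.
  have -> : (fun z => Psi z 0 al) = X al ord0 by apply/funext => z'; rewrite PsiE.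
  rewrite (derive_dw fP); last exact: smooth_differentiable (sX al ord0) Uz.
  by apply: eq_bigr => j _; rewrite dX.
(* the chord matrix, whose Gram matrix on the diagonal is [C] times the metric *)
pose q0 : P * ('rV[R]_n * 'rV[R]_n) := (p0, (0, 0)).
pose hc al (i : 'I_n) q := hadamard_coef (fV := row_frame n) (X al ord0) i q.
pose S q : 'M[R]_n := \matrix_(i, k) \sum_al hc al i q * hc al k q.
have oH : open (hadamard_dom (cyl p0 r : set Z)) by exact: open_hadamard_dom.
have conv p (z z' : 'rV[R]_n) (t : R) : cyl p0 r (p, z) -> cyl p0 r (p, z') -> 0 <= t <= 1 ->
    cyl p0 r (p, z + t *: (z' - z)).
  move=> h h' t01; have := cyl_convex h h' t01.
  rewrite (_ : (p, z) + t *: _ = (p, z + t *: (z' - z)))//.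
  by apply: injective_projections => /=; rewrite ?subrr ?scaler0 ?addr0.
have shc al i : smooth_on (hadamard_dom (cyl p0 r : set Z)) (hc al i).
  by move=> k; exact: (Ck_hadamard fP (fV := row_frame n) oU conv i (sX al ord0 k.+1)).
have U0 : cyl p0 r (p0, 0 : 'rV[R]_n) by split => /=; exact: ballxx.
have S0 : S q0 = C p0 *: G (p0, 0).
  apply/matrixP => i k; rewrite !mxE -(sphere_gramll i k (p0, 0)) -gX//.
  by apply: eq_bigr => al _; rewrite /hc !hadamard_diag -!/(dw _ _ _) !dX.
have sS : smooth_mx (hadamard_dom (cyl p0 r : set Z)) S.
  move=> i k; apply: (@eq_smooth _ _ _ oH _ (fun q => \sum_al hc al i q * hc al k q)).
    by move=> q _; rewrite mxE.
  by apply: (smooth_sum oH) => al _; apply: (smoothM oH).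
have H0 : hadamard_dom (cyl p0 r : set Z) q0 by [].
have nS : \forall q \near q0, \det (S q) != 0.
  have c : {for q0, continuous (fun q => \det (S q))}.
    exact: (Ck_continuous (smooth_det oH sS 0%N)).
  apply: (cvgr_neq0 _ c); rewrite S0 detZ mulf_neq0//.
    by rewrite expf_neq0// lt0r_neq0//; exact: C_gt0 O0.
  by have := posdef_unit (pG O0); rewrite unitmxE unitfE.
have /nbhs_ballP[e /= e0 eS] := nS.
pose r' := Num.min r e.
have r'0 : 0 < r' by rewrite lt_min r0.
have r'U : (cyl p0 r' : set Z) `<=` cyl p0 r.
  by move=> z [z1 z2]; split; [apply: le_ball z1|apply: le_ball z2]; rewrite ge_min lexx.
exists r', Psi; split => //.
- by move=> z /r'U/rO.
- exact: smooth_subset sPsi.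
- split => [z /r'U Uz|z v v' /r'U Uz].
    rewrite bilin1E -[RHS](sphere_gram00 z) -gX//.
    by apply: eq_bigr => al _; rewrite PsiE.
  split.
    rewrite bilin1E; under eq_bigr do rewrite PsiE dPsi// mulr_sumr.
    rewrite exchange_big/= big1// => j _.
    under eq_bigr do rewrite mulrCA.
    by rewrite -mulr_sumr gX// sphere_gram0l mulr0.
  rewrite bilin1E bilinE mulr_sumr.
  under eq_bigr do rewrite !dPsi// mulr_suml.
  rewrite exchange_big/=; apply: eq_bigr => i _; rewrite mulr_sumr.
  under eq_bigr do rewrite mulr_sumr.
  rewrite exchange_big/=; apply: eq_bigr => k _.
  transitivity (v 0 i * v' 0 k * \sum_al X al (lift ord0 i) z * X al (lift ord0 k) z).
    by rewrite mulr_sumr; apply: eq_bigr => al _; ring.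
  by rewrite gX// sphere_gramll; ring.
- move=> p w w' Uw Uw' PP; pose q : P * ('rV[R]_n * 'rV[R]_n) := (p, (w, w')).
  have Sq : \det (S q) != 0.
    have bl (V : normedModType R) (x y : V) : ball x r' y -> ball x e y.
      by apply: le_ball; rewrite ge_min lexx orbT.
    by apply: eS; case: Uw => pw ww; case: Uw' => _ ww'; split; [exact: bl|split; exact: bl].
  pose u := w' - w.
  have Hu al : \sum_i u 0 i * hc al i q = 0.
    have := hadamardE fP (row_frame n) oU conv (sX al ord0 1%N) (r'U _ Uw) (r'U _ Uw').
    rewrite -!PsiE PP subrr => e1; rewrite /hc /q; exact: (esym e1).
  have uS : u *m S q = 0.
    apply/rowP => k; rewrite !mxE.
    transitivity (\sum_al (\sum_i u 0 i * hc al i q) * hc al k q); last first.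
      by apply: big1 => al _; rewrite Hu mul0r.
    under [RHS]eq_bigr do rewrite mulr_suml.
    rewrite [RHS]exchange_big/=; apply: eq_bigr => i _; rewrite [S q i k]mxE mulr_sumr.
    by apply: eq_bigr => al _; rewrite mulrA.
  have u0 : u = 0.
    have uq : S q \in unitmx by rewrite unitmxE unitfE.
    by rewrite -(mulmxK uq u) uS mul0mx.
  by apply/eqP; rewrite eq_sym -subr_eq0 -/u u0.
Qed.

End Development.

(** * Polar coordinates in the tangent spaces *)

Section LocalDeformation.
Context {R : realType} (n : nat).
Local Notation W := 'rV[R]_n.+1.
Local Notation V := 'rV[R]_n.
Variables (M : set W) (D : set (W * W)) (F : W * W -> R).
Hypothesis hF : finsler_space M D F.

Lemma smooth_fundamental_tensor : smooth_mx D (fun z => fundamental_tensor F z.1 z.2).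
Proof.
have oD := finsler_domain_open hF; move=> i j.
apply: (@eq_smooth _ _ _ oD _ (fun z => 2^-1 *
  'D_((0, delta_mx 0 i) : W * W) ('D_((0, delta_mx 0 j) : W * W) (fun z => F z ^+ 2)) z)).
  move=> [x y] _; rewrite fundamental_tensorE hessianE.
  have -> : partial_der j (fun y' => F (x, y') ^+ 2) =
      (fun y' => 'D_((0, delta_mx 0 j) : W * W) (fun z => F z ^+ 2) (x, y')).
    apply/funext => y'; exact: (derive_pair_snd (fun z => F z ^+ 2) x y' (delta_mx 0 j)).
  congr (_ * _); exact: (esym (derive_pair_snd
    ('D_((0, delta_mx 0 j) : W * W) (fun z => F z ^+ 2)) x y (delta_mx 0 i))).
apply: (smoothM oD); first exact: smooth_cst.
by do 2!apply: smooth_der; apply: (smoothM oD); exact: (finsler_smooth hF).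
Qed.

Variables (y0 : W) (B : 'M[R]_(n, n.+1)).
Local Notation O := (ray_dom D y0 B).
Local Notation phi := (ray_chart F y0 B).

Definition ray_metric (z : W * V) : 'M[R]_n :=
  induced_metric F z.1 (fun w => phi (z.1, w)) z.2.

Lemma smooth_ray_metric : smooth_mx O ray_metric.
Proof.
have oO : open O := @open_ray_dom _ _ _ _ _ hF y0 B.
have sphi : smooth_on O phi := @smooth_ray_chart _ _ _ _ _ hF y0 B.
have sE : smooth_mx O (fun z => fundamental_tensor F z.1 (phi z)).
  move=> i j; apply: (smooth_comp oO (prod_frame (row_frame _) (row_frame _))
    (f := fun z : W * W => fundamental_tensor F z.1 z.2 i j) (g := fun z => (z.1, phi z)) _
    (smooth_fundamental_tensor i j)).
    by apply: (smooth_pair oO) => // k; apply: Ck_fst_comp oO _; exact: Ck_id.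
  by move=> z /(ray_chart_unit hF)[].
have sd i : smooth_mx O ('D_((0, delta_mx 0 i) : W * V) phi).
  by move=> u k; rewrite ord1; apply: (smooth_row_coord oO); exact: smooth_der.
move=> i j; apply: (@eq_smooth _ _ _ oO _ (fun z => bilin (fundamental_tensor F z.1 (phi z))
  ('D_((0, delta_mx 0 i) : W * V) phi z) ('D_((0, delta_mx 0 j) : W * V) phi z))).
  by move=> [x w] _; rewrite [RHS]mxE /= /partial_der !derive_pair_snd.
exact: smooth_bilin.
Qed.

(* [y *m t] and [y *m S] are the coordinates of [y] in the basis formed by [y0]
   and the rows of [B]. *)
Variables (t : 'cV[R]_n.+1) (S : 'M[R]_(n.+1, n)).
Hypothesis tS : t *m y0 + S *m B = 1%:M.

(** The factor of [y0] in [y]; the points with positive height lie on the rays of the chart. *)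
Definition height (y : W) : R := (y *m t) 0 0.
(** The chart coordinates of the ray of [y]. *)
Definition slope (y : W) : V := (height y)^-1 *: (y *m S).

Let T : set W := [set y | 0 < height y].

Lemma smooth_height (U : set W) : open U -> smooth_on U height.
Proof.
move=> oU; apply: (smooth_row_coord oU (f := fun y => y *m t) (0 : 'I_1)).
by apply: (mulmxr_smooth t oU) => k; exact: Ck_id.
Qed.

Lemma open_height : open T.
Proof.
apply: (open_comp (f := height) (D := [set t | 0 < t])) => [y _|]; last exact: open_gt.
exact: (smooth_height openT 0%N).
Qed.

Lemma smooth_slope : smooth_on T slope.
Proof.
have oT := open_height; have st := smooth_height oT.
apply: (smooth_on_row oT) => i.
apply: (@eq_smooth _ _ _ oT _ (fun y => (height y)^-1 * (y *m S) 0 i)).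
  by move=> y _; rewrite [RHS]mxE.
apply: (smoothM oT); first by apply: (smoothV oT) => // y /lt0r_neq0.
apply: (smooth_row_coord oT (f := fun y => y *m S)).
by apply: (mulmxr_smooth S oT) => k; exact: Ck_id.
Qed.

Lemma height_hom (l : R) y : height (l *: y) = l * height y.
Proof. by rewrite /height -scalemxAl mxE. Qed.

Lemma slope_hom (l : R) y : 0 < l -> slope (l *: y) = slope y.
Proof.
move=> l0; rewrite /slope height_hom -scalemxAl scalerA invfM mulrC mulrA mulfV ?mul1r//.
exact: lt0r_neq0.
Qed.

Lemma ray_pointE y : 0 < height y -> height y *: ray_point y0 B (slope y) = y.
Proof.
move=> h0; rewrite /ray_point /slope scalerDr -scalemxAl scalerA mulfV ?lt0r_neq0// scale1r.
rewrite -[RHS]mulmx1 -tS mulmxDr !mulmxA; congr (_ + _).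
by rewrite -mul_scalar_mx; congr (_ *m _); rewrite /height [RHS]mx11_scalar.
Qed.

Section Point.
Variables x y : W.
Hypotheses (hy : 0 < height y) (Oy : O (x, slope y)).

Lemma ray_dom_domain : D (x, y).
Proof. by rewrite -(ray_pointE hy); exact: (finsler_domain_conic hF). Qed.

Lemma ray_chart_slope : phi (x, slope y) = (F (x, y))^-1 *: y.
Proof.
have h0 := lt0r_neq0 hy; have p0 := lt0r_neq0 (ray_norm_gt0 hF Oy).
rewrite -{2 3}(ray_pointE hy) (finsler_hom hF hy Oy) /ray_chart/= scalerA.
by congr (_ *: _); field; rewrite p0 h0.
Qed.

Let r0 : 0 < F (x, y). Proof. exact: (finsler_pos hF ray_dom_domain). Qed.

Let dF : differentiable (fun y => F (x, y)) y.
Proof. exact: smooth_differentiable (smooth_norm hF x) ray_dom_domain. Qed.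

Let dslope : differentiable slope y. Proof. exact: smooth_differentiable smooth_slope hy. Qed.

Let Dphi u := 'D_u (fun w => phi (x, w)) (slope y).

Let dphi : differentiable (fun w => phi (x, w)) (slope y).
Proof.
have oO : open O := @open_ray_dom _ _ _ _ _ hF y0 B.
have sphi : smooth_on O phi := @smooth_ray_chart _ _ _ _ _ hF y0 B.
exact: smooth_differentiable (smooth_row_section (row_frame _) (row_frame _) x oO sphi) Oy.
Qed.

(** Polar coordinates [y = F *: phi]. *)
Lemma polar_velocity v : v = 'D_v (fun y => F (x, y)) y *: phi (x, slope y) +
  F (x, y) *: Dphi ('D_v slope y).
Proof.
have op : open [set y | D (x, y)] := open_section x (finsler_domain_open hF).
apply/rowP => i.
pose c (y' : W) := phi (x, slope y') 0 i.
have dc : differentiable c y.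
  have dps : differentiable (fun y' => phi (x, slope y')) y by exact: differentiable_comp dphi.
  have cl : linear (fun v : W => v 0 i) by move=> k u u'; rewrite !mxE.
  have cc : continuous (fun v : W => v 0 i) by exact: coord_continuous.
  by have [] := differentiable_linear_comp cl cc dps.
have Dc : 'D_v c y = Dphi ('D_v slope y) 0 i.
  rewrite /c derive_coord; last exact: differentiable_comp dphi.
  by rewrite (derive_comp v dslope dphi).
transitivity ('D_v (fun y' : W => y' 0 i) y).
  apply/esym; apply: derive_linear; first by move=> k u u'; rewrite !mxE.
  exact: coord_continuous.
transitivity ('D_v (fun y' => F (x, y') * c y') y).
  apply: near_eq_derive.
  have hT : \forall y' \near y, 0 < height y' by exact: open_nbhs_nbhs (conj open_height hy).
  have hO : \forall y' \near y, O (x, slope y').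
    have oO : open [set w | O (x, w)] := open_section x (@open_ray_dom _ _ _ _ _ hF y0 B).
    exact: (differentiable_continuous dslope) _ (open_nbhs_nbhs (conj oO Oy)).
  apply: filterS2 hT hO => y' hy' Oy'.
  have Dy' : D (x, y') by rewrite -(ray_pointE hy'); exact: (finsler_domain_conic hF).
  have p0 := lt0r_neq0 (ray_norm_gt0 hF Oy').
  rewrite /c /ray_chart/= mxE -{1 2}(ray_pointE hy') (finsler_hom hF hy' Oy') mxE.
  by field.
by rewrite deriveM_fun// Dc [RHS]mxE [X in _ = X + _]mxE [X in _ = _ + X]mxE.
Qed.

(** The fundamental tensor in polar coordinates is the metric of a cone over
    the indicatrix. *)
Lemma fundamental_tensor_polar v v' : bilin (fundamental_tensor F x y) v v' =
  'D_v (fun y => F (x, y)) y * 'D_v' (fun y => F (x, y)) y +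
  F (x, y) ^+ 2 * bilin (ray_metric (x, slope y)) ('D_v slope y) ('D_v' slope y).
Proof.
have op : open [set y | D (x, y)] := open_section x (finsler_domain_open hF).
have coneU := fun y l (l0 : 0 < l) => finsler_domain_conic hF (x := x) (y := y) l0.
have homU := fun y l (l0 : 0 < l) => finsler_hom hF (x := x) (y := y) l0.
have sF := smooth_norm hF x.
have [Dp Fp] := ray_chart_unit hF Oy.
pose p := phi (x, slope y).
have gE : fundamental_tensor F x y = fundamental_tensor F x p.
  rewrite /p ray_chart_slope !fundamental_tensorE (hessian_hom op sF coneU homU)//.
    by rewrite invr_gt0.
  exact: ray_dom_domain.
have gpp : bilin (fundamental_tensor F x p) p p = 1.
  by rewrite fundamental_tensorE (bilin_hessian_self op sF coneU homU Dp) Fp expr1n.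
have gpD u : bilin (fundamental_tensor F x p) p (Dphi u) = 0.
  rewrite fundamental_tensorE -(derive_norm_hessian op sF coneU homU _ Dp) Fp mul1r.
  have dFp : differentiable (fun y => F (x, y)) p by exact: smooth_differentiable sF Dp.
  rewrite -(derive_comp u dphi dFp).
  rewrite -[RHS](derive_cst (1 : R) (slope y) u); apply: near_eq_derive.
  have oO : open [set w | O (x, w)] := open_section x (@open_ray_dom _ _ _ _ _ hF y0 B).
  by apply: filterS (open_nbhs_nbhs (conj oO Oy)) => w /(ray_chart_unit hF)[].
have gDp u : bilin (fundamental_tensor F x p) (Dphi u) p = 0.
  by rewrite (bilin_sym _ _ (proj1 (finsler_posdef hF Dp))) gpD.
have gDD u u' : bilin (ray_metric (x, slope y)) u u' =
    bilin (fundamental_tensor F x p) (Dphi u) (Dphi u').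
  exact: (bilin_gram _ _ _ dphi).
rewrite {1}(polar_velocity v) {1}(polar_velocity v') gE -/p.
have pD := gpD ('D_v' slope y); have Dp' := gDp ('D_v slope y); rewrite gDD.
have comb (g : 'M[R]_n.+1) (p1 q q' : W) (a b r : R) : bilin g p1 p1 = 1 -> bilin g p1 q' = 0 ->
    bilin g q p1 = 0 -> bilin g (a *: p1 + r *: q) (b *: p1 + r *: q') = a * b + r ^+ 2 * bilin g q q'.
  move=> h1 h2 h3; rewrite !bilinDl !bilinDr !bilinZl !bilinZr h1 h2 h3; ring.
exact: comb.
Qed.

End Point.

End LocalDeformation.

(** * The deformation defined by a development *)

Section DevelopedDeformation.
Context {R : realType} (n : nat).
Local Notation W := 'rV[R]_n.+1.
Local Notation V := 'rV[R]_n.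
Variables (M : set W) (D : set (W * W)) (F : W * W -> R).
Hypothesis hF : finsler_space M D F.
Variables (y0 : W) (B : 'M[R]_(n, n.+1)) (t : 'cV[R]_n.+1) (S : 'M[R]_(n.+1, n)).
Hypothesis tS : t *m y0 + S *m B = 1%:M.
Local Notation O := (ray_dom D y0 B).
Local Notation G := (ray_metric F y0 B).
Local Notation height := (height t).
Local Notation slope := (slope t S).
Variables (C : W -> R) (x1 : W) (r : R) (Psi : W * V -> W).
Hypotheses (C_gt0 : forall x, M x -> 0 < C x) (sC : smooth_on O (fun z => C z.1)).
Let U : set (W * V) := cyl x1 r.
Hypotheses (UO : U `<=` O) (sPsi : smooth_on U Psi).
Hypothesis Psi1 : forall z, U z -> bilin 1%:M (Psi z) (Psi z) = 1.
Hypothesis PsiD : forall z v v', U z ->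
  bilin 1%:M (Psi z) ('D_((0, v) : W * V) Psi z) = 0 /\
  bilin 1%:M ('D_((0, v) : W * V) Psi z) ('D_((0, v') : W * V) Psi z) = C z.1 * bilin (G z) v v'.
Hypothesis Psi_inj : forall p w w', U (p, w) -> U (p, w') -> Psi (p, w) = Psi (p, w') -> w = w'.

Let H x := Num.sqrt (C x).
Let a x := 1 - H x.

Definition developed_dom : set (W * W) :=
  [set z | 0 < height z.2 /\ U (z.1, slope z.2)].

Definition developed_map (z : W * W) : W := F z `^ H z.1 *: Psi (z.1, slope z.2).

Definition developed_factor (z : W * W) : R := (H z.1 ^+ 2)^-1 * F z `^ (2 * a z.1).

Local Notation W' := developed_dom.

Lemma developed_dom_sub : W' `<=` D.
Proof. by move=> [x y] [hy Uy]; apply: (ray_dom_domain hF tS hy); exact: UO. Qed.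

Let o2 : open [set z : W * W | 0 < height z.2].
Proof.
apply: (open_comp (f := fun z : W * W => height z.2) (D := [set s | 0 < s])) => [z _|];
  last exact: open_gt.
have sh : smooth_on setT (fun z : W * W => height z.2).
  apply: (smooth_comp openT (row_frame _) (f := height) (g := fun z : W * W => z.2) _
    (smooth_height t openT)) => //.
  by move=> k; apply: Ck_snd_comp openT _; exact: Ck_id.
exact: (sh 0%N z I).
Qed.

Let oU : open U. Proof. exact: open_cyl. Qed.

Lemma smooth_developed_arg : smooth_on [set z : W * W | 0 < height z.2] (fun z => (z.1, slope z.2)).
Proof.
apply: (smooth_pair o2); first by move=> k; apply: Ck_fst_comp o2 _; exact: Ck_id.
apply: (smooth_on_row o2) => i; apply: (smooth_comp o2 (row_frame _) (U' := [set y | 0 < height y])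
   (f := fun y => slope y 0 i) (g := fun z : W * W => z.2)) => //.
  by move=> k; apply: Ck_snd_comp o2 _; exact: Ck_id.
exact: (smooth_row_coord (@open_height _ _ t) i (@smooth_slope _ _ t S)).
Qed.

Lemma open_developed_dom : open W'.
Proof.
apply: (open_preimage (phi := fun z : W * W => (z.1, slope z.2)) o2 _ oU) => z hz.
exact: (Ck_continuous (smooth_developed_arg 0%N)).
Qed.

Let sarg : smooth_on W' (fun z => (z.1, slope z.2)).
Proof. by apply: smooth_subset smooth_developed_arg => z []. Qed.

Let fWV := prod_frame (row_frame (R := R) n.+1) (row_frame (R := R) n).

Let sF : smooth_on W' F.
Proof. by apply: smooth_subset (finsler_smooth hF); exact: developed_dom_sub. Qed.

Let M_dom z : W' z -> M z.1.
Proof. by move=> /developed_dom_sub /(finsler_domain_sub hF)[]. Qed.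

Let F_gt0 z : W' z -> 0 < F z.
Proof. by case: z => x y /developed_dom_sub; exact: (finsler_pos hF). Qed.

Let H_gt0 z : W' z -> 0 < H z.1.
Proof. by move=> /M_dom Mz; rewrite sqrtr_gt0 C_gt0. Qed.

Let H2 z : W' z -> H z.1 ^+ 2 = C z.1.
Proof. by move=> /M_dom Mz; rewrite sqr_sqrtr// ltW// C_gt0. Qed.

Let sC' : smooth_on W' (fun z => C z.1).
Proof.
apply: (smooth_comp open_developed_dom fWV (f := fun z : W * V => C z.1) sarg sC).
by move=> z [_ /UO].
Qed.

Let sH : smooth_on W' (fun z => H z.1).
Proof.
apply: (@eq_smooth _ _ _ open_developed_dom _ (fun z => C z.1 `^ 2^-1)).
  by move=> z /M_dom Mz; rewrite powR12_sqrt// ltW// C_gt0.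
apply: (smooth_powR open_developed_dom _ sC'); last exact: smooth_cst.
by move=> z /M_dom; exact: C_gt0.
Qed.

Let W_hom x y (l : R) : 0 < l -> W' (x, y) -> W' (x, l *: y).
Proof.
move=> l0 [hy Uy]; split; first by rewrite /= height_hom mulr_gt0.
by rewrite /= slope_hom.
Qed.

Let sdev : smooth_on W' developed_map.
Proof.
have oW := open_developed_dom.
apply: (smooth_on_row oW) => i.
apply: (@eq_smooth _ _ _ oW _ (fun z => F z `^ H z.1 * Psi (z.1, slope z.2) 0 i)).
  by move=> z _; rewrite [RHS]mxE.
apply: (smoothM oW); first exact: (smooth_powR oW).
apply: (smooth_comp oW fWV (U' := U) (f := fun z => Psi z 0 i) sarg); last by move=> z [].
exact: (smooth_row_coord oU i sPsi).
Qed.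

Let norm_dev z : W' z -> bilin 1%:M (developed_map z) (developed_map z) = (F z `^ H z.1) ^+ 2.
Proof. by move=> [hz Uz]; rewrite bilinZl bilinZr Psi1// mulr1 expr2. Qed.

Let powR_eq (x y z : R) : 0 < x -> 0 < y -> 0 < z -> x `^ z = y `^ z -> x = y.
Proof.
move=> x0 y0' z0 e; apply: (powR_injective z0) => //; rewrite nnegrE ltW//.
Qed.

(** Both members are the metric of a cone, of total angle scaled by [H]. *)
Lemma developed_conformal x y v v' : W' (x, y) ->
  bilin (fundamental_tensor F x y) v v' = developed_factor (x, y) *
  bilin 1%:M ('D_v (fun y => developed_map (x, y)) y) ('D_v' (fun y => developed_map (x, y)) y).
Proof.
move=> Wxy; have [hy Uy] := Wxy.
have Dxy : D (x, y) := developed_dom_sub Wxy.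
have f0 := F_gt0 Wxy; have h0 := H_gt0 Wxy.
have dF : differentiable (fun y => F (x, y)) y.
  exact: smooth_differentiable (smooth_norm hF x) Dxy.
have dsl : differentiable slope y.
  by apply: (smooth_differentiable (smooth_slope t S)).
have dPsi : differentiable (fun w => Psi (x, w)) (slope y).
  exact: smooth_differentiable (smooth_row_section (row_frame _) (row_frame _) x oU sPsi) Uy.
pose k y' := F (x, y') `^ H x.
pose kp := H x * F (x, y) `^ (H x - 1).
have dpow : is_derive (F (x, y)) (1 : R) ((powR (R:=R))^~ (H x)) kp by exact: is_derive1_powR.
have dpw : differentiable ((powR (R:=R))^~ (H x)) (F (x, y)).
  by apply/derivable1_diffP; have [] := dpow.
have dk : differentiable k y by exact: (differentiable_comp dF dpw).
have Dk u : 'D_u k y = 'D_u (fun y => F (x, y)) y * kp.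
  rewrite /k (derive_comp u dF dpw).
  have -> : 'D_u (fun y => F (x, y)) y = 'D_u (fun y => F (x, y)) y *: (1 : R).
    by rewrite /GRing.scale/= mulr1.
  rewrite derive_scaled_dir// (derive_val (is_derive := dpow)).
  by rewrite [in RHS]/GRing.scale/= mulr1.
have dps : differentiable (fun y' => Psi (x, slope y')) y by exact: (differentiable_comp dsl dPsi).
have Dps u : 'D_u (fun y' => Psi (x, slope y')) y = 'D_((0, 'D_u slope y) : W * V) Psi (x, slope y).
  by rewrite (derive_comp u dsl dPsi) derive_pair_snd.
have ddev : differentiable (fun y => developed_map (x, y)) y.
  exact: smooth_differentiable (smooth_row_section (row_frame _) (row_frame _) x open_developed_dom sdev) Wxy.
have Dev u : 'D_u (fun y => developed_map (x, y)) y =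
    'D_u k y *: Psi (x, slope y) + k y *: 'D_((0, 'D_u slope y) : W * V) Psi (x, slope y).
  apply/rowP => i; rewrite -derive_coord//.
  have -> : (fun y => developed_map (x, y) 0 i) = (fun y => k y * Psi (x, slope y) 0 i).
    by apply/funext => y'; rewrite [LHS]mxE.
  have dpi : differentiable (fun y => Psi (x, slope y) 0 i) y.
    have cl : linear (fun v : W => v 0 i) by move=> c u' u''; rewrite !mxE.
    have cc : continuous (fun v : W => v 0 i) by exact: coord_continuous.
    by have [] := differentiable_linear_comp cl cc dps.
  by rewrite deriveM_fun// derive_coord// Dps [RHS]mxE [X in _ = X + _]mxE [X in _ = _ + X]mxE.
rewrite (fundamental_tensor_polar hF tS hy (UO Uy)) !Dev !Dk.
have [pv dvv] := PsiD ('D_v slope y) ('D_v' slope y) Uy.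
have [pv' _] := PsiD ('D_v' slope y) ('D_v' slope y) Uy.
have comb (p q q' : W) (c d m : R) : bilin 1%:M p p = 1 -> bilin 1%:M p q' = 0 ->
    bilin 1%:M p q = 0 ->
    bilin 1%:M (c *: p + m *: q) (d *: p + m *: q') = c * d + m ^+ 2 * bilin 1%:M q q'.
  move=> h1 h2 h3; have h4 : bilin 1%:M q p = 0 by rewrite bilin_sym ?trmx1.
  by rewrite !bilinDl !bilinDr !bilinZl !bilinZr h1 h2 h4; ring.
rewrite (comb _ _ _ _ _ _ (Psi1 Uy) pv' pv) dvv /= -(H2 Wxy)/= /developed_factor /a/= /kp /k.
have Hn : H x != 0 by exact: lt0r_neq0 h0.
have rn : F (x, y) != 0 by exact: lt0r_neq0.
have p0 : F (x, y) `^ H x != 0 by rewrite lt0r_neq0// powR_gt0.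
have -> : F (x, y) `^ (H x - 1) = F (x, y) `^ H x / F (x, y).
  by rewrite powRB ?rn ?implybT// powRr1// ltW.
have -> : F (x, y) `^ (2 * (1 - H x)) = (F (x, y) / F (x, y) `^ H x) ^+ 2.
  by rewrite mulrC powRrM powRB ?rn ?implybT// powRr1 ?ltW// powR_mulrn// divr_ge0// ?powR_ge0// ltW.
move: ('D_v (fun y => F (x, y)) y) ('D_v' (fun y => F (x, y)) y) (bilin _ _ _) => d d' g.
by field; rewrite p0 rn Hn.
Qed.

Lemma developed_deformation :
  deformation F (fun=> 1%:M) H a W' developed_map developed_factor.
Proof.
have dm_pos x y : W' (x, y) -> 0 < developed_factor (x, y).
  by move=> Wxy; rewrite mulr_gt0 ?invr_gt0 ?exprn_gt0 ?powR_gt0 ?H_gt0 ?F_gt0.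
have pinj x y y' : W' (x, y) -> W' (x, y') ->
    F (x, y) `^ H x = F (x, y') `^ H x -> F (x, y) = F (x, y').
  by move=> h h'; apply: powR_eq; [exact: F_gt0 h|exact: F_gt0 h'|exact: H_gt0 h].
have conf_mx x y : W' (x, y) -> fundamental_tensor F x y =
    developed_factor (x, y) *: pullback_metric (fun=> 1%:M) developed_map x y.
  move=> Wxy; apply/matrixP => i j; rewrite -bilin_delta (developed_conformal _ _ Wxy).
  by rewrite [RHS]mxE [X in _ = _ * X]mxE.
split => //.
- exact: open_developed_dom.
- move=> x y y' Wy Wy' e.
  have e2 : (F (x, y) `^ H x) ^+ 2 = (F (x, y') `^ H x) ^+ 2.
    by rewrite -(norm_dev Wy) -(norm_dev Wy') e.
  have e1 : F (x, y) `^ H x = F (x, y') `^ H x.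
    by apply/eqP; rewrite -(eqrXn2 (n := 2)) ?powR_ge0 ?e2.
  have FF := pinj x y y' Wy Wy' e1.
  have [hy Uy] := Wy; have [hy' Uy'] := Wy'.
  have es : slope y = slope y'.
    apply: (Psi_inj Uy Uy'); have pn : F (x, y) `^ H x != 0 by rewrite lt0r_neq0// powR_gt0// F_gt0.
    by apply: (scalerI pn); move: e; rewrite /developed_map/= -FF.
  have c1 := ray_chart_slope hF tS hy (UO Uy); have c2 := ray_chart_slope hF tS hy' (UO Uy').
  have rn : (F (x, y))^-1 != 0 by rewrite invr_eq0 lt0r_neq0// F_gt0.
  by apply: (scalerI rn); rewrite -c1 es c2 FF.
- move=> x y Wxy v Dv0; apply/eqP/negPn/negP => v0.
  have [_ /(_ v v0)] := finsler_posdef hF (developed_dom_sub Wxy).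
  by rewrite (developed_conformal _ _ Wxy) Dv0 bilin0l mulr0 ltxx.
- move=> x y l l0 Wxy; rewrite /developed_map/= (finsler_hom hF l0 (developed_dom_sub Wxy)).
  by rewrite powRM ?(ltW l0) ?(ltW (F_gt0 Wxy))// slope_hom// scalerA.
- move=> x y Wxy; rewrite /riemannian_norm norm_dev// sqrtr_sqr ger0_norm ?powR_ge0//=.
  split => [->|e]; first by rewrite powR1.
  apply: (powR_eq (F_gt0 Wxy) ltr01 (H_gt0 Wxy)); by rewrite powR1.
- apply: (smoothM open_developed_dom).
    apply: (smoothV open_developed_dom) => [z Wz|]; first by rewrite expf_neq0// lt0r_neq0// H_gt0.
    by apply: (smoothM open_developed_dom).
  apply: (smooth_powR open_developed_dom) => //.
  apply: (smoothM open_developed_dom); first exact: (smooth_cst W' (2 : R)).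
  apply: (smoothB open_developed_dom) => //; exact: (smooth_cst W' (1 : R)).
- move=> x y l l0 Wxy; rewrite /developed_factor/= (finsler_hom hF l0 (developed_dom_sub Wxy)).
  by rewrite powRM ?(ltW l0) ?(ltW (F_gt0 Wxy))// mulrCA.
Qed.

End DevelopedDeformation.

(** * Spaces with indicatrices of constant curvature *)

Section Converse.
Context {R : realType} (n : nat).
Local Notation W := 'rV[R]_n.+1.
Variables (M : set W) (D : set (W * W)) (F : W * W -> R).
Hypothesis hF : finsler_space M D F.

(** The chart is centred at the ray of [y1] and spanned by an orthonormal frame,
    whose dual basis gives the height and the slope. *)
Lemma const_curvature_deformation (C : W -> R) x1 y1 : (1 < n)%N ->
  (forall x, M x -> 0 < C x) -> (forall x, M x -> indicatrix_const_curvature D F x (C x)) ->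
  D (x1, y1) -> exists W' ybar f, [/\ W' (x1, y1), W' `<=` D &
    deformation F (fun=> 1%:M) (fun x => Num.sqrt (C x)) (fun x => 1 - Num.sqrt (C x)) W' ybar f].
Proof.
move=> n2 C_gt0 cc Dy1.
have oU := open_section x1 (finsler_domain_open hF).
have coneU := fun y l (l0 : 0 < l) => finsler_domain_conic hF (x := x1) (y := y) l0.
have homU := fun y l (l0 : 0 < l) => finsler_hom hF (x := x1) (y := y) l0.
have r0 := finsler_pos hF Dy1.
have ri : 0 < (F (x1, y1))^-1 by rewrite invr_gt0.
pose y0 := (F (x1, y1))^-1 *: y1.
have Dy0 : D (x1, y0) by exact: (finsler_domain_conic hF).
have F1 : F (x1, y0) = 1 by rewrite (finsler_hom hF)// mulVf// lt0r_neq0.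
have y1E : y1 = F (x1, y1) *: y0 by rewrite scalerA mulfV ?scale1r// lt0r_neq0.
have pg := finsler_posdef hF Dy0; set g0 := fundamental_tensor F x1 y0 in pg.
have by0 : bilin g0 y0 y0 = 1.
  by rewrite /g0 fundamental_tensorE (bilin_hessian_self oU (smooth_norm hF x1) coneU homU Dy0) F1 expr1n.
have [B [By0 BB inv]] := orthonormal_frame pg by0.
have fr := frame_free hF Dy0 By0 BB.
pose t : 'cV[R]_n.+1 := g0 *m y0^T; pose S : 'M[R]_(n.+1, n) := g0 *m B^T.
have tS : t *m y0 + S *m B = 1%:M.
  by rewrite /t /S -!mulmxA -mulmxDr -inv mulmxV// posdef_unit.
have oO : open (ray_dom D y0 B) := @open_ray_dom _ _ _ _ _ hF y0 B.
have sG := smooth_ray_metric hF y0 B.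
have pG z : ray_dom D y0 B z -> posdef (ray_metric F y0 B z) 
  by case: z => x w Oz; exact: (posdef_induced_metric hF (ray_chart_param hF fr x) Oz).
have ccl p : const_curvature (leaf (ray_dom D y0 B) p) (leaf_metric (ray_metric F y0 B) p) (C p).
  move=> w Ow; have [Mp _] := finsler_domain_sub hF Ow.
  exact: (cc p Mp _ _ (ray_chart_param hF fr p) w Ow).
have sC := smooth_leaf_curvature oO sG pG n2 ccl.
have O_gt0 z : ray_dom D y0 B z -> 0 < C z.1.
  by move=> /(finsler_domain_sub hF)[Mz _]; exact: C_gt0.
have O0 : ray_dom D y0 B (x1, 0) := ray_dom0 B Dy0.
have [r [Psi [rpos rO sPsi [P1 PD] Pinj]]] :=
  parametric_development (row_frame _) oO O0 sG pG sC O_gt0 ccl.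
exists (developed_dom t S x1 r), (developed_map F t S C Psi), (developed_factor F C); split.
- have hy0 : height t y0 = 1 by rewrite /height /t mulmxA.
  split; first by rewrite /= y1E height_hom hy0 mulr1.
  have -> : slope t S (x1, y1).2 = 0.
    rewrite /= y1E slope_hom// /slope /S mulmxA.
    have -> : y0 *m g0 *m B^T = 0.
      by apply: trmx_inj; rewrite !trmx_mul trmxK (proj1 pg) mulmxA By0 trmx0.
    by rewrite scaler0.
  by split => /=; exact: ballxx.
- exact: (developed_dom_sub hF tS rO).
- exact: (developed_deformation hF tS C_gt0 sC rO sPsi P1 PD Pinj).
Qed.

Lemma const_curvature_FN : (1 < n)%N ->
  (forall x, M x -> exists C : R, 0 < C /\ indicatrix_const_curvature D F x C) ->
  FN_space M D F.
Proof.
move=> n2 hC.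
have /choice[C CP] : forall x, exists C : R, M x -> 0 < C /\ indicatrix_const_curvature D F x C.
  move=> x; have [Mx|Mx] := pselect (M x); first by have [c hc] := hC x Mx; exists c.
  by exists 0.
exists (fun=> 1%:M), (fun x => Num.sqrt (C x)), (fun x => 1 - Num.sqrt (C x)); split.
  split => [i j|x _]; first exact: smooth_cst.
  split; first by rewrite trmx1.
  move=> v v0; rewrite /bilin mulmx1 lt_neqAle eq_sym dot_ge0 andbT.
  by apply/eqP => /dot_eq0 vE; rewrite vE eqxx in v0.
move=> [x y] Dxy; apply: const_curvature_deformation => // x' /CP[] //.
Qed.

End Converse.

Lemma FN_degree (R : realType) (n : nat) (M : set 'rV[R]_n.+1)
    (D : set ('rV[R]_n.+1 * 'rV[R]_n.+1)) (F : 'rV[R]_n.+1 * 'rV[R]_n.+1 -> R) A H a x :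
  finsler_space M D F -> FN_structure M D F A H a -> M x -> H x != 0 /\ H x = 1 - a x.
Proof.
move=> hF [[_ pA] loc] Mx; have [y Dxy] := finsler_domain_fiber hF Mx.
have [W [ybar [f [Wxy WD def]]]] := loc _ Dxy.
split; first exact: (deform_degree_neq0 hF WD def (pA x Mx) Wxy).
exact: (deform_degree hF WD def (pA x Mx) Wxy).
Qed.

Theorem mainTheorem5 (R : realType) (N : nat) (hN : (3 <= N)%N)
    (M : set 'rV[R]_N) (D : set ('rV[R]_N * 'rV[R]_N))
    (F : 'rV[R]_N * 'rV[R]_N -> R) (hF : finsler_space M D F) :
  (* F regular on the whole slit tangent bundle *)
  (D = slit_tangent M ->
    (FN_space M D F <->
     forall x, M x -> exists C : R, indicatrix_const_curvature D F x C)) /\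
  (* local form in the tangent spaces *)
  (FN_space M D F <->
   forall x, M x ->
     exists C : R, 0 < C /\ indicatrix_const_curvature D F x C) /\
  (forall (A : 'rV[R]_N -> 'M[R]_N) (H a : 'rV[R]_N -> R),
    FN_structure M D F A H a ->
    (forall x, M x ->
      [/\ a x != 1, H x = 1 - a x &
          indicatrix_const_curvature D F x (H x ^+ 2)]) /\
    exists c1 : 'rV[R]_N -> R,
      (forall x, M x -> 0 < c1 x) /\
      (forall W ybar f, W `<=` D -> deformation F A H a W ybar f ->
        forall x y, W (x, y) ->
          let p := c1 x * F (x, y) `^ a x in
          f (x, y) = p ^+ 2 /\
          fundamental_tensor F x y = p ^+ 2 *: pullback_metric A ybar x y)).
Proof.
case: N hN M D F hF => // n n2 M D F hF.
have FN_curv : FN_space M D F ->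
    forall x, M x -> exists C : R, 0 < C /\ indicatrix_const_curvature D F x C.
  move=> [A [H [a st]]] x Mx; exists (H x ^+ 2); split; last exact: (FN_curvature hF st).
  by have [H0 _] := FN_degree hF st Mx; rewrite exprn_even_gt0.
split; [|split].
- move=> DE; split => [/FN_curv h x /h[C [_ hC]]|h]; first by exists C.
  subst D; apply: (const_curvature_FN hF n2) => x Mx; have [C hC] := h x Mx.
  by exists C; split => //; apply: lt_le_trans ltr01 (slit_curvature_ge1 hF n2 Mx hC).
- by split => // h; exact: (const_curvature_FN hF n2).
- move=> A H a st; split => [x Mx|].
    have [H0 HE] := FN_degree hF st Mx; split => //; last exact: (FN_curvature hF st).
    by apply/eqP => a1; rewrite HE a1 subrr eqxx in H0.
  exists (fun x => `|H x|^-1); split => [x Mx|W ybar f WD def x y Wxy p].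
    by have [H0 _] := FN_degree hF st Mx; rewrite invr_gt0 normr_gt0.
  have Mx : M x by have [] := finsler_domain_sub hF (WD _ Wxy).
  have pA : posdef (A x) by have [[_ h] _] := st; exact: h.
  have fE := deform_multiplier hF WD def pA Wxy.
  by split; [exact: fE|rewrite (deform_conformal def Wxy) fE].
Qed.
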